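(* Let $\mathbb{H}_{\mathbb{C}}$ denote complex hyperbolic space of complex dimension greater than one. Then the group $\mathrm{Conf}(\partial\mathbb{H}_{\mathbb{C}})$ of conformal homeomorphisms of its boundary is a maximal convergence group. That is: (1) $\mathrm{Conf}(\partial\mathbb{H}_{\mathbb{C}})$ is a convergence group; and (2) if $G$ is a group of homeomorphisms of $\partial\mathbb{H}_{\mathbb{C}}$ which is a convergence group and $G\supseteq\mathrm{Conf}(\partial\mathbb{H}_{\mathbb{C}})$, then $G=\mathrm{Conf}(\partial\mathbb{H}_{\mathbb{C}})$.
   Context: $\partial\mathbb{H}_{\mathbb{C}}$ is the ideal boundary of $\mathbb{H}_{\mathbb{C}}$, topologically a sphere. Every isometry of $\mathbb{H}_{\mathbb{C}}$ extends to a homeomorphism of the boundary; $\mathrm{Conf}(\partial\mathbb{H}_{\mathbb{C}})$, the group of conformal homeomorphisms of $\partial\mathbb{H}_{\mathbb{C}}$, is the image of the full isometry group $\mathrm{Isom}(\mathbb{H}_{\mathbb{C}})$ (holomorphic and antiholomorphic isometries) under $f\mapsto f|_{\partial\mathbb{H}_{\mathbb{C}}}$. Convergence property: let $Y$ be a compact (metrizable) space. A family $\mathcal{F}\subset\mathrm{Homeo}(Y)$ has the convergence property if each infinite sequence $\{f_n\}$ of elements of $\mathcal{F}$ contains a subsequence which either (C1) converges uniformly to an element of $\mathrm{Homeo}(Y)$, or (C2) has the attractor-repeller property: there are points $a,r\in Y$ (possibly $a=r$) such that the subsequence converges to the constant function $a$ uniformly outside of any open neighborhood of $r$. A convergence group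 is a subgroup of $\mathrm{Homeo}(Y)$ with the convergence property (no discreteness is assumed). *)

(* Defs.v *)
From HB Require Import structures.
From mathcomp Require Import all_boot all_order all_algebra.
From mathcomp Require Import all_classical all_reals all_analysis.
From mathcomp Require Import complex.

Set Implicit Arguments.
Unset Strict Implicit.
Unset Printing Implicit Defensive.

Import Order.TTheory GRing.Theory Num.Theory.
Import numFieldNormedType.Exports.

Local Open Scope classical_set_scope.
Local Open Scope ring_scope.
Local Open Scope complex_scope.

(* [R[i]] carries the topology of its norm; [R[i]^o] is only used to transport
   the generic instances for numFieldType. *)
HB.instance Definition _ (R : realType) := NormedModule.copy R[i] R[i]^o.

Section Convergence.
Variable Y : uniformType.
Implicit Types (f g h : Y -> Y) (F G : set (Y -> Y)).

Definition homeomorphism f :=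
  continuous f /\ exists g, [/\ cancel f g, cancel g f & continuous g].

Definition homeo_subgroup G :=
  [/\ G `<=` homeomorphism,
      G id,
      (forall f g, G f -> G g -> G (f \o g)) &
      (forall f g, G f -> cancel f g -> cancel g f -> G g)].

(* When Y is compact metrizable, its uniformity is the only one inducing its
   topology, so uniform convergence does not depend on a choice of metric. *)
Definition uniform_homeo_limit (u : nat -> Y -> Y) :=
  exists2 h, homeomorphism h & {uniform, u @ \oo --> h}.

Definition attractor_repeller (u : nat -> Y -> Y) :=
  exists a r : Y, forall U : set Y, open U -> U r ->
    {uniform ~` U, u @ \oo --> (cst a : Y -> Y)}.

Definition convergence_property F :=
  forall u : nat -> Y -> Y, (forall k, F (u k)) ->
  exists2 phi : nat -> nat, {homo phi : i j / (i < j)%N} &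
    uniform_homeo_limit (u \o phi) \/ attractor_repeller (u \o phi).

Definition convergence_group G := homeo_subgroup G /\ convergence_property G.

End Convergence.

Section ComplexHyperbolic.
Variables (R : realType) (n : nat).
Implicit Types z w : 'rV[R[i]]_n.

Definition arcosh (x : R) : R := ln (x + Num.sqrt (x ^+ 2 - 1)).

(* The Hermitian form of signature (n,1) on C^(n+1), evaluated on the lifts
   (z,1) and (w,1).  In this affine chart the negative lines are the points of
   the open unit ball and the null lines those of the unit sphere. *)
Definition herm z w : R[i] := \sum_(k < n) z 0 k * (w 0 k)^* - 1.

Definition HC : set 'rV[R[i]]_n := [set z | herm z z < 0].

Definition HC_sphere : set 'rV[R[i]]_n := [set z | herm z z = 0].

(* The ideal boundary as a space of its own, with the subspace uniformity. *)
Definition HC_boundary := set_type HC_sphere.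
HB.instance Definition _ := Uniform.on HC_boundary.

(* Bergman distance:
   cosh^2 (d(z,w) / 2) = <z,w> <w,z> / (<z,z> <w,w>), where the right-hand side
   is a real number >= 1 for z and w in HC. *)
Definition HC_dist z w : R :=
  2 * arcosh (Num.sqrt
        (complex.Re (herm z w * herm w z / (herm z z * herm w w)))).

(* The full isometry group: no holomorphy is required. Values outside HC are
   irrelevant. *)
Definition HC_isometry (f : 'rV[R[i]]_n -> 'rV[R[i]]_n) :=
  set_bij HC HC f /\
  forall z w, HC z -> HC w -> HC_dist (f z) (f w) = HC_dist z w.

Definition boundary_extension (f : 'rV[R[i]]_n -> 'rV[R[i]]_n)
    (g : HC_boundary -> HC_boundary) :=
  forall xi : HC_boundary,
    f @ within HC (nbhs (set_val xi)) --> (set_val (g xi) : 'rV[R[i]]_n).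

Definition Conf : set (HC_boundary -> HC_boundary) :=
  [set g | exists2 f, HC_isometry f & boundary_extension f g].

End ComplexHyperbolic.

(* Main.v *)
From HB Require Import structures.
From mathcomp Require Import all_boot all_order all_algebra.
From mathcomp Require Import all_classical all_reals all_analysis.
From mathcomp Require Import complex.
From mathcomp Require Import ring lra.
Require Import Defs.

Set Implicit Arguments.
Unset Strict Implicit.
Unset Printing Implicit Defensive.

Import Order.TTheory GRing.Theory Num.Theory.
Import numFieldNormedType.Exports.

Local Open Scope classical_set_scope.
Local Open Scope ring_scope.
Local Open Scope complex_scope.

(** Conformal maps form a convergence group.  Let [hm z w] be the modulus of the
    Hermitian form.  The distance between two points of the ball determines
    [hm z w ^+ 2] up to a factor depending on z and a factor depending on w.
    Hence an isometry f multiplies [hm] by a product of two such factors, and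
    comparing with the centre of the ball expresses them through p = f 0
    ([isometry_herm]).  The identity passes to the boundary
    ([boundary_herm]); since [hm] vanishes on the sphere only on the diagonal,
    it makes a boundary value bi-Lipschitz for [hm], with a constant controlled
    by 1 - |p|^2.  For a sequence of conformal maps, let p_k and q_k be the
    images of the centre under the isometries and their inverses.  If the p_k
    have a limit in the open ball, the maps are equicontinuous together with
    their inverses ([equi_limit]).  If they tend to the sphere, the identity
    [hm x q_k * hm (g_k x) p_k = 1 - |p_k|^2] shows that everything away from
    the limit of the q_k is sent to the limit of the p_k ([Conf_convergence]).

    Maximality.  Minus a point, the boundary is the Heisenberg group V x R, with
    V = C^(n-1); left translations, dilations, unitary and antiunitary maps of V
    come from conformal maps, and so does a map exchanging the removed point
    and the origin.  So it suffices to show that an element of G fixing both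
    of these points is conformal ([stabilizer_conformal]).

    The convergence property, combined with dilations, gives a constant C such
    that every element of G fixing infinity distorts ratios of Heisenberg
    distances by at most C ([quasi_similarity]): a map with larger distortion,
    composed with a suitable dilation, would map a ball around the origin into a
    smaller one and the complement of another ball into itself, and its iterates
    would contradict the convergence property ([no_two_basins]).  Every such map
    k thus has a scaling factor up to a bounded factor, and the logarithm of that
    factor is turned into an exact homomorphism rho.  No averaging over the group
    is available; rho is obtained by counting how many sets are needed to cover
    the region between two level sets, where the covering sets are taken from
    families preserved by the group, so that counts are invariant
    ([displacement_hom], [scaling_hom]).  Then the supremum over the group of
    [expR (- rho k) * hdist (k x) (k y)] is a metric D which each k multiplies by
    the factor [expR (rho k)] ([invariant_metric]).

    After a dilation, the given map is an isometry of D fixing the origin.  As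
    D is left invariant, homogeneous and unitarily invariant, and comparable to
    the Heisenberg distance, its isometries can be determined.  A distance is at
    least a constant times that of the projections to V, with equality along
    horizontal lines, and moving a point vertically hardly changes its distance
    to far points.  This forces isometries to preserve the horizontal lines
    through the origin ([straight_line]) and the asymptotic position of a point
    along each of them ([asymptotic_direction]).  Such an isometry
    has the form (z, t) |-> (phi z, t) with phi unitary, or
    (z, t) |-> (phi z, - t) with phi antiunitary ([isometry_form]), and is
    therefore conformal. *)

(** * The Hermitian inner product *)

Section Hermitian.
Variables (R : realType) (n : nat).
Implicit Types (z w v : 'rV[R[i]]_n) (a b : R[i]) (s : R).

Definition hdot z w : R[i] := \sum_(k < n) z 0 k * (w 0 k)^*.
Definition rd z w : R := complex.Re (hdot z w).
(** The imaginary part of the inner product is the symplectic form that twists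
    the Heisenberg group law. *)
Definition om z w : R := complex.Im (hdot z w).
Definition nr z : R := Num.sqrt (rd z z).
(** A real-valued modulus: the norm of [R[i]] itself takes values in [R[i]]. *)
Definition cm a : R := ComplexField.Normc.normc a.

Lemma cm_sqr a : cm a ^+ 2 = complex.Re a ^+ 2 + complex.Im a ^+ 2.
Proof. by case: a => x y; rewrite /cm /= sqr_sqrtr // addr_ge0 ?sqr_ge0. Qed.

Lemma cm_ge0 a : 0 <= cm a.
Proof. by case: a => x y; rewrite sqrtr_ge0. Qed.

Lemma cmM a b : cm (a * b) = cm a * cm b.
Proof. exact: ComplexField.Normc.normcM. Qed.

Lemma cmV a : cm a^-1 = (cm a)^-1.
Proof. exact: ComplexField.Normc.normcV. Qed.

Lemma cm_real s : cm s%:C = `|s|.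
Proof. by rewrite /cm /= expr0n addr0 sqrtr_sqr. Qed.

Lemma cmD a b : cm (a + b) <= cm a + cm b.
Proof. exact: le_normcD. Qed.

Lemma cmN a : cm (- a) = cm a.
Proof. by case: a => x y; rewrite /cm /= !sqrrN. Qed.

Lemma cmJ a : cm a^* = cm a.
Proof. by case: a => x y; rewrite /cm /= !sqrrN. Qed.

Lemma cm0 : cm 0 = 0.
Proof. exact: ComplexField.Normc.normc0. Qed.

Lemma cm1 : cm 1 = 1.
Proof. exact: ComplexField.Normc.normc1. Qed.

Lemma cm_eq0 a : (cm a == 0) = (a == 0).
Proof.
by apply/eqP/eqP => [/ComplexField.Normc.eq0_normc//|->]; rewrite cm0.
Qed.

Lemma cm_gt0 a : (0 < cm a) = (a != 0).
Proof. by rewrite lt_neqAle cm_ge0 andbT eq_sym cm_eq0. Qed.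

Lemma norm_cm a : `|a| = (cm a)%:C.
Proof. by rewrite normc_def; case: a. Qed.

Lemma Re_le_cm a : complex.Re a <= cm a.
Proof.
apply: (le_trans (ler_norm _)); rewrite -sqrtr_sqr.
by case: a => x y; rewrite ler_wsqrtr //= lerDl sqr_ge0.
Qed.

Lemma Im_le_cm a : complex.Im a <= cm a.
Proof.
apply: (le_trans (ler_norm _)); rewrite -sqrtr_sqr.
by case: a => x y; rewrite ler_wsqrtr //= lerDr sqr_ge0.
Qed.

Lemma cm_le_ReIm a : cm a <= `|complex.Re a| + `|complex.Im a|.
Proof.
rewrite -(ler_pXn2r (n:=2)) ?nnegrE ?cm_ge0 ?addr_ge0 //.
rewrite cm_sqr sqrrD !real_normK ?num_real // lerD2r lerDl.
by rewrite mulrn_wge0 ?mulr_ge0.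
Qed.

Lemma ReM a b : complex.Re (a * b)
  = complex.Re a * complex.Re b - complex.Im a * complex.Im b.
Proof. by case: a; case: b. Qed.

Lemma ImM a b : complex.Im (a * b)
  = complex.Re a * complex.Im b + complex.Im a * complex.Re b.
Proof. by case: a; case: b. Qed.

Lemma ReD a b : complex.Re (a + b) = complex.Re a + complex.Re b.
Proof. by case: a; case: b. Qed.
Lemma ImD a b : complex.Im (a + b) = complex.Im a + complex.Im b.
Proof. by case: a; case: b. Qed.
Lemma ReN a : complex.Re (- a) = - complex.Re a.
Proof. by case: a. Qed.
Lemma ImN a : complex.Im (- a) = - complex.Im a.
Proof. by case: a. Qed.
Lemma ReJ a : complex.Re a^* = complex.Re a.
Proof. by case: a. Qed.
Lemma ImJ a : complex.Im a^* = - complex.Im a.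
Proof. by case: a. Qed.
Lemma eqC a b : complex.Re a = complex.Re b -> complex.Im a = complex.Im b ->
  a = b.
Proof. by case: a => ? ?; case: b => ? ? /= -> ->. Qed.

Lemma mulcJ a : a * a^* = (cm a ^+ 2)%:C.
Proof.
apply: eqC; rewrite ?ReM ?ImM ReJ ImJ /= ?cm_sqr; ring.
Qed.

Lemma hdotDl z v w : hdot (z + v) w = hdot z w + hdot v w.
Proof. by rewrite -big_split; apply: eq_bigr => k _; rewrite mxE mulrDl. Qed.

Lemma hdotZl a z w : hdot (a *: z) w = a * hdot z w.
Proof. by rewrite mulr_sumr; apply: eq_bigr => k _; rewrite mxE mulrA. Qed.

Lemma hdotC z w : hdot w z = (hdot z w)^*.
Proof.
rewrite /hdot rmorph_sum; apply: eq_bigr => k _.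
by rewrite rmorphM /= conjcK mulrC.
Qed.

Lemma hdotDr z v w : hdot w (z + v) = hdot w z + hdot w v.
Proof. by rewrite hdotC hdotDl rmorphD /= -!hdotC. Qed.

Lemma hdotZr a z w : hdot w (a *: z) = a^* * hdot w z.
Proof. by rewrite hdotC hdotZl rmorphM /= -!hdotC. Qed.

Lemma hdotNl z w : hdot (- z) w = - hdot z w.
Proof. by rewrite -scaleN1r hdotZl mulN1r. Qed.

Lemma hdotNr z w : hdot w (- z) = - hdot w z.
Proof. by rewrite hdotC hdotNl rmorphN /= -hdotC. Qed.

Lemma hdot0l z : hdot 0 z = 0.
Proof. by rewrite -(scale0r 0) hdotZl mul0r. Qed.

Lemma hdot0r z : hdot z 0 = 0.
Proof. by rewrite hdotC hdot0l conjc0. Qed.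

Lemma rdDl z v w : rd (z + v) w = rd z w + rd v w.
Proof. by rewrite /rd hdotDl ReD. Qed.
Lemma rdDr z v w : rd w (z + v) = rd w z + rd w v.
Proof. by rewrite /rd hdotDr ReD. Qed.
Lemma rdNl z w : rd (- z) w = - rd z w.
Proof. by rewrite /rd hdotNl ReN. Qed.
Lemma rdNr z w : rd w (- z) = - rd w z.
Proof. by rewrite /rd hdotNr ReN. Qed.
Lemma rdZl s z w : rd (s%:C *: z) w = s * rd z w.
Proof. by rewrite /rd hdotZl ReM /= mul0r subr0. Qed.
Lemma rdZr s z w : rd w (s%:C *: z) = s * rd w z.
Proof. by rewrite /rd hdotZr ReM ReJ ImJ /= oppr0 mul0r subr0. Qed.
Lemma rdC z w : rd w z = rd z w.
Proof. by rewrite /rd hdotC ReJ. Qed.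
Lemma rd0l z : rd 0 z = 0.
Proof. by rewrite /rd hdot0l. Qed.
Lemma rd0r z : rd z 0 = 0.
Proof. by rewrite /rd hdot0r. Qed.

Lemma omDl z v w : om (z + v) w = om z w + om v w.
Proof. by rewrite /om hdotDl ImD. Qed.
Lemma omDr z v w : om w (z + v) = om w z + om w v.
Proof. by rewrite /om hdotDr ImD. Qed.
Lemma omNl z w : om (- z) w = - om z w.
Proof. by rewrite /om hdotNl ImN. Qed.
Lemma omNr z w : om w (- z) = - om w z.
Proof. by rewrite /om hdotNr ImN. Qed.
Lemma omZl s z w : om (s%:C *: z) w = s * om z w.
Proof. by rewrite /om hdotZl ImM /= mul0r addr0. Qed.
Lemma omZr s z w : om w (s%:C *: z) = s * om w z.
Proof. by rewrite /om hdotZr ImM ReJ ImJ /= oppr0 mul0r addr0. Qed.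
Lemma omC z w : om w z = - om z w.
Proof. by rewrite /om hdotC ImJ. Qed.
Lemma om0l z : om 0 z = 0.
Proof. by rewrite /om hdot0l. Qed.
Lemma om0r z : om z 0 = 0.
Proof. by rewrite /om hdot0r. Qed.
Lemma om_diag z : om z z = 0.
Proof. by have := omC z z; lra. Qed.
Lemma omiE z w : om ('i *: z) w = rd z w.
Proof. by rewrite /om hdotZl ImM /= mul0r mul1r add0r. Qed.
Lemma rdiE z w : rd ('i *: z) w = - om z w.
Proof. by rewrite /rd hdotZl ReM /= mul0r mul1r sub0r. Qed.

Lemma hdot_self z : hdot z z = (rd z z)%:C.
Proof. by apply: eqC => //; exact: om_diag. Qed.

Lemma rd_sum z : rd z z = \sum_(k < n) cm (z 0 k) ^+ 2.
Proof.
rewrite /rd /hdot (big_morph (@complex.Re R) ReD (erefl _)).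
by apply: eq_bigr => k _; rewrite mulcJ.
Qed.

Lemma rd_ge0 z : 0 <= rd z z.
Proof. by rewrite rd_sum sumr_ge0 // => k _; rewrite sqr_ge0. Qed.

Lemma nr_sqr z : nr z ^+ 2 = rd z z.
Proof. by rewrite sqr_sqrtr // rd_ge0. Qed.

Lemma nr_ge0 z : 0 <= nr z.
Proof. exact: sqrtr_ge0. Qed.

Lemma entry_le_nr z k : cm (z 0 k) <= nr z.
Proof.
rewrite -(ler_pXn2r (n:=2)) ?nnegrE ?cm_ge0 ?nr_ge0 // nr_sqr rd_sum.
by rewrite (bigD1 k) //= lerDl sumr_ge0 // => j _; rewrite sqr_ge0.
Qed.

Lemma nr_eq0 z : (nr z == 0) = (z == 0).
Proof.
apply/eqP/eqP => [z0|->]; last by rewrite /nr rd0l sqrtr0.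
apply/rowP => k; rewrite mxE; apply/eqP; rewrite -cm_eq0.
by rewrite eq_le cm_ge0 andbT -z0 entry_le_nr.
Qed.

Lemma nr0 : nr 0 = 0.
Proof. by apply/eqP; rewrite nr_eq0. Qed.

Lemma nr_gt0 z : (0 < nr z) = (z != 0).
Proof. by rewrite lt_neqAle nr_ge0 andbT eq_sym nr_eq0. Qed.

Lemma nrN z : nr (- z) = nr z.
Proof. by rewrite /nr rdNl rdNr opprK. Qed.

Lemma nrB z w : nr (z - w) = nr (w - z).
Proof. by rewrite -nrN opprB. Qed.

Lemma nrZC a z : nr (a *: z) = cm a * nr z.
Proof.
apply/eqP; rewrite -(eqrXn2 (n:=2)) ?mulr_ge0 ?nr_ge0 ?cm_ge0 //.
rewrite exprMn !nr_sqr /rd hdotZl hdotZr mulrA mulcJ hdot_self.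
by rewrite /= mul0r subr0.
Qed.

Lemma nrZ s z : nr (s%:C *: z) = `|s| * nr z.
Proof. by rewrite nrZC cm_real. Qed.

(** Cauchy--Schwarz: expand the square norm of [<z,w> z - |z|^2 w]. *)
Lemma rd_le z w : rd z w <= nr z * nr w.
Proof.
have [->|z0] := eqVneq z 0; first by rewrite rd0l nr0 mul0r.
have zp : 0 < nr z by rewrite nr_gt0.
have := rd_ge0 ((rd z w)%:C *: z - (nr z ^+ 2)%:C *: w).
rewrite !(rdDl, rdDr, rdNl, rdNr, rdZl, rdZr) -!nr_sqr (rdC z w) => h.
have [//|h2] := leP (rd z w) (nr z * nr w).
have h3 : 0 <= nr z * nr w by rewrite mulr_ge0 ?nr_ge0.
have h4 : (nr z * nr w) ^+ 2 < rd z w ^+ 2.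
  by rewrite ltr_pXn2r ?nnegrE // ltW // (le_lt_trans h3).
have : 0 < nr z ^+ 2 * (rd z w ^+ 2 - (nr z * nr w) ^+ 2).
  by rewrite mulr_gt0 ?exprn_gt0 // subr_gt0.
have -> : nr z ^+ 2 * (rd z w ^+ 2 - (nr z * nr w) ^+ 2)
  = - (rd z w * (rd z w * nr z ^+ 2) + - (rd z w * (nr z ^+ 2 * rd z w)) +
     (- (nr z ^+ 2 * (rd z w * rd z w)) + - - (nr z ^+ 2 * (nr z ^+ 2 * nr w ^+ 2)))).
  ring.
by move=> h5; move: h; lra.
Qed.

(** Multiplying z by the conjugate of [<z,w>] makes the product real, which
    reduces the bound to the real part. *)
Lemma hdot_le z w : cm (hdot z w) <= nr z * nr w.
Proof.
have [->|h0] := eqVneq (hdot z w) 0; first by rewrite cm0 mulr_ge0 ?nr_ge0.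
have hp : 0 < cm (hdot z w) by rewrite cm_gt0.
have := rd_le ((hdot z w)^* *: z) w.
rewrite nrZC cmJ -mulrA {1}/rd hdotZl mulrC mulcJ /= expr2.
by rewrite ler_pM2l.
Qed.

Lemma rd_normle z w : `|rd z w| <= nr z * nr w.
Proof. by rewrite ler_norml lerNl -rdNl -{1}(nrN z) !rd_le. Qed.

Lemma om_normle z w : `|om z w| <= nr z * nr w.
Proof.
rewrite -normrN -rdiE (le_trans (rd_normle _ _)) // nrZC.
have -> : cm 'i = 1 by rewrite /cm /= expr0n expr1n add0r sqrtr1.
by rewrite mul1r.
Qed.

Lemma nrD z w : nr (z + w) <= nr z + nr w.
Proof.
rewrite -(ler_pXn2r (n:=2)) ?nnegrE ?nr_ge0 ?addr_ge0 ?nr_ge0 //.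
rewrite nr_sqr rdDl !rdDr sqrrD -!nr_sqr (rdC z w).
have := rd_le z w; lra.
Qed.

Lemma nr_triangle v z w : nr (z - w) <= nr (z - v) + nr (v - w).
Proof. by have := nrD (z - v) (v - w); rewrite addrA subrK. Qed.

Lemma nr_le_sum z : nr z <= \sum_(k < n) cm (z 0 k).
Proof.
have s0 : 0 <= \sum_(k < n) cm (z 0 k).
  by apply: sumr_ge0 => k _; exact: cm_ge0.
rewrite -(ler_pXn2r (n:=2)) ?nnegrE ?nr_ge0 // nr_sqr rd_sum expr2 mulr_suml.
apply: ler_sum => k _; rewrite expr2 ler_wpM2l ?cm_ge0 //.
by rewrite (bigD1 k) //= lerDl sumr_ge0 // => j _; exact: cm_ge0.
Qed.

End Hermitian.

(** * The boundary as a metric space *)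

Section BoundaryUniformity.
Variables (R : realType) (n : nat).
Implicit Types (z w : 'rV[R[i]]_n) (x y : HC_boundary R n).

Lemma ball_nr z w (e : R[i]) : ball z e w <-> 0 < e /\
  forall k, cm (z 0 k - w 0 k) < complex.Re e.
Proof.
have key k : 0 < e -> ball (z 0 k) e (w 0 k) <-> cm (z 0 k - w 0 k) < complex.Re e.
  move=> e0; rewrite -ball_normE /ball_ /= norm_cm ltcE /=.
  by move: e0; rewrite ltcE /= => /andP[/eqP -> _]; rewrite eqxx.
split=> [[e0 h]|[e0 h]]; split=> //.
  by move=> k; apply/key => //; exact: h.
by move=> i k; rewrite !ord1; apply/key.
Qed.

Lemma ball_nr_lt z w (e : R) : 0 < e -> nr (z - w) < e -> ball z e%:C w.
Proof.
move=> e0 h; apply/ball_nr; split=> [|k]; first by rewrite ltcR.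
by apply: le_lt_trans h; have := entry_le_nr (z - w) k; rewrite !mxE.
Qed.

(** The topology of row vectors is that of the supremum norm; the factor
    [n.+1] compares it with the Hermitian norm, also for n = 0. *)
Lemma nr_lt_ball z w (e : R) : 0 < e ->
  ball z (e / n.+1%:R)%:C w -> nr (z - w) < e.
Proof.
move=> e0 /ball_nr[_ h]; apply: (le_lt_trans (nr_le_sum _)).
apply: (@le_lt_trans _ _ (\sum_(k < n) (e / n.+1%:R))).
  by apply: ler_sum => k _; rewrite !mxE ltW.
rewrite sumr_const card_ord -[X in X < _]mulr_natr mulrAC.
by rewrite ltr_pdivrMr ?ltr0n // ltr_pM2l // ltr_nat.
Qed.

Lemma ReC_gt0 (e : R[i]) : 0 < e -> 0 < complex.Re e /\ e = (complex.Re e)%:C.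
Proof.
by case: e => a b; rewrite ltcE /= => /andP[/eqP -> ->].
Qed.

Lemma nbhs_nrP z (U : set 'rV[R[i]]_n) :
  nbhs z U <-> exists2 e : R, 0 < e & forall w, nr (z - w) < e -> U w.
Proof.
split=> [/nbhs_ballP[e /= /ReC_gt0[e0 ->] h]|[e e0 h]].
  by exists (complex.Re e) => // w zw; apply: h; exact: ball_nr_lt.
apply/nbhs_ballP; exists (e / n.+1%:R)%:C => /=.
  by rewrite ltcR divr_gt0 // ltr0n.
by move=> w zw; apply: h; exact: nr_lt_ball.
Qed.

Definition bdist x y : R := nr (set_val x - set_val y).

Lemma bdist_ge0 x y : 0 <= bdist x y. Proof. exact: nr_ge0. Qed.
Lemma bdistC x y : bdist x y = bdist y x. Proof. exact: nrB. Qed.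
Lemma bdist_tri y x x1 : bdist x x1 <= bdist x y + bdist y x1.
Proof. exact: nr_triangle. Qed.
Lemma bdistxx x : bdist x x = 0.
Proof. by rewrite /bdist subrr nr0. Qed.
Lemma bdist0_eq x y : bdist x y = 0 -> x = y.
Proof. by move/eqP; rewrite nr_eq0 subr_eq0 => /eqP/val_inj. Qed.

Lemma boundary_entourageP (E : set (HC_boundary R n * HC_boundary R n)) :
  entourage E <-> exists2 e : R, 0 < e & forall x y, bdist x y < e -> E (x, y).
Proof.
split.
- case=> B; rewrite -entourage_ballE => -[/= e /ReC_gt0[e0 ee] eB] BE.
  exists (complex.Re e) => // x y xy; apply: BE; apply: eB => /=.
  by rewrite ee; exact: ball_nr_lt.
- case=> e e0 h.
  exists [set xy | ball xy.1 (e / n.+1%:R)%:C xy.2].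
    rewrite -entourage_ballE; exists (e / n.+1%:R)%:C => //=.
    by rewrite ltcR divr_gt0 // ltr0n.
  by move=> [x y] /= xy; apply: h; exact: nr_lt_ball.
Qed.

Lemma boundary_nbhsP x (U : set (HC_boundary R n)) :
  nbhs x U <-> exists2 e : R, 0 < e & forall y, bdist x y < e -> U y.
Proof.
split.
  move/nbhsP => [E /boundary_entourageP[e e0 h] EU]; exists e => // y xy.
  by apply: EU; apply/xsectionP; exact: h.
case=> e e0 h; apply/nbhsP; exists [set xy | bdist xy.1 xy.2 < e].
  by apply/boundary_entourageP; exists e.
by move=> y /xsectionP /=; exact: h.
Qed.

Lemma boundary_open_ball x (e : R) : open [set y | bdist x y < e].
Proof.
rewrite openE => y /= xy; apply/boundary_nbhsP; exists (e - bdist x y).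
  by rewrite subr_gt0.
by move=> z; rewrite ltrBrDl => h; apply: le_lt_trans h; exact: bdist_tri.
Qed.

Lemma boundary_continuousP (f : HC_boundary R n -> HC_boundary R n) :
  continuous f <-> forall x (e : R), 0 < e ->
    exists2 d : R, 0 < d & forall y, bdist x y < d -> bdist (f x) (f y) < e.
Proof.
split=> [fc x e e0|h x U].
  have /fc/boundary_nbhsP[d d0 h] : nbhs (f x) [set y | bdist (f x) y < e].
    by apply/boundary_nbhsP; exists e.
  by exists d.
case/boundary_nbhsP=> e e0 eU; have [d d0 hd] := h x e e0.
by apply/boundary_nbhsP; exists d => // y /hd /eU.
Qed.

Lemma boundary_uniformP (A : set (HC_boundary R n))
    (u : nat -> HC_boundary R n -> HC_boundary R n) h :
  {uniform A, u @ \oo --> h} <-> forall e : R, 0 < e ->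
    exists N, forall k, (N <= k)%N -> forall x, A x -> bdist (h x) (u k x) < e.
Proof.
split.
  move=> uh e e0.
  have : nbhs (h : {uniform` A -> _}) [set g | forall x, A x -> bdist (h x) (g x) < e].
    apply/uniform_nbhs; exists [set xy | bdist xy.1 xy.2 < e]; split=> //.
    by apply/boundary_entourageP; exists e.
  by move/uh => -[N _ hN]; exists N => k Nk x Ax; exact: hN.
move=> H U /uniform_nbhs[E [/boundary_entourageP[e e0 eE] EU]].
have [N hN] := H e e0; exists N => // k /= Nk; apply: EU => x Ax.
by apply: eE; exact: hN.
Qed.

Lemma boundary_extensionP f g : boundary_extension f g <->
  forall x (e : R), 0 < e -> exists2 d : R, 0 < d &
    forall z, @HC R n z -> nr (set_val x - z) < d -> nr (set_val (g x) - f z) < e.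
Proof.
split=> [h x e e0|h x U].
  have : nbhs (set_val (g x)) [set w | nr (set_val (g x) - w) < e].
    by apply/nbhs_nrP; exists e.
  move/(h x) => /nbhs_nrP[d d0 hd]; exists d => // z zH zd.
  exact: hd.
case/nbhs_nrP=> e e0 eU; have [d d0 hd] := h x e e0.
by apply/nbhs_nrP; exists d => // z zd zH; apply: eU; exact: hd.
Qed.
End BoundaryUniformity.

(** * Limits along an ultrafilter *)

Section UltraLimits.
Variables (R : realType) (U : set_system nat).
Hypotheses (ultraU : UltraFilter U) (ooU : \oo `<=` U).
Local Instance UF : ProperFilter U := @ultra_proper _ _ ultraU.

Lemma ultra_ge N : U [set k | (N <= k)%N].
Proof. by apply: ooU; exists N. Qed.

Lemma ultra_ex (P : set nat) N : U P -> exists2 k, (N <= k)%N & P k.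
Proof.
move=> UP; have [k [Pk Nk]] := filter_ex (filterI UP (ultra_ge N)).
by exists k.
Qed.

Lemma ultra_nat (s : R) : U [set k : nat | s <= k%:R].
Proof.
apply: filterS (ultra_ge (Num.bound `|s|)) => k /= h.
rewrite (le_trans (ler_norm _)) // (le_trans (ltW (archi_boundP (normr_ge0 s)))) //.
by rewrite ler_nat.
Qed.

Lemma ultra_inv (e : R) : 0 < e -> U [set k | k.+1%:R^-1 < e].
Proof.
move=> e0; have [N hN] : exists N : nat, e^-1 < N%:R.
  by exists (Num.bound e^-1); rewrite archi_boundP // invr_ge0 ltW.
apply: filterS (ultra_ge N) => k /= Nk.
rewrite invf_plt ?posrE // (lt_le_trans hN) // ler_nat.
exact: leq_trans Nk _.
Qed.

(** Diagonal extraction: properties that hold along the ultrafilter, one for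
    each j, are met by a single subsequence. *)
Lemma ultra_extract (A : nat -> set nat) : (forall j, U (A j)) ->
  exists2 phi : nat -> nat, {homo phi : i j / (i < j)%N} & forall j, A j (phi j).
Proof.
move=> UA.
have step j i : {k | A j k /\ (i < k)%N}.
  by apply: cid; have [k ik Ak] := ultra_ex i.+1 (UA j); exists k.
pose phi := fix phi j := if j is j'.+1 then sval (step j (phi j'))
                         else sval (step 0 0)%N.
exists phi; last first.
  by case=> [|j] /=; [case: (svalP (step 0 0)%N) | case: (svalP (step j.+1 (phi j)))].
apply: homo_ltn; first exact: ltn_trans.
by move=> j /=; case: (svalP (step j.+1 (phi j))).
Qed.

(** A segment is compact, and an ultrafilter contains a set or its complement,
    so a cluster point is a limit. *)
Lemma ultra_lim (x : nat -> R) (M : R) : U [set k | `|x k| <= M] ->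
  exists l, forall e, 0 < e -> U [set k | `|l - x k| < e].
Proof.
move=> xM.
have fxM : (x @ U) [set t | t \in `[- M, M]].
  by apply: (@filterS _ U _ _ _ _ xM) => k xk; rewrite /= in_itv /= -ler_norml.
have [l [_ hl]] := @segment_compact R (- M) M (x @ U) _ fxM.
exists l => e e0.
have [//|nU] := in_ultra_setVsetC [set k | `|l - x k| < e] ultraU.
have [] := hl [set t | ~ `|l - t| < e] [set t | `|l - t| < e] _ _.
- exact: nU.
- by have := nbhsx_ballx l e e0; rewrite -ball_normE.
- by move=> t [].
Qed.

Lemma ultra_lim_near (x : nat -> R) (a M : R) : U [set k | `|x k - a| <= M] ->
  exists l, (forall e, 0 < e -> U [set k | `|l - x k| < e]) /\ `|l - a| <= M.
Proof.
move=> xM; have [|l hl] := @ultra_lim x (`|a| + M).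
  apply: filterS xM => k /=; have := ler_norm a; have := ler_norm (- a).
  rewrite normrN !ler_norml; lra.
exists l; split=> //; apply/ler_addgt0Pr => e e0.
have [k [/= h1 h2]] := filter_ex (filterI (hl e e0) xM).
move: h1 h2; rewrite ltr_norml !ler_norml; lra.
Qed.

Lemma ultra_limV n (z : nat -> 'rV[R[i]]_n) (M : R) :
  U [set k | nr (z k) <= M] ->
  exists l, forall e, 0 < e -> U [set k | nr (l - z k) < e].
Proof.
move=> zM.
have re j : exists l : R, forall e, 0 < e ->
    U [set k | `|l - complex.Re (z k 0 j)| < e].
  apply: (@ultra_lim _ M); apply: filterS zM => k /= h.
  rewrite ler_norml; apply/andP; split; last first.
    by rewrite (le_trans (Re_le_cm _)) // (le_trans (entry_le_nr _ _)).
  rewrite lerNl -ReN (le_trans (Re_le_cm _)) // cmN.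
  by rewrite (le_trans (entry_le_nr _ _)).
have im j : exists l : R, forall e, 0 < e ->
    U [set k | `|l - complex.Im (z k 0 j)| < e].
  apply: (@ultra_lim _ M); apply: filterS zM => k /= h.
  rewrite ler_norml; apply/andP; split; last first.
    by rewrite (le_trans (Im_le_cm _)) // (le_trans (entry_le_nr _ _)).
  rewrite lerNl -ImN (le_trans (Im_le_cm _)) // cmN.
  by rewrite (le_trans (entry_le_nr _ _)).
have [a ha] := choice re; have [b hb] := choice im.
exists (\row_j (a j +i* b j)) => e e0.
pose d := e / (n.+1 * 2)%:R.
have d0 : 0 < d by rewrite divr_gt0 // ltr0n.
have : \forall k \near U, forall j, `|a j - complex.Re (z k 0 j)| < d
    /\ `|b j - complex.Im (z k 0 j)| < d.
  apply: filter_forall => j; exact: filterI (ha j d d0) (hb j d d0).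
apply: filterS => k h; apply: (le_lt_trans (nr_le_sum _)).
apply: (@le_lt_trans _ _ (\sum_(j < n) (d * 2))).
  apply: ler_sum => j _; rewrite !mxE (le_trans (cm_le_ReIm _)) //.
  have [h1 h2] := h j; rewrite ReD ReN ImD ImN /=; lra.
rewrite sumr_const card_ord -[X in X < _]mulr_natr /d natrM.
rewrite invfM mulrA divfK ?pnatr_eq0 //.
by rewrite mulrAC ltr_pdivrMr ?ltr0n // ltr_pM2l // ltr_nat.
Qed.

End UltraLimits.

(** * The Hermitian form on the closed ball *)

Section BallGeometry.
Variables (R : realType) (n : nat).
Implicit Types (z w p q : 'rV[R[i]]_n) (x y : HC_boundary R n).

Definition hm z w : R := cm (herm z w).
(** The real number [- herm z z], positive in the ball and zero on the sphere. *)
Definition defect z : R := 1 - rd z z.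

Lemma hermE z w : herm z w = hdot z w - 1.
Proof. by []. Qed.

Lemma herm_self z : herm z z = (- defect z)%:C.
Proof. rewrite hermE hdot_self /defect; apply: eqC; rewrite !(ReD, ImD, ReN, ImN) /=; ring. Qed.

Lemma HC_def z : @HC R n z <-> 0 < defect z.
Proof.
rewrite /HC /= herm_self ltcR.
by rewrite oppr_lt0.
Qed.

Lemma HC_sphere_def z : @HC_sphere R n z <-> defect z = 0.
Proof.
rewrite /HC_sphere /= herm_self; split=> [/(congr1 (@complex.Re R)) /= /eqP|->].
  by rewrite oppr_eq0 => /eqP.
by rewrite oppr0.
Qed.

Lemma defect_boundary x : defect (set_val x) = 0.
Proof. by apply/HC_sphere_def; have := set_valP x. Qed.

Lemma rd_boundary x : rd (set_val x) (set_val x) = 1.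
Proof. by have := defect_boundary x; rewrite /defect; lra. Qed.

Lemma hm_ge0 z w : 0 <= hm z w. Proof. exact: cm_ge0. Qed.

Lemma hermC z w : herm w z = (herm z w)^*.
Proof.
rewrite !hermE (hdotC z w); apply: eqC;
  by rewrite !(ReD, ImD, ReN, ImN, ReJ, ImJ) /= ?oppr0 ?addr0 ?opprD ?oppr0 ?addr0.
Qed.

Lemma hmC z w : hm z w = hm w z.
Proof.
by rewrite /hm hermC cmJ.
Qed.

Lemma hm0r z : hm z 0 = 1.
Proof. by rewrite /hm hermE hdot0r sub0r cmN cm1. Qed.

Lemma hm0l z : hm 0 z = 1.
Proof. by rewrite hmC hm0r. Qed.

Lemma nr_le1 z : 0 <= defect z -> nr z <= 1.
Proof.
rewrite /defect subr_ge0 -nr_sqr => h.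
by rewrite -(expr_le1 (n:=2)) ?nr_ge0.
Qed.

Lemma nr_lt1 z : 0 < defect z -> nr z < 1.
Proof.
rewrite /defect subr_gt0 -nr_sqr => h.
by rewrite -(expr_lt1 (n:=2)) ?nr_ge0.
Qed.

Lemma hm_self z : 0 <= defect z -> hm z z = defect z.
Proof. by move=> h; rewrite /hm herm_self cm_real normrN ger0_norm. Qed.

Lemma hm_le2 z w : 0 <= defect z -> 0 <= defect w -> hm z w <= 2.
Proof.
move=> /nr_le1 hz /nr_le1 hw; rewrite /hm hermE (le_trans (cmD _ _)) // cmN cm1.
rewrite -[2]/(1 + 1) lerD2r (le_trans (hdot_le _ _)) //.
by rewrite mulr_ile1 ?nr_ge0.
Qed.

Lemma hm_ge z w : 0 <= defect z -> 1 - nr w <= hm z w.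
Proof.
move=> /nr_le1 hz; rewrite /hm hermE -cmN opprB.
have := cmD (1 - hdot z w) (hdot z w); rewrite subrK cm1.
have := hdot_le z w; have : nr z * nr w <= nr w by rewrite ler_piMl ?nr_ge0.
lra.
Qed.

(** The reverse Cauchy--Schwarz inequality for a form of signature (n,1). *)
Lemma hm_ge_def z w : 0 <= defect z -> 0 <= defect w -> defect z * defect w <= hm z w ^+ 2.
Proof.
move=> hz hw; have nz := nr_le1 hz; have nw := nr_le1 hw.
have h1 : 0 <= 1 - nr z * nr w.
  by rewrite subr_ge0 mulr_ile1 ?nr_ge0.
have h2 : 1 - nr z * nr w <= hm z w.
  rewrite /hm hermE -cmN opprB.
  have := cmD (1 - hdot z w) (hdot z w); rewrite subrK cm1.
  have := hdot_le z w; lra.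
apply: (@le_trans _ _ ((1 - nr z * nr w) ^+ 2)); last first.
  by rewrite ler_pXn2r ?nnegrE ?hm_ge0.
rewrite /defect -!nr_sqr -subr_ge0.
have -> : (1 - nr z * nr w) ^+ 2 - (1 - nr z ^+ 2) * (1 - nr w ^+ 2)
   = (nr z - nr w) ^+ 2 by ring.
exact: sqr_ge0.
Qed.

Lemma hm_lip z z' w w' : 0 <= defect z' -> 0 <= defect w ->
  hm z w <= hm z' w' + nr (z - z') + nr (w - w').
Proof.
move=> /nr_le1 hz /nr_le1 hw; rewrite /hm !hermE.
have -> : hdot z w - 1 = (hdot z' w' - 1) + hdot (z - z') w + hdot z' (w - w').
  by rewrite hdotDl hdotDr hdotNl hdotNr; ring.
rewrite (le_trans (cmD _ _)) // lerD //; first rewrite (le_trans (cmD _ _)) // lerD2l.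
  by rewrite (le_trans (hdot_le _ _)) // ler_piMr ?nr_ge0.
by rewrite (le_trans (hdot_le _ _)) // ler_piMl ?nr_ge0.
Qed.

Lemma hm_dist z w z' w' : 0 <= defect z -> 0 <= defect w -> 0 <= defect z' -> 0 <= defect w' ->
  `|hm z w - hm z' w'| <= nr (z - z') + nr (w - w').
Proof.
move=> hz hw hz' hw'; have := hm_lip z w' hz' hw; have := hm_lip z' w hz hw'.
rewrite (nrB z') (nrB w') ler_norml; lra.
Qed.

(** On the sphere [hm] is comparable to the distance up to a square root, so it
    controls the topology in both directions. *)
Lemma nr_le_hm z x : 0 <= defect z -> nr (z - set_val x) ^+ 2 <= 2 * hm z (set_val x).
Proof.
move=> hz; rewrite nr_sqr !(rdDl, rdDr, rdNl, rdNr) rd_boundary (rdC z).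
have := Re_le_cm (- herm z (set_val x)); rewrite cmN -/(hm _ _) hermE ReN ReD /=.
rewrite -/(rd _ _) => h; move: hz; rewrite /defect; lra.
Qed.

Lemma hm_le_nr z x : hm z (set_val x) <= nr (z - set_val x).
Proof.
rewrite /hm hermE; have -> : 1 = hdot (set_val x) (set_val x).
  by rewrite hdot_self rd_boundary.
rewrite -hdotNl -hdotDl (le_trans (hdot_le _ _)) //.
by rewrite ler_piMr ?nr_ge0 // nr_le1 // defect_boundary.
Qed.

(** The square of [cosh (d / 2)], where d is the hyperbolic distance. *)
Definition hratio z w : R := hm z w ^+ 2 / (defect z * defect w).

Lemma arcosh_inj (a b : R) : 1 <= a -> 1 <= b -> arcosh a = arcosh b -> a = b.
Proof.
have lt_arcosh (c d : R) : 1 <= c -> c < d -> arcosh c < arcosh d.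
  move=> c1 cd; rewrite /arcosh ltr_ln ?posrE.
  - apply: ltr_leD => //; rewrite ler_wsqrtr // lerD2r.
    by rewrite ler_pXn2r // ?nnegrE; lra.
  - by rewrite ltr_pwDl ?sqrtr_ge0 //; lra.
  - by rewrite ltr_pwDl ?sqrtr_ge0 //; lra.
move=> a1 b1 ab; have [h|h|//] := ltgtP a b.
  by have := lt_arcosh _ _ a1 h; rewrite ab ltxx.
by have := lt_arcosh _ _ b1 h; rewrite ab ltxx.
Qed.

Lemma HC_distE z w : HC_dist z w = 2 * arcosh (Num.sqrt (hratio z w)).
Proof.
rewrite /HC_dist /hratio; congr (2 * arcosh (Num.sqrt _)).
by rewrite (hermC z w) mulcJ !herm_self -rmorphM mulrNN -fmorphV -rmorphM.
Qed.

Lemma hratio_ge1 z w : 0 < defect z -> 0 < defect w -> 1 <= hratio z w.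
Proof.
move=> hz hw; rewrite /hratio ler_pdivlMr ?mulr_gt0 // mul1r.
by rewrite hm_ge_def // ltW.
Qed.

Lemma HC_dist_eq z w z' w' : 0 < defect z -> 0 < defect w -> 0 < defect z' -> 0 < defect w' ->
  HC_dist z w = HC_dist z' w' <-> hratio z w = hratio z' w'.
Proof.
move=> hz hw hz' hw'; rewrite !HC_distE; split=> [|-> //].
have two0 : 2 != 0 :> R by rewrite pnatr_eq0.
move/(mulfI two0).
have s1 a b : 0 < defect a -> 0 < defect b -> 1 <= Num.sqrt (hratio a b).
  by move=> ha hb; rewrite -sqrtr1 ler_wsqrtr // hratio_ge1.
move/(arcosh_inj (s1 _ _ hz hw) (s1 _ _ hz' hw'))/eqP.
rewrite eqr_sqrt; first by move/eqP.
  by apply: (le_trans ler01); exact: hratio_ge1.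
by apply: (le_trans ler01); exact: hratio_ge1.
Qed.

End BallGeometry.

(** * Boundary values of isometries *)

Section ConfBasics.
Variables (R : realType) (n : nat).
Implicit Types (z w p q : 'rV[R[i]]_n) (x y : HC_boundary R n).
Implicit Types (f : 'rV[R[i]]_n -> 'rV[R[i]]_n) (g : HC_boundary R n -> HC_boundary R n).

Lemma defect0 : defect (0 : 'rV[R[i]]_n) = 1.
Proof. by rewrite /defect rd0l subr0. Qed.

(** The distance determines [hratio], so f multiplies [hm z w] by a factor
    depending on z and a factor depending on w; taking 0 for one of the points
    expresses both factors through [f 0]. *)
Lemma isometry_herm f : HC_isometry f -> forall z w, 0 < defect z -> 0 < defect w ->
  hm (f z) (f w) * defect (f 0) = hm z w * hm (f z) (f 0) * hm (f w) (f 0).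
Proof.
move=> [[fH _ _] fd].
have fp z : 0 < defect z -> 0 < defect (f z) by move=> /HC_def/fH/HC_def.
have rat z w : 0 < defect z -> 0 < defect w ->
    hm (f z) (f w) ^+ 2 * (defect z * defect w) = hm z w ^+ 2 * (defect (f z) * defect (f w)).
  move=> hz hw; have /HC_dist_eq := fd z w (proj2 (HC_def z) hz) (proj2 (HC_def w) hw).
  move=> /(_ (fp _ hz) (fp _ hw) hz hw) /eqP; rewrite /hratio.
  have n1 : defect (f z) * defect (f w) != 0 by rewrite gt_eqF // mulr_gt0 ?fp.
  have n2 : defect z * defect w != 0 by rewrite gt_eqF // mulr_gt0.
  by rewrite (eqr_div _ _ n1 n2) => /eqP.
have d0 : 0 < defect (0 : 'rV[R[i]]_n) by rewrite defect0.
move=> z w hz hw.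
have rz := rat z 0 hz d0; have rw := rat w 0 hw d0; have rzw := rat z w hz hw.
rewrite hm0r defect0 expr1n mul1r mulr1 in rz; rewrite hm0r defect0 expr1n mul1r mulr1 in rw.
apply/eqP; rewrite -(eqrXn2 (n:=2)) ?mulr_ge0 ?hm_ge0 ?(ltW (fp _ d0)) //.
have nz : defect z * defect w != 0 by rewrite gt_eqF // mulr_gt0.
apply/eqP; apply: (mulIf nz).
transitivity (hm (f z) (f w) ^+ 2 * (defect z * defect w) * defect (f 0) ^+ 2); first by ring.
rewrite rzw.
transitivity (hm z w ^+ 2 * (hm (f z) (f 0) ^+ 2 * defect z) * (hm (f w) (f 0) ^+ 2 * defect w)).
  by rewrite rz rw; ring.
by ring.
Qed.

(** Approach the boundary point along a radius. *)
Lemma near_boundary f g : boundary_extension f g -> forall x (e : R), 0 < e ->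
  exists z, [/\ 0 < defect z, nr (set_val x - z) < e & nr (set_val (g x) - f z) < e].
Proof.
move=> /boundary_extensionP fg x e e0; have [d d0 hd] := fg x e e0.
pose t := Num.min (Num.min (d / 2) (e / 2)) (1 / 2).
have t0 : 0 < t by rewrite !lt_min !divr_gt0 //.
have [td te t1] : [/\ t <= d / 2, t <= e / 2 & t <= 1 / 2].
  by split; rewrite !ge_min lexx ?orbT.
have zE : set_val x - (1 - t)%:C *: set_val x = t%:C *: set_val x.
  rewrite -[X in X - _]scale1r -scalerBl; congr (_ *: _).
  by apply: eqC; rewrite ?ReD ?ImD ?ReN ?ImN /=; ring.
have nx : nr (set_val x) = 1 by rewrite /nr rd_boundary sqrtr1.
exists ((1 - t)%:C *: set_val x).
have zp : 0 < defect ((1 - t)%:C *: set_val x).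
  rewrite /defect rdZl rdZr rd_boundary mulr1.
  have : 0 < t * (2 - t) by rewrite mulr_gt0 //; lra.
  have -> : t * (2 - t) = 1 - (1 - t) * (1 - t) by ring.
  by [].
have zx : nr (set_val x - (1 - t)%:C *: set_val x) = t.
  by rewrite zE nrZ nx mulr1 gtr0_norm.
split=> //; first by rewrite zx; lra.
by apply: hd; [exact/HC_def|rewrite zx; lra].
Qed.

Lemma eq_small (a b c : R) : (forall e, 0 < e -> `|a - b| <= c * e) -> a = b.
Proof.
move=> h; apply/eqP; rewrite -subr_eq0 -normr_le0; apply/ler_addgt0Pl => e e0.
rewrite addr0; apply: (le_trans (h (e / (`|c| + 1)) _)).
  by rewrite divr_gt0 // ltr_wpDl.
rewrite mulrA ler_pdivrMr ?ltr_wpDl // mulrC ler_wpM2l ?(ltW e0) //.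
by apply: (le_trans (ler_norm c)); rewrite lerDl.
Qed.

Lemma hm02 z w : 0 <= defect z -> 0 <= defect w -> 0 <= hm z w <= 2.
Proof. by move=> hz hw; rewrite hm_ge0 hm_le2. Qed.

Lemma mul3_lip (a b c a' b' c' e : R) :
  0 <= a <= 2 -> 0 <= b <= 2 -> 0 <= c <= 2 ->
  0 <= a' <= 2 -> 0 <= b' <= 2 -> 0 <= c' <= 2 ->
  `|a - a'| <= e -> `|b - b'| <= e -> `|c - c'| <= e ->
  `|a * b * c - a' * b' * c'| <= 12 * e.
Proof.
move=> /andP[a0 a2] /andP[b0 b2] /andP[c0 c2] /andP[a'0 a'2] /andP[b'0 b'2] /andP[c'0 c'2].
move=> ha hb hc; have e0 : 0 <= e by apply: le_trans ha.
have -> : a * b * c - a' * b' * c' = (a - a') * (b * c) + a' * c * (b - b') + a' * b' * (c - c').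
  by ring.
have bound u v d : 0 <= u -> u <= 2 -> 0 <= v -> v <= 2 -> `|d| <= e -> `|u * v * d| <= 4 * e.
  move=> u0 u2 v0 v2 de; rewrite !normrM (ger0_norm u0) (ger0_norm v0).
  apply: ler_pM => //; first by rewrite mulr_ge0.
  have -> : 4 = 2 * 2 :> R by ring.
  exact: ler_pM.
have h1 := bound b c (a - a') b0 b2 c0 c2 ha.
have h2 := bound a' c (b - b') a'0 a'2 c0 c2 hb.
have h3 := bound a' b' (c - c') a'0 a'2 b'0 b'2 hc.
rewrite mulrC in h1.
have := ler_normD ((a - a') * (b * c) + a' * c * (b - b')) (a' * b' * (c - c')).
have := ler_normD ((a - a') * (b * c)) (a' * c * (b - b')).
lra.
Qed.

(** Both sides are Lipschitz in z and [f z] on the closed ball, so the identity of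
    [isometry_herm] survives the passage to a boundary point, first in one variable
    and then in the other. *)
Lemma herm_limit f g (a a' p : 'rV[R[i]]_n) : HC_isometry f -> boundary_extension f g ->
  0 <= defect a -> 0 <= defect a' -> 0 < defect p ->
  (forall z, 0 < defect z -> hm a' (f z) * defect p = hm a z * hm a' p * hm (f z) p) ->
  forall y, hm a' (set_val (g y)) * defect p
    = hm a (set_val y) * hm a' p * hm (set_val (g y)) p.
Proof.
move=> fI fg ha ha' p0 H y; have D := defect_boundary.
apply: (@eq_small _ _ 14) => e e0.
have [w [hw yw gyw]] := near_boundary fg y e0.
have E := H w hw.
have fw0 : 0 < defect (f w) by case: fI => -[fH _ _] _; apply/HC_def/fH/HC_def.
have p1 : defect p <= 1 by rewrite /defect gerBl rd_ge0.
have h1 : `|hm a' (set_val (g y)) - hm a' (f w)| <= e.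
  rewrite (le_trans (hm_dist _ _ _ _)) ?D ?(ltW fw0) //.
  by rewrite subrr nr0 add0r ltW.
have h2 : `|hm a (set_val y) - hm a w| <= e.
  rewrite (le_trans (hm_dist _ _ _ _)) ?D ?(ltW hw) //.
  by rewrite subrr nr0 add0r ltW.
have h3 : `|hm (set_val (g y)) p - hm (f w) p| <= e.
  rewrite (le_trans (hm_dist _ _ _ _)) ?D ?(ltW fw0) ?(ltW p0) //.
  by rewrite subrr nr0 addr0 ltW.
have h4 : `|hm a' (set_val (g y)) * defect p - hm a' (f w) * defect p| <= e.
  rewrite -mulrBl normrM (ger0_norm (ltW p0)).
  by rewrite (le_trans _ h1) // ler_piMr.
have h5 : `|hm a (set_val y) * hm a' p * hm (set_val (g y)) p
   - hm a w * hm a' p * hm (f w) p| <= 12 * e.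
  apply: mul3_lip; rewrite ?subrr ?normr0 ?(ltW e0) //;
    apply: hm02; rewrite ?D //; exact: ltW.
rewrite E in h4.
move: h4 h5; rewrite !ler_norml; lra.
Qed.

Lemma isometry_herm_mixed f g : HC_isometry f -> boundary_extension f g ->
  forall z y, 0 < defect z ->
  hm (f z) (set_val (g y)) * defect (f 0)
    = hm z (set_val y) * hm (f z) (f 0) * hm (set_val (g y)) (f 0).
Proof.
move=> fI fg z y hz.
have fp w : 0 < defect w -> 0 < defect (f w) by case: fI => -[fH _ _] _ /HC_def/fH/HC_def.
apply: (herm_limit fI fg) => [|||w hw]; last exact: isometry_herm.
- exact: ltW.
- exact: ltW (fp _ hz).
- by apply: fp; rewrite defect0.
Qed.

Lemma boundary_herm f g : HC_isometry f -> boundary_extension f g ->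
  forall x y, hm (set_val (g x)) (set_val (g y)) * defect (f 0)
    = hm (set_val x) (set_val y) * hm (set_val (g x)) (f 0) * hm (set_val (g y)) (f 0).
Proof.
move=> fI fg x y; apply: (herm_limit fI fg) => [|||w hw]; rewrite ?defect_boundary //.
  by case: fI => -[fH _ _] _; apply/HC_def/fH/HC_def; rewrite defect0.
by rewrite hmC (isometry_herm_mixed fI fg) // (hmC w) mulrAC.
Qed.

End ConfBasics.

(** * The group of conformal maps *)

Section ConfGroup.
Variables (R : realType) (n : nat).
Implicit Types (z w p q : 'rV[R[i]]_n) (x y : HC_boundary R n).
Implicit Types (f : 'rV[R[i]]_n -> 'rV[R[i]]_n) (g : HC_boundary R n -> HC_boundary R n).

Notation bhm x y := (hm (set_val x) (set_val y)).

Lemma bdist_le_hm x y : bdist x y ^+ 2 <= 2 * bhm x y.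
Proof. by apply: nr_le_hm; rewrite defect_boundary. Qed.

Lemma hm_le_bdist x y : bhm x y <= bdist x y.
Proof. exact: hm_le_nr. Qed.

Lemma bhm0_eq x y : bhm x y <= 0 -> x = y.
Proof.
move=> h; apply: bdist0_eq; apply/eqP; rewrite -sqrf_eq0 eq_le sqr_ge0 andbT.
by have := bdist_le_hm x y; lra.
Qed.

Lemma defect_bge0 x : 0 <= defect (set_val x : 'rV[R[i]]_n).
Proof. by rewrite (defect_boundary x). Qed.

Lemma bhmxx x : bhm x x = 0.
Proof. by rewrite hm_self (defect_boundary x). Qed.

Lemma defect_le2nr p : 0 < defect p -> defect p <= 2 * (1 - nr p).
Proof.
move=> /nr_lt1 h; rewrite /defect -nr_sqr.
have -> : 1 - nr p ^+ 2 = (1 + nr p) * (1 - nr p) by ring.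
by rewrite ler_wpM2r //; lra.
Qed.

Lemma hm_ge_def2 z p : 0 <= defect z -> 0 < defect p -> defect p / 2 <= hm z p.
Proof. by move=> hz hp; have := defect_le2nr hp; have := hm_ge p hz; lra. Qed.

(** What is remembered of an isometry f extending to g: its behaviour at the
    centre, through [p = f 0] and [q = f^-1 0]. *)
Definition conf_data g p q :=
  [/\ 0 < defect p, defect q = defect p,
     forall x, hm (set_val x) q * hm (set_val (g x)) p = defect p &
     forall x y, bhm (g x) (g y) * defect p
       = bhm x y * hm (set_val (g x)) p * hm (set_val (g y)) p].

Lemma isometry_HC f : HC_isometry f -> forall z, 0 < defect z -> 0 < defect (f z).
Proof. by case=> -[fH _ _] _ z /HC_def/fH/HC_def. Qed.

Lemma isometry_inverse f : HC_isometry f -> exists f', [/\ HC_isometry f',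
  forall z, 0 < defect z -> f' (f z) = z & forall z, 0 < defect z -> f (f' z) = z].
Proof.
move=> fI; have [[fH finj fsurj] fd] := fI.
have ex z : exists w, 0 < defect z -> 0 < defect w /\ f w = z.
  have [zH|zH] := pselect (0 < defect z); last by exists 0.
  by have [w /HC_def wH fw] := fsurj z (proj2 (HC_def z) zH); exists w.
have [f' hf'] := choice ex.
have fK z : 0 < defect z -> f' (f z) = z.
  move=> hz; have [h1 h2] := hf' _ (isometry_HC fI hz).
  by apply: finj => //; apply/mem_set/HC_def.
have f'K z : 0 < defect z -> f (f' z) = z by move=> /hf'[].
exists f'; split=> //; split; last first.
  move=> z w /HC_def hz /HC_def hw; have [hz' ez] := hf' z hz; have [hw' ew] := hf' w hw.
  by rewrite -{2}ez -{2}ew fd //; exact/HC_def.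
split=> [z /HC_def hz|z w /set_mem/HC_def hz /set_mem/HC_def hw e|z /HC_def hz].
- by apply/HC_def; case: (hf' z hz).
- by rewrite -(f'K z hz) e f'K.
- by exists (f z); [apply/HC_def; exact: isometry_HC|exact: fK].
Qed.

Lemma Conf_data f g : HC_isometry f -> boundary_extension f g ->
  exists q, conf_data g (f 0) q.
Proof.
move=> fI fg; have [f' [f'I fK f'K]] := isometry_inverse fI.
have d0 : 0 < defect (0 : 'rV[R[i]]_n) by rewrite defect0.
have q0 := isometry_HC f'I d0; have p0 := isometry_HC fI d0.
exists (f' 0).
have pq : defect (f' 0) = defect (f 0).
  have := isometry_herm fI q0 q0; rewrite f'K // hm_self ?(ltW d0) //.
  by rewrite hm0l hm_self ?(ltW q0) // defect0 mul1r !mulr1 => ->.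
split=> // [x|x y]; last exact: boundary_herm.
have := isometry_herm_mixed fI fg x q0; rewrite f'K // !hm0l mul1r mulr1 => ->.
by rewrite (hmC (set_val x)).
Qed.

(** Together with [conf_data_lower]: on the sphere [hm _ p] lies between
    [defect p / 2] and 2, so g is bi-Lipschitz for [hm]. *)
Lemma conf_data_holder g p q : conf_data g p q -> forall x y,
  bhm (g x) (g y) * defect p <= 4 * bhm x y.
Proof.
case=> p0 _ _ h x y; rewrite h -mulrA mulrC ler_wpM2r ?hm_ge0 //.
have -> : 4 = 2 * 2 :> R by ring.
by apply: ler_pM; rewrite ?hm_ge0 // hm_le2 ?defect_boundary // ltW.
Qed.

Lemma conf_data_lower g p q : conf_data g p q -> forall x y,
  bhm x y * defect p <= 4 * bhm (g x) (g y).
Proof.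
case=> p0 _ _ h x y.
have hx := @hm_ge_def2 (set_val (g x)) p; have hy := @hm_ge_def2 (set_val (g y)) p.
rewrite !defect_boundary in hx hy; have {}hx := hx (lexx _) p0; have {}hy := hy (lexx _) p0.
rewrite -(ler_pM2r p0) -[X in _ <= X]mulrA h.
have -> : bhm x y * defect p * defect p = 4 * (bhm x y * (defect p / 2) * (defect p / 2)) by field.
rewrite ler_pM2l // -[X in X <= _]mulrA -[X in _ <= X]mulrA ler_wpM2l ?hm_ge0 //.
by apply: ler_pM => //; rewrite divr_ge0 // ltW.
Qed.

Lemma conf_data_inj g p q : conf_data g p q -> injective g.
Proof.
move=> gd x y e; apply: bhm0_eq; have [p0 _ _ _] := gd.
have := conf_data_lower gd x y; rewrite e hm_self defect_boundary // mulr0.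
by rewrite pmulr_lle0.
Qed.

Lemma hm_continuous g (c : R) : 0 <= c ->
  (forall x y, bhm (g x) (g y) <= c * bhm x y) -> continuous g.
Proof.
move=> c0 h; apply/boundary_continuousP => x e e0.
have d0 : 0 < e ^+ 2 / (2 * (c + 1)).
  by rewrite divr_gt0 ?exprn_gt0 // mulr_gt0 // ltr_wpDl.
exists (e ^+ 2 / (2 * (c + 1))) => // y xy.
rewrite -(ltr_pXn2r (n:=2)) ?nnegrE ?bdist_ge0 ?(ltW e0) //.
apply: (le_lt_trans (bdist_le_hm _ _)).
have c1 : 0 < 2 * (c + 1) by rewrite mulr_gt0 // ltr_wpDl.
move: xy; rewrite ltr_pdivlMr // => xy.
have := h x y; have := hm_le_bdist x y; have := bdist_ge0 x y => b0 h1 h2.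
have : c * bhm x y <= c * bdist x y by rewrite ler_wpM2l.
lra.
Qed.

Lemma conf_data_continuous g p q : conf_data g p q -> continuous g.
Proof.
move=> gd; have [p0 _ _ _] := gd; apply: (@hm_continuous g (4 / defect p)).
  by rewrite divr_ge0 // ltW.
move=> x y; rewrite mulrAC ler_pdivlMr //; exact: (conf_data_holder gd).
Qed.

Lemma nat_ultra : exists U : set_system nat, UltraFilter U /\ \oo `<=` U.
Proof. exact: ultraFilterLemma. Qed.

(** The sphere is closed and bounded. *)
Lemma ultra_boundary (U : set_system nat) (hU : UltraFilter U)
    (u : nat -> HC_boundary R n) :
  exists x, forall e, 0 < e -> U [set k | bdist x (u k) < e].
Proof.
have UF : ProperFilter U := @ultra_proper _ _ hU.
have b1 : U [set k | nr (set_val (u k)) <= 1].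
  by apply: filterE => k /=; rewrite nr_le1 // defect_boundary.
have [l hl] := ultra_limV hU b1.
suff lS : @HC_sphere R n l by exists (exist _ l (mem_set lS)) => e /hl.
apply/HC_sphere_def; rewrite /defect; apply/eqP; rewrite subr_eq0 eq_sym -nr_sqr.
rewrite sqrp_eq1 ?nr_ge0 //; apply/eqP; apply: (@eq_small _ _ _ 1) => e e0.
have [k] := filter_ex (hl e e0); rewrite /= mul1r => h.
have nx : nr (set_val (u k)) = 1 by rewrite /nr rd_boundary sqrtr1.
have := nrD (l - set_val (u k)) (set_val (u k)); rewrite subrK nx.
have := nrD (set_val (u k) - l) l; rewrite subrK nx nrB.
rewrite ler_norml; lra.
Qed.

Lemma ultra_nr_le (U : set_system nat) (hU : UltraFilter U) (w : nat -> 'rV[R[i]]_n) l M :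
  (forall e, 0 < e -> U [set k | nr (l - w k) < e]) -> (forall k, nr (w k) <= M) -> nr l <= M.
Proof.
move=> hl wM; apply/ler_addgt0Pr => e e0.
have UF : ProperFilter U := @ultra_proper _ _ hU.
have [k /= h] := filter_ex (hl e e0).
have := nrD (l - w k) (w k); rewrite subrK; have := wM k; lra.
Qed.

Lemma defect_lip z w : nr z <= 1 -> nr w <= 1 -> `|defect z - defect w| <= 2 * nr (z - w).
Proof.
move=> hz hw; have := nr_ge0 z; have := nr_ge0 w.
have := nrD (z - w) w; rewrite subrK.
have := nrD (w - z) z; rewrite subrK nrB => a1 a2 a3 a4.
rewrite /defect -!nr_sqr.
have -> : 1 - nr z ^+ 2 - (1 - nr w ^+ 2) = (nr z + nr w) * (nr w - nr z) by ring.
by rewrite normrM; apply: ler_pM => //; rewrite ler_norml; lra.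
Qed.

(** Let z_k tend to y.  The identity [isometry_herm] at f^-1 z_k shows that these
    points tend to the sphere; a limit of them is mapped to y. *)
Lemma Conf_surj f g : HC_isometry f -> boundary_extension f g ->
  forall y, exists x, g x = y.
Proof.
move=> fI fg y.
have [f' [f'I fK f'K]] := isometry_inverse fI.
have [q gd] := Conf_data fI fg; have [p0 qp _ _] := gd.
have [U [hU hoo]] := nat_ultra.
have UF : ProperFilter U := @ultra_proper _ _ hU.
have nb (k : nat) : exists z, 0 < defect z /\ nr (set_val y - z) < k.+1%:R^-1.
  have idI : HC_isometry (@id 'rV[R[i]]_n).
    by split=> //; split=> [z|z w|z hz] //; exists z.
  have ide : boundary_extension (@id 'rV[R[i]]_n) (@id (HC_boundary R n)).
    by apply/boundary_extensionP => x e e0; exists e.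
  by have [|z [? ? _]] := near_boundary ide y (e := k.+1%:R^-1);
    rewrite ?invr_gt0 ?ltr0n //; exists z.
have [z hz] := choice nb.
have b1 : U [set k | nr (f' (z k)) <= 1].
  apply: filterE => k /=; have [h _] := hz k.
  by rewrite nr_le1 // ltW // isometry_HC.
have [l hl] := ultra_limV hU b1.
(* by isometry_herm, the points f' (z k) tend to the sphere with z k *)
have zlim e : 0 < e -> U [set k | nr (set_val y - z k) < e].
  move=> e0; apply: filterS (ultra_inv hU hoo e0) => k /= h.
  by have [_ h2] := hz k; exact: lt_trans h.
have defb k : defect (f' (z k)) * (defect (f 0) / 2) ^+ 2 <= 2 * nr (set_val y - z k) * defect (f 0).
  have [zk _] := hz k; have wk := isometry_HC f'I zk.
  have := isometry_herm fI wk wk; rewrite f'K // !hm_self ?(ltW zk) ?(ltW wk) //.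
  move=> E; have h1 := hm_ge_def2 (ltW zk) p0.
  apply: (@le_trans _ _ (defect (z k) * defect (f 0))).
    rewrite E -mulrA ler_wpM2l ?(ltW wk) // -expr2.
    by rewrite ler_pXn2r ?nnegrE ?hm_ge0 // divr_ge0 // ltW.
  rewrite ler_wpM2r ?(ltW p0) // -(hm_self (ltW zk)).
  have := hm_dist (ltW zk) (ltW zk) (defect_bge0 y) (defect_bge0 y).
  rewrite bhmxx subr0 (nrB (z k)) ger0_norm ?hm_ge0 //; lra.
have w1 k : nr (f' (z k)) <= 1.
  by have [h _] := hz k; rewrite nr_le1 // ltW // isometry_HC.
have l1 := ultra_nr_le hU hl w1.
pose c := (defect (f 0) / 2) ^+ 2.
have c0 : 0 < c by rewrite exprn_gt0 // divr_gt0.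
have lS : @HC_sphere R n l.
  apply/HC_sphere_def; apply: (@eq_small _ _ _ (2 + 2 * defect (f 0) / c)) => e e0.
  have [k [/= h1 h2]] := filter_ex (filterI (hl e e0) (zlim e e0)).
  have [zk _] := hz k; have wk := isometry_HC f'I zk.
  have := defect_lip l1 (w1 k); have db : defect (f' (z k)) <= 2 * defect (f 0) / c * e.
    rewrite mulrAC ler_pdivlMr // (le_trans (defb k)) //.
    by rewrite mulrAC ler_wpM2l ?mulr_ge0 ?(ltW p0) // ltW.
  by rewrite subr0 mulrDl !ler_norml; lra.
exists (exist _ l (mem_set lS)).
apply: bdist0_eq; apply: (@eq_small _ _ _ 2) => e e0.
have [d d0 hd] := proj1 (boundary_extensionP f g) fg (exist _ l (mem_set lS)) e e0.
have [k [/= h1 h2]] := filter_ex (filterI (hl d d0) (zlim e e0)).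
have [zk _] := hz k; have wk := isometry_HC f'I zk.
have := hd _ (proj2 (HC_def _) wk) h1; rewrite f'K // => h3.
rewrite subr0 ger0_norm ?bdist_ge0 //.
apply: (le_trans (nr_triangle (z k) _ _)); rewrite (nrB (z k)); lra.
Qed.

(** The identity [isometry_herm_mixed] bounds [hm (f^-1 z) (g^-1 y)] by a multiple
    of [hm z y], so the inverse isometry extends by the inverse of g. *)
Lemma Conf_inverse g : @Conf R n g ->
  exists g', [/\ @Conf R n g', cancel g g' & cancel g' g].
Proof.
case=> f fI fg; have [f' [f'I fK f'K]] := isometry_inverse fI.
have [q gd] := Conf_data fI fg; have [p0 qp _ _] := gd.
have [g' hg'] := choice (Conf_surj fI fg).
have gK : cancel g g' by move=> x; apply: (conf_data_inj gd); exact: hg'.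
exists g'; split; [|exact: gK|exact: hg'].
exists f'; first exact: f'I.
apply/boundary_extensionP => y e e0.
pose c := (defect (f 0) / 2) ^+ 2.
have c0 : 0 < c by rewrite exprn_gt0 // divr_gt0.
exists (e ^+ 2 * c / (2 * defect (f 0))).
  by rewrite divr_gt0 ?mulr_gt0 ?exprn_gt0.
move=> z /HC_def hz; rewrite ltr_pdivlMr ?mulr_gt0 // => zy.
have wz := isometry_HC f'I hz.
have := isometry_herm_mixed fI fg (g' y) wz; rewrite f'K // hg' => E.
rewrite -(ltr_pXn2r (n:=2)) ?nnegrE ?nr_ge0 ?(ltW e0) // nrB.
apply: (le_lt_trans (nr_le_hm _ (ltW wz))); rewrite -(ltr_pM2r c0).
apply: le_lt_trans zy; rewrite nrB.
apply: (@le_trans _ _ (2 * (hm z (set_val y) * defect (f 0)))); last first.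
  have : hm z (set_val y) * defect (f 0) <= nr (z - set_val y) * defect (f 0).
    by rewrite ler_wpM2r ?(ltW p0) // hm_le_nr.
  lra.
rewrite E -!(mulrA 2) ler_pM2l // -[X in _ <= X]mulrA ler_wpM2l ?hm_ge0 //.
rewrite /c expr2; apply: ler_pM; rewrite ?divr_ge0 ?(ltW p0) //.
  by apply: hm_ge_def2 => //; exact: ltW.
by apply: hm_ge_def2 => //; rewrite defect_boundary.
Qed.

Lemma Conf_subgroup : homeo_subgroup (@Conf R n).
Proof.
split.
- move=> g gC; have [g' [g'C gK g'K]] := Conf_inverse gC.
  have cont h : @Conf R n h -> continuous h.
    by case=> f fI fh; have [q hd] := Conf_data fI fh; exact: conf_data_continuous hd.
  by split; [exact: cont|exists g'; split; [exact: gK|exact: g'K|exact: cont]].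
- exists id; last by apply/boundary_extensionP => x e e0; exists e.
  by split=> //; split=> [z|z w|z hz] //; exists z.
- move=> g h [f fI fg] [k kI kh]; exists (f \o k).
    split; last first.
      move=> z w hz hw /=; have [[kH _ _] kd] := kI; have [_ fd] := fI.
      by rewrite fd ?kd //; exact: kH.
    by have [kb _] := kI; have [fb _] := fI; exact: set_bij_comp kb fb.
  apply/boundary_extensionP => x e e0.
  have [d d0 hd] := proj1 (boundary_extensionP _ _) fg (h x) e e0.
  have [d' d'0 hd'] := proj1 (boundary_extensionP _ _) kh x d d0.
  exists d' => // z zH zx; apply: hd; last exact: hd'.
  by case: kI => -[kH _ _] _; exact: kH.
- move=> g h /Conf_inverse[g' [g'C gK g'K]] gh hg.
  suff -> : h = g' by [].
  by apply/funext => x; rewrite -{1}(g'K x) gh.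
Qed.

End ConfGroup.

(** * The convergence property of conformal maps *)

Section ConfConvergence.
Variables (R : realType) (n : nat).
Implicit Types (z w p q : 'rV[R[i]]_n) (x y : HC_boundary R n).
Implicit Types (g : HC_boundary R n -> HC_boundary R n).
Notation bhm x y := (hm (set_val x) (set_val y)).

Lemma bdist_lt_of_hm x y (c e : R) : 0 <= c -> 0 < e -> bhm x y <= c ->
  2 * c < e ^+ 2 -> bdist x y < e.
Proof.
move=> c0 e0 h ce; rewrite -(ltr_pXn2r (n:=2)) ?nnegrE ?bdist_ge0 ?(ltW e0) //.
by have := bdist_le_hm x y; lra.
Qed.

(** The bounds make the maps and their inverses equicontinuous.  Pointwise limits
    along the ultrafilter are then inverse homeomorphisms, and convergence is
    uniform: otherwise take a limit of points where it fails. *)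
Lemma equi_limit (U : set_system nat) (hU : UltraFilter U) (hoo : \oo `<=` U)
   (u : nat -> HC_boundary R n -> HC_boundary R n) (c : R) : 0 < c ->
   (forall k, homeomorphism (u k)) ->
   U [set k | forall x y, bhm (u k x) (u k y) <= c * bhm x y /\
                          bhm x y <= c * bhm (u k x) (u k y)] ->
   exists2 h, homeomorphism h &
     forall e, 0 < e -> U [set k | forall x, bdist (h x) (u k x) < e].
Proof.
move=> c0 uh uc.
have UF : ProperFilter U := @ultra_proper _ _ hU.
have [h hh] := choice (fun x => ultra_boundary hU (fun k => u k x)).
have modulus e : 0 < e -> exists2 d, 0 < d & U [set k | forall x y, bdist x y < d ->
    bdist (u k x) (u k y) < e].
  move=> e0; exists (e ^+ 2 / (4 * c)); first by rewrite divr_gt0 ?exprn_gt0 // mulr_gt0.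
  apply: filterS uc => k /= hk x y; rewrite ltr_pdivlMr ?mulr_gt0 // => xy.
  have [h1 _] := hk x y; apply: (@bdist_lt_of_hm _ _ (c * bdist x y)) => //.
  - by rewrite mulr_ge0 ?bdist_ge0 // ltW.
  - by apply: (le_trans h1); rewrite ler_pM2l // hm_le_bdist.
  - by move: xy; have := bdist_ge0 x y; rewrite -subr_gt0 => b0 b1;
      have := exprn_gt0 2 e0; have := mulr_ge0 (ltW c0) b0; lra.
have hlip x y : bhm (h x) (h y) <= c * bhm x y /\ bhm x y <= c * bhm (h x) (h y).
  have appr e : 0 < e -> exists2 k, forall x y, bhm (u k x) (u k y) <= c * bhm x y /\
      bhm x y <= c * bhm (u k x) (u k y) &
      `|bhm (h x) (h y) - bhm (u k x) (u k y)| <= 2 * e.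
    move=> e0; have [k [/= [h1 h2] h3]] := filter_ex (filterI (filterI (hh x e e0) (hh y e e0)) uc).
    exists k => //; apply: (le_trans (hm_dist _ _ _ _)); rewrite ?defect_bge0 //.
    by rewrite -!/(bdist _ _); lra.
  split; apply/ler_addgt0Pr => e e0.
    have e20 : 0 < e / 2 by rewrite divr_gt0.
    have [k hk] := appr _ e20; have [a1 _] := hk x y.
    by rewrite ler_norml; lra.
  have e20 : 0 < e / (2 * c) by rewrite divr_gt0 // mulr_gt0.
  have [k hk] := appr _ e20; have [_ a1] := hk x y.
  rewrite ler_norml => /andP[a2 _]; apply: (le_trans a1).
  have -> : c * bhm (h x) (h y) + e = c * (bhm (h x) (h y) + 2 * (e / (2 * c))).
    by field; rewrite gt_eqF.
  by rewrite ler_pM2l //; lra.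
have hinj x y : h x = h y -> x = y.
  move=> e; apply: bhm0_eq; have [_] := hlip x y.
  by rewrite e bhmxx mulr0.
have ginv k := proj2 (uh k).
have [v hv] := choice ginv.
have [h' hh'] := choice (fun x => ultra_boundary hU (fun k => v k x)).
have h'K : cancel h' h.
  move=> x; apply: bdist0_eq; apply: (@eq_small _ _ _ 2) => e e0.
  have [d d0 hd] := modulus e e0.
  have [k [/= [h1 h2] h3]] := filter_ex (filterI (filterI hd (hh (h' x) e e0)) (hh' x d d0)).
  have [_ vK _] := hv k.
  have := h1 _ _ h3; rewrite vK => h4.
  rewrite subr0 ger0_norm ?bdist_ge0 //.
  by have := bdist_tri (u k (h' x)) (h (h' x)) x; lra.
have hK : cancel h h' by move=> x; apply: hinj; rewrite h'K.
exists h.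
  split; first by apply: (hm_continuous (ltW c0)) => x y; case: (hlip x y).
  exists h'; split => //; apply: (hm_continuous (ltW c0)) => x y.
  by have [_] := hlip (h' x) (h' y); rewrite !h'K.
move=> e e0; have [//|nU] := in_ultra_setVsetC [set k | forall x, bdist (h x) (u k x) < e] hU.
exfalso.
have [k0 /existsNP[x0 _]] := filter_ex nU.
have ex k : exists x, (~ forall x, bdist (h x) (u k x) < e) -> e <= bdist (h x) (u k x).
  have [hx|/existsNP[x /negP]] := pselect (forall x, bdist (h x) (u k x) < e).
    by exists x0 => /(_ hx).
  by rewrite -leNgt => ?; exists x.
have [s hs] := choice ex.
have [x hx] := ultra_boundary hU s.
have e30 : 0 < e / 3 by rewrite divr_gt0.
have [d d0 hd] := modulus _ e30.
have /boundary_continuousP/(_ x _ e30)[d' d'0 hd'] : continuous h.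
  by apply: (hm_continuous (ltW c0)) => a b; case: (hlip a b).
have [k [[/= h1 h2] [h3 [h4 h5]]]] := filter_ex
  (filterI (filterI nU hd) (filterI (hh x _ e30) (filterI (hx d d0) (hx d' d'0)))).
have := hs k h1; have := h2 _ _ h4; have := hd' _ h5.
have := bdist_tri (h x) (h (s k)) (u k (s k)).
have := bdist_tri (u k x) (h x) (u k (s k)).
rewrite (bdistC (h (s k)) (h x)); lra.
Qed.

(** The alternative is decided by the limit of the images p_k of the centre.  In
    the ball, it gives uniform bi-Lipschitz bounds; on the sphere, the identity
    [hm x q_k * hm (g_k x) p_k = defect p_k], whose right-hand side tends to 0,
    makes [lim p_k] the attractor and [lim q_k] the repeller. *)
Lemma Conf_convergence : convergence_property (@Conf R n).
Proof.
move=> u uC.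
have data k : exists pq, conf_data (u k) pq.1 pq.2.
  by have [f fI fu] := uC k; have [q hq] := Conf_data fI fu; exists (f 0, q).
have [pq hpq] := choice data.
pose p k := (pq k).1; pose q k := (pq k).2.
have [U [hU hoo]] := nat_ultra.
have UF : ProperFilter U := @ultra_proper _ _ hU.
have p0 k : 0 < defect (p k) by case: (hpq k).
have qp k : defect (q k) = defect (p k) by case: (hpq k).
have p1 k : nr (p k) <= 1 by rewrite nr_le1 // ltW.
have q1 k : nr (q k) <= 1 by rewrite nr_le1 // qp ltW.
have [lp hlp] := ultra_limV hU (filterE _ p1 : U [set k | nr (p k) <= 1]).
have [lq hlq] := ultra_limV hU (filterE _ q1 : U [set k | nr (q k) <= 1]).
have lp1 := ultra_nr_le hU hlp p1; have lq1 := ultra_nr_le hU hlq q1.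
have defp e : 0 < e -> U [set k | `|defect lp - defect (p k)| < e].
  move=> e0; have e20 : 0 < e / 2 by rewrite divr_gt0.
  by apply: filterS (hlp _ e20) => k /= h; have := defect_lip lp1 (p1 k); lra.
have defq e : 0 < e -> U [set k | `|defect lq - defect (p k)| < e].
  move=> e0; have e20 : 0 < e / 2 by rewrite divr_gt0.
  by apply: filterS (hlq _ e20) => k /= h; rewrite -qp; have := defect_lip lq1 (q1 k); lra.
have lpq : defect lp = defect lq.
  apply: (@eq_small _ _ _ 2) => e e0.
  have [k [/= h1 h2]] := filter_ex (filterI (defp e e0) (defq e e0)).
  by move: h1 h2; rewrite !ltr_norml ler_norml; lra.
have lpge : 0 <= defect lp by rewrite /defect subr_ge0 -nr_sqr expr_le1 ?nr_ge0.
have [lp0|lp0] := eqVneq (defect lp) 0; last first.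
  (* along the ultrafilter, the p k stay in a compact part of the open ball *)
  have {lp0}lpos : 0 < defect lp by rewrite lt_neqAle eq_sym lp0.
  have l20 : 0 < defect lp / 2 by rewrite divr_gt0.
  have c0 : 0 < 8 / defect lp by rewrite divr_gt0.
  have uh k : homeomorphism (u k) by have [Ch _ _ _] := Conf_subgroup R n; exact: Ch.
  have uc : U [set k | forall x y, bhm (u k x) (u k y) <= 8 / defect lp * bhm x y /\
                          bhm x y <= 8 / defect lp * bhm (u k x) (u k y)].
    apply: filterS (defp _ l20) => k /=; rewrite ltr_norml => h x y.
    have hp : defect lp <= 2 * defect (p k) by lra.
    have cmp a b : 0 <= a -> a * defect (p k) <= 4 * b -> a <= 8 / defect lp * b.
      move=> a0 ab; rewrite mulrAC ler_pdivlMr //.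
      by have := ler_wpM2l a0 hp; lra.
    split; apply: cmp; rewrite ?hm_ge0 //.
      exact: (conf_data_holder (hpq k)).
    exact: (conf_data_lower (hpq k)).
  have [h hh hu] := equi_limit hU hoo c0 uh uc.
  have hi (j : nat) : 0 < j.+1%:R^-1 :> R by rewrite invr_gt0 ltr0n.
  have [phi phi_mono hphi] := ultra_extract hU hoo (fun j => hu _ (hi j)).
  exists phi => //; left; exists h => //.
  apply/boundary_uniformP => e e0.
  have [N hN] : exists N : nat, e^-1 < N%:R.
    by exists (Num.bound e^-1); rewrite archi_boundP // invr_ge0 ltW.
  exists N => k Nk x _ /=; apply: (lt_trans (hphi k x)).
  by rewrite invf_plt ?posrE // (lt_le_trans hN) // ler_nat (leq_trans Nk).
have lq0 : defect lq = 0 by rewrite -lpq.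
pose a : HC_boundary R n := exist _ lp (mem_set (proj2 (HC_sphere_def lp) lp0)).
pose r : HC_boundary R n := exist _ lq (mem_set (proj2 (HC_sphere_def lq) lq0)).
have hu e : 0 < e -> U [set k | forall x, e <= bdist r x -> bdist a (u k x) < e].
  move=> e0.
  (* hm x (q k) is at least e ^+ 2 / 4 outside the ball of radius e around r, and
     hm (u k x) a at most 4 d / e ^+ 2 + d; d is chosen
     to make the latter less than e ^+ 2 / 2 *)
  pose d := Num.min (e ^+ 2 / 8) (e ^+ 4 / 64).
  have d0 : 0 < d by rewrite lt_min !divr_gt0 ?exprn_gt0.
  have [de1 de2] : d <= e ^+ 2 / 8 /\ d <= e ^+ 4 / 64 by rewrite !ge_min !lexx orbT.
  apply: filterS (filterI (filterI (hlp d d0) (hlq d d0)) (defp d d0)) => k /=.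
  rewrite lp0 sub0r normrN (ger0_norm (ltW (p0 k))) => -[[h1 h2] h3] x rx.
  have [_ _ hx _] := hpq k.
  have hxr : e ^+ 2 <= 2 * bhm x r.
    apply: (le_trans _ (bdist_le_hm x r)); rewrite bdistC.
    by rewrite ler_pXn2r ?nnegrE ?bdist_ge0 // ltW.
  have hxq : e ^+ 2 / 4 <= hm (set_val x) (q k).
    have qk0 : 0 <= defect (q k) by rewrite qp ltW.
    have := hm_lip (set_val x) (q k) (defect_bge0 x) (defect_bge0 r).
    rewrite subrr nr0; move: h2; rewrite -/(set_val r) => h2; lra.
  have hup : hm (set_val (u k x)) (p k) <= 4 * d / e ^+ 2.
    rewrite ler_pdivlMr ?exprn_gt0 //.
    have := ler_wpM2r (hm_ge0 (set_val (u k x)) (p k)) hxq; rewrite hx; lra.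
  have h5 : hm (set_val (u k x)) (set_val a) <= 4 * d / e ^+ 2 + d.
    have := hm_lip (set_val (u k x)) (p k) (defect_bge0 (u k x)) (defect_bge0 a).
    rewrite subrr nr0; move: h1; rewrite -/(set_val a) => h1; lra.
  have e2 : 0 < e ^+ 2 by rewrite exprn_gt0.
  have dq : 0 <= 4 * d / e ^+ 2 by apply: divr_ge0; lra.
  rewrite bdistC; apply: bdist_lt_of_hm e0 h5 _; first by lra.
  have : 4 * d / e ^+ 2 <= e ^+ 2 / 16.
    rewrite ler_pdivrMr //; have -> : e ^+ 2 / 16 * e ^+ 2 = e ^+ 4 / 16 by rewrite mulrAC -exprD.
    lra.
  lra.
have hi (j : nat) : 0 < j.+1%:R^-1 :> R by rewrite invr_gt0 ltr0n.
have [phi phi_mono hphi] := ultra_extract hU hoo (fun j => hu _ (hi j)).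
exists phi => //; right; exists a, r => V Vo Vr.
have /boundary_nbhsP[e e0 eV] : nbhs r V by exact: open_nbhs_nbhs.
apply/boundary_uniformP => e' e'0.
have [N hN] : exists N : nat, (Num.min e e')^-1 < N%:R.
  by exists (Num.bound (Num.min e e')^-1); rewrite archi_boundP // invr_ge0 ltW // lt_min e0.
exists N => k Nk x Vx /=.
have : k.+1%:R^-1 < Num.min e e'.
  by rewrite invf_plt ?posrE ?lt_min ?e0 // (lt_le_trans hN) // ler_nat (leq_trans Nk).
rewrite lt_min => /andP[ke ke'].
apply: lt_trans ke'; apply: hphi.
by rewrite leNgt; apply/negP => h; apply: Vx; apply: eV; exact: lt_trans ke.
Qed.

Lemma Conf_convergence_group : convergence_group (@Conf R n).
Proof. by split; [exact: Conf_subgroup|exact: Conf_convergence]. Qed.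

End ConfConvergence.

(** * Isometries from similitudes of the Hermitian form *)

Section Lifts.
Variables (R : realType) (m : nat).
Local Notation V := 'rV[R[i]]_m.
Local Notation bdry := (HC_boundary R (1 + m)).

(** Homogeneous coordinates (z, u, w) in which the Hermitian form is
    [<z,z'> - (u w'^* + w u'^* ) / 2]: the lines of (0,1,0) and (0,0,1) are points
    of the boundary, exchanged by swapping u and w. *)
Definition lvec := (V * R[i] * R[i])%type.
Implicit Types (p q : lvec) (c : R[i]) (xi eta : 'rV[R[i]]_(1 + m)).

Definition lscale c p : lvec := (c *: p.1.1, c * p.1.2, c * p.2).
Definition lform p q : R[i] :=
  hdot p.1.1 q.1.1 - 2^-1 * (p.1.2 * (q.2)^* + p.2 * (q.1.2)^*).
Definition lsum p : R[i] := p.1.2 + p.2.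
Definition hd xi : R[i] := xi 0 (lshift m 0).
(** The point xi of the affine chart lifts to the vector (xi, 1) of C^(n+1);
    u and w are the sum and the difference of its last and first coordinates. *)
Definition lift xi : lvec := (rsubmx xi, 1 + hd xi, 1 - hd xi).
Definition proj p : 'rV[R[i]]_(1 + m) :=
  row_mx (((p.1.2 - p.2) / lsum p)%:M : 'M[R[i]]_1) ((2 / lsum p) *: p.1.1).

Lemma hdot_split xi eta :
  hdot xi eta = hd xi * (hd eta)^* + hdot (rsubmx xi) (rsubmx eta).
Proof.
rewrite /hdot big_split_ord big_ord1; congr (_ + _).
by apply: eq_bigr => k _; rewrite !mxE.
Qed.

Lemma lformE z u w z' u' w' : lform (z, u, w) (z', u', w') =
  hdot z z' - 2^-1 * (u * w'^* + w * u'^*).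
Proof. by []. Qed.

Lemma two_neq0 : 2 != 0 :> R[i].
Proof. by rewrite pnatr_eq0. Qed.

Lemma herm_lift xi eta : herm xi eta = lform (lift xi) (lift eta).
Proof.
rewrite hermE hdot_split lformE.
rewrite rmorphB rmorphD rmorph1.
by have t0 := two_neq0; field.
Qed.

Lemma hd_proj p : hd (proj p) = (p.1.2 - p.2) / lsum p.
Proof. by rewrite /hd row_mxEl mxE. Qed.

Lemma projK p : lsum p != 0 -> lift (proj p) = lscale (2 / lsum p) p.
Proof.
case: p => -[z u] w; rewrite /lift hd_proj /lscale /lsum /= => h.
by rewrite row_mxKr; congr (_, _, _); field.
Qed.

Lemma liftK xi : proj (lift xi) = xi.
Proof.
have ls : lsum (lift xi) = 2 by rewrite /lsum /=; ring.
have t0 := two_neq0.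
rewrite /proj ls divff // scale1r /= -[RHS]hsubmxK; congr row_mx.
apply/rowP => k; rewrite !ord1 !mxE /= mulr1n /hd /=.
have -> : 1 + xi 0 (lshift m 0) - (1 - xi 0 (lshift m 0)) = 2 * xi 0 (lshift m 0) by ring.
by rewrite mulrC mulKf.
Qed.

Lemma lsum_scale c p : lsum (lscale c p) = c * lsum p.
Proof. by rewrite /lsum mulrDr. Qed.

Lemma proj_scale c p : c != 0 -> proj (lscale c p) = proj p.
Proof.
move=> c0; rewrite /proj lsum_scale /= -mulrBr -mulf_div divff // mul1r.
by rewrite scalerA invfM mulrA mulrAC divfK.
Qed.

Lemma lform_scale c d p q : lform (lscale c p) (lscale d q) = c * d^* * lform p q.
Proof.
rewrite /lform /= hdotZl hdotZr.
by rewrite !rmorphM; ring.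
Qed.

(** Only the modulus of the form and homogeneity up to a scalar are prescribed,
    so that antilinear maps are included. *)
Definition similitude (k : R) (L : lvec -> lvec) :=
  [/\ 0 < k, forall c p, c != 0 -> exists2 d, d != 0 & L (lscale c p) = lscale d (L p),
      forall p q, cm (lform (L p) (L q)) = k * cm (lform p q) &
      forall p, complex.Re (lform (L p) (L p)) = k * complex.Re (lform p p)].

Lemma Re_lform p : complex.Re (lform p p) = rd p.1.1 p.1.1 -
  (complex.Re p.1.2 * complex.Re p.2 + complex.Im p.1.2 * complex.Im p.2).
Proof.
case: p => -[z u] w; rewrite lformE hdot_self.
have -> : (2^-1 : R[i]) = (2^-1)%:C by rewrite fmorphV rmorph_nat.
by rewrite !(ReD, ReN, ReM, ImM, ImD, ReJ, ImJ) /=; field.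
Qed.

(** The form is positive definite on the hyperplane u + w = 0, so a nonpositive
    vector in it vanishes: the closed ball lies in the affine chart. *)
Lemma lsum_neq0 p : complex.Re (lform p p) <= 0 -> lsum p = 0 ->
  forall q, lform p q = 0.
Proof.
rewrite Re_lform; case: p => -[z [a b]] [c d] /= h /eqP.
rewrite addr_eq0 => /eqP[ea eb]; subst a b.
have z0 : rd z z = 0 /\ c = 0 /\ d = 0.
  have h1 := rd_ge0 z; have h2 := sqr_ge0 c; have h3 := sqr_ge0 d.
  have e1 : rd z z = 0 by nra.
  have e2 : c ^+ 2 = 0 by nra.
  have e3 : d ^+ 2 = 0 by nra.
  by split=> //; split; apply/eqP; rewrite -sqrf_eq0 ?e2 ?e3.
have [e1 [-> ->]] := z0.
have -> : z = 0 by apply/eqP; rewrite -nr_eq0 -sqrf_eq0 nr_sqr e1.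
move=> q; rewrite /lform /= hdot0l oppr0.
by have -> : (0 +i* 0 : R[i]) = 0 by []; rewrite !mul0r addr0 mulr0 subr0.
Qed.

Definition lmap (L : lvec -> lvec) xi := proj (L (lift xi)).

Lemma lmap_lsum k L : similitude k L -> forall xi, 0 <= defect xi ->
  lsum (L (lift xi)) != 0.
Proof.
case=> k0 _ Lf LR xi hxi; apply/eqP => s0.
have h : complex.Re (lform (L (lift xi)) (L (lift xi))) <= 0.
  rewrite LR -herm_lift herm_self /= mulrN oppr_le0.
  by rewrite mulr_ge0 // ltW.
have /(congr1 (@cm R)) := lsum_neq0 h s0 (L (lift 0)).
rewrite Lf -herm_lift -/(hm _ _) hm0r mulr1 cm0 => k00.
by rewrite k00 ltxx in k0.
Qed.

Lemma lmapK k k' L L' : similitude k L -> similitude k' L' -> cancel L L' ->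
  forall xi, 0 <= defect xi -> lmap L' (lmap L xi) = xi.
Proof.
move=> Ls [_ L'h _ _] LK xi hxi; have s0 := lmap_lsum Ls hxi.
rewrite /lmap projK //.
have c0 : 2 / lsum (L (lift xi)) != 0 by rewrite mulf_neq0 ?two_neq0 ?invr_eq0.
have [d d0 ->] := L'h _ (L (lift xi)) c0.
by rewrite proj_scale // LK liftK.
Qed.

(** The scalar by which the lift of the image differs from the image of the lift. *)
Definition jac (L : lvec -> lvec) xi : R := cm (2 / lsum (L (lift xi))).

Lemma jac_gt0 k L : similitude k L -> forall xi, 0 <= defect xi -> 0 < jac L xi.
Proof.
by move=> Ls xi hxi; rewrite cm_gt0 mulf_neq0 ?two_neq0 ?invr_eq0 // (lmap_lsum Ls).
Qed.

Lemma hm_lmap k L : similitude k L -> forall xi eta, 0 <= defect xi -> 0 <= defect eta ->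
  hm (lmap L xi) (lmap L eta) = jac L xi * jac L eta * (k * hm xi eta).
Proof.
move=> Ls xi eta hxi heta; have [_ _ Lf _] := Ls.
rewrite /hm !herm_lift -Lf /lmap (projK (lmap_lsum Ls hxi)) (projK (lmap_lsum Ls heta)).
by rewrite lform_scale !cmM cmJ /jac !cmM.
Qed.

Lemma defect_lmap k L : similitude k L -> forall xi, 0 <= defect xi ->
  defect (lmap L xi) = jac L xi ^+ 2 * k * defect xi.
Proof.
move=> Ls xi hxi; have [_ _ _ LR] := Ls.
have E : complex.Re (herm (lmap L xi) (lmap L xi)) = jac L xi ^+ 2 * (k * - defect xi).
  rewrite herm_lift /lmap !projK ?(lmap_lsum Ls) // lform_scale mulcJ.
  by rewrite ReM /= mul0r subr0 LR -herm_lift herm_self.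
by move: E; rewrite herm_self /= => /(congr1 -%R); rewrite opprK => ->; ring.
Qed.

(** The factors of [hm_lmap] and [defect_lmap] cancel in [hratio], so L acts by
    isometries; the same formula at a boundary point bounds
    [hm (lmap L z) (lmap L x)] by [hm z x] and gives the extension. *)
Lemma lmap_Conf k k' L L' : similitude k L -> similitude k' L' ->
  cancel L L' -> cancel L' L ->
  exists2 g, @Conf R (1 + m) g & forall xi : bdry, set_val (g xi) = lmap L (set_val xi).
Proof.
move=> Ls L's LK L'K.
have k0 : 0 < k by case: Ls.
have d0 : 0 < defect (0 : 'rV[R[i]]_(1 + m)) by rewrite defect0.
have pos M kk xi : similitude kk M -> 0 < defect xi -> 0 < defect (lmap M xi).
  move=> Ms hxi; have kk0 : 0 < kk by case: Ms.
  have j0 := jac_gt0 Ms (ltW hxi).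
  by rewrite (defect_lmap Ms) ?(ltW hxi) // !mulr_gt0 // exprn_gt0.
have sph (xi : bdry) : @HC_sphere R (1 + m) (lmap L (set_val xi)).
  by apply/HC_sphere_def; rewrite (defect_lmap Ls) ?defect_bge0 // defect_boundary mulr0.
exists (fun xi : bdry => exist _ (lmap L (set_val xi)) (mem_set (sph xi))) => //.
exists (lmap L).
  split; last first.
    move=> z w /HC_def hz /HC_def hw.
    apply/HC_dist_eq; rewrite ?(pos _ k) //; rewrite /hratio.
    rewrite (hm_lmap Ls) ?(ltW hz) ?(ltW hw) // !(defect_lmap Ls) ?(ltW hz) ?(ltW hw) //.
    have jz := jac_gt0 Ls (ltW hz); have jw := jac_gt0 Ls (ltW hw).
    by field; rewrite !gt_eqF.
  split=> [z /HC_def hz|z w /set_mem/HC_def hz /set_mem/HC_def hw e|z /HC_def hz].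
  - by apply/HC_def; exact: pos Ls hz.
  - by rewrite -(lmapK Ls L's LK (ltW hz)) e (lmapK Ls L's LK (ltW hw)).
  - exists (lmap L' z); last by rewrite (lmapK L's Ls L'K (ltW hz)).
    by apply/HC_def; exact: pos L's hz.
apply/boundary_extensionP => x e e0.
have jx := jac_gt0 Ls (defect_bge0 x); have j0 := jac_gt0 Ls (ltW d0).
(* hm_lmap with second point 0 bounds the factor jac L, since hm is at most 2 *)
pose b := 2 / (jac L 0 * k).
have b0 : 0 < b by rewrite divr_gt0 // mulr_gt0.
have jb z : 0 < defect z -> jac L z <= b.
  move=> hz; rewrite ler_pdivlMr ?mulr_gt0 //.
  have := hm_lmap Ls (ltW hz) (ltW d0); rewrite hm0r mulr1 mulrA => <-.
  by rewrite hm_le2 // ltW // (pos _ k).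
pose d := e ^+ 2 / (2 * (b * jac L (set_val x) * k)).
have D0 : 0 < 2 * (b * jac L (set_val x) * k) by exact: mulr_gt0 (ltr0Sn R 1) (mulr_gt0 (mulr_gt0 b0 jx) k0).
have dp : 0 < d by rewrite divr_gt0 ?exprn_gt0.
exists d => // z /HC_def hz.
rewrite (ltr_pdivlMr _ _ D0) => zx.
rewrite -(ltr_pXn2r (n:=2)) ?nnegrE ?nr_ge0 ?(ltW e0) // nrB.
apply: le_lt_trans zx.
set gx : bdry := exist _ _ _.
apply: (le_trans (nr_le_hm gx (ltW (pos _ _ _ Ls hz)))).
rewrite [X in _ <= X]mulrCA ler_pM2l // [set_val gx]/(lmap L (set_val x)).
rewrite (hm_lmap Ls (ltW hz) (defect_bge0 x)).
have -> : jac L z * jac L (set_val x) * (k * hm z (set_val x))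
  = hm z (set_val x) * (jac L z * jac L (set_val x) * k) by ring.
apply: ler_pM; rewrite ?hm_ge0 //.
- exact: ltW (mulr_gt0 (mulr_gt0 (jac_gt0 Ls (ltW hz)) jx) k0).
- by rewrite nrB hm_le_nr.
- by rewrite ler_pM2r // ler_pM2r // jb.
Qed.

End Lifts.

(** * The Heisenberg group *)

Section Heisenberg.
Variables (R : realType) (m : nat).
Local Notation V := 'rV[R[i]]_m.

Definition heis := (V * R)%type.
Implicit Types (a b x y z : heis) (s r : R).

Definition hmul a x : heis := (a.1 + x.1, a.2 + x.2 + 2 * om x.1 a.1).
Definition hinv a : heis := (- a.1, - a.2).
Definition h0 : heis := (0, 0).
Definition hdil s x : heis := (s%:C *: x.1, s ^+ 2 * x.2).
Definition gauge x : R := Num.max (nr x.1) (Num.sqrt `|x.2|).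
Definition hdist x y : R := gauge (hmul (hinv x) y).

Lemma hmulA a b x : hmul a (hmul b x) = hmul (hmul a b) x.
Proof.
rewrite /hmul /= addrA omDl omDr; congr pair; ring.
Qed.

Lemma hmul0r x : hmul x h0 = x.
Proof. by case: x => z t; rewrite /hmul /= om0l mulr0 !addr0. Qed.

Lemma hmul0l x : hmul h0 x = x.
Proof. by case: x => z t; rewrite /hmul /= om0r mulr0 addr0 !add0r. Qed.

Lemma hmulV x : hmul x (hinv x) = h0.
Proof. by rewrite /hmul /= omNl om_diag oppr0 mulr0 addr0 !subrr. Qed.

Lemma hmulVl x : hmul (hinv x) x = h0.
Proof. by rewrite /hmul /= omNr om_diag oppr0 mulr0 addr0 !addNr. Qed.

Lemma hmulK a : cancel (hmul a) (hmul (hinv a)).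
Proof. by move=> x; rewrite hmulA hmulVl hmul0l. Qed.

Lemma hmulVK a : cancel (hmul (hinv a)) (hmul a).
Proof. by move=> x; rewrite hmulA hmulV hmul0l. Qed.

Lemma hinvM a b : hinv (hmul a b) = hmul (hinv b) (hinv a).
Proof.
rewrite /hinv /hmul /= omNl omNr opprK (omC b.1) opprD; congr pair; last by ring.
by rewrite addrC.
Qed.

Lemma hinvK a : hinv (hinv a) = a.
Proof. by case: a => z t; rewrite /hinv /= !opprK. Qed.

Lemma hdil_comp s r x : hdil s (hdil r x) = hdil (s * r) x.
Proof.
rewrite /hdil /= scalerA exprMn mulrA; congr (_ *: _, _).
by apply: eqC; rewrite ?ReM ?ImM /=; ring.
Qed.

Lemma hdil1 x : hdil 1 x = x.
Proof. by case: x => z t; rewrite /hdil /= scale1r expr1n mul1r. Qed.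

Lemma hdil_h0 s : hdil s h0 = h0.
Proof. by rewrite /hdil /= scaler0 mulr0. Qed.

Lemma gauge_ge0 x : 0 <= gauge x.
Proof. by rewrite le_max nr_ge0. Qed.

Lemma gauge_le x r : 0 <= r -> (gauge x <= r) = (nr x.1 <= r) && (`|x.2| <= r ^+ 2).
Proof.
move=> r0; rewrite ge_max; congr (_ && _).
by rewrite -[X in (_ <= X) = _](ger0_norm r0) -(sqrtr_sqr r) ler_sqrt // sqr_ge0.
Qed.

Lemma nr_le_gauge x : nr x.1 <= gauge x.
Proof. by rewrite le_max lexx. Qed.

Lemma snd_le_gauge x : `|x.2| <= gauge x ^+ 2.
Proof. by have := gauge_le x (gauge_ge0 x); rewrite lexx => /esym/andP[]. Qed.

Lemma gauge0 : gauge h0 = 0.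
Proof. by rewrite /gauge /= nr0 normr0 sqrtr0 maxxx. Qed.

Lemma gauge_eq0 x : gauge x = 0 -> x = h0.
Proof.
move=> g0; have := gauge_le x (lexx 0); rewrite g0 lexx => /esym/andP[].
rewrite expr0n /= normr_le0 => n0 /eqP t0.
have /eqP : nr x.1 = 0 by apply/eqP; rewrite eq_le n0 nr_ge0.
by rewrite nr_eq0 => /eqP z0; case: x z0 t0 {g0 n0} => z t /= -> ->.
Qed.

Lemma gauge_gt0 x : x <> h0 -> 0 < gauge x.
Proof.
move=> xn; rewrite lt_neqAle gauge_ge0 andbT eq_sym.
by apply/eqP => /gauge_eq0.
Qed.

(** The twist contributes at most [2 * nr x.1 * nr y.1], the cross term in the
    square of [gauge x + gauge y]. *)
Lemma gauge_mul x y : gauge (hmul x y) <= gauge x + gauge y.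
Proof.
rewrite gauge_le ?addr_ge0 ?gauge_ge0 //; apply/andP; split=> /=.
  by rewrite (le_trans (nrD _ _)) // lerD // nr_le_gauge.
have h1 := snd_le_gauge x; have h2 := snd_le_gauge y; have h3 := om_normle y.1 x.1.
have h4 : nr y.1 * nr x.1 <= gauge y * gauge x.
  by apply: ler_pM; rewrite ?nr_ge0 // nr_le_gauge.
have := ler_normD (x.2 + y.2) (2 * om y.1 x.1); have := ler_normD x.2 y.2.
rewrite normrM ger0_norm // sqrrD; lra.
Qed.

Lemma gauge_inv x : gauge (hinv x) = gauge x.
Proof. by rewrite /gauge /= nrN normrN. Qed.

Lemma gauge_dil s x : 0 <= s -> gauge (hdil s x) = s * gauge x.
Proof.
move=> s0; rewrite /gauge /= nrZ normrM (ger0_norm s0) (ger0_norm (sqr_ge0 s)).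
by rewrite sqrtrM ?sqr_ge0 // sqrtr_sqr (ger0_norm s0) maxr_pMr.
Qed.

Lemma hdist_mul a x y : hdist (hmul a x) (hmul a y) = hdist x y.
Proof. by rewrite /hdist hinvM -hmulA hmulK. Qed.

Lemma hdist0 x : hdist h0 x = gauge x.
Proof. by rewrite /hdist /hinv /= !oppr0 hmul0l. Qed.

Lemma hdistC x y : hdist x y = hdist y x.
Proof. by rewrite /hdist -gauge_inv hinvM hinvK. Qed.

Lemma hdist_tri y x z : hdist x z <= hdist x y + hdist y z.
Proof.
rewrite /hdist; have := gauge_mul (hmul (hinv x) y) (hmul (hinv y) z).
by rewrite -hmulA hmulVK.
Qed.

Lemma hdist_ge0 x y : 0 <= hdist x y. Proof. exact: gauge_ge0. Qed.

Lemma hdistxx x : hdist x x = 0.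
Proof. by rewrite /hdist hmulVl gauge0. Qed.

Lemma hdist_eq0 x y : hdist x y = 0 -> x = y.
Proof. by move/gauge_eq0 => h; rewrite -(hmulVK x y) h hmul0r. Qed.

Lemma hdist_gt0 x y : x <> y -> 0 < hdist x y.
Proof.
move=> xy; rewrite lt_neqAle hdist_ge0 andbT eq_sym.
by apply/eqP => /hdist_eq0.
Qed.

Lemma gauge_hdist x y : `|gauge x - gauge y| <= hdist x y.
Proof.
have := hdist_tri x h0 y; have := hdist_tri y h0 x; rewrite !hdist0 (hdistC y).
rewrite ler_norml; lra.
Qed.

End Heisenberg.
Arguments h0 {R m}.

(** * Heisenberg coordinates on the boundary *)

Section Chart.
Variables (R : realType) (m : nat).
Local Notation heis := (heis R m).
Local Notation lvec := (lvec R m).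
Local Notation bdry := (HC_boundary R (1 + m)).
Implicit Types (a x y : heis) (s r : R) (p q : lvec).

(** The isotropic vector with last coordinate 1 over the point (z, t). *)
Definition hnull x : lvec := (x.1, (nr x.1 ^+ 2) +i* x.2, 1).
Definition linf : lvec := (0, 1, 0).

Lemma hnull_isotropic x : complex.Re (lform (hnull x) (hnull x)) = 0.
Proof. by rewrite Re_lform /= nr_sqr mulr1 mulr0 addr0 subrr. Qed.

Lemma linf_isotropic : complex.Re (lform linf linf) = 0.
Proof. by rewrite Re_lform /= rd0l !mulr0 addr0 subrr. Qed.

Lemma lsum_hnull x : lsum (hnull x) = (nr x.1 ^+ 2 + 1) +i* x.2.
Proof. by apply: eqC; rewrite /lsum ?ReD ?ImD /= ?addr0. Qed.

Lemma hnull_neq0 x : lsum (hnull x) != 0.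
Proof.
rewrite lsum_hnull; apply/eqP => /(congr1 (@complex.Re R)) /=.
by have := sqr_ge0 (nr x.1); lra.
Qed.

Lemma lsum_inf : lsum linf = 1.
Proof. by rewrite /lsum /= addr0. Qed.

Lemma linf_neq0 : lsum linf != 0.
Proof. by rewrite lsum_inf oner_eq0. Qed.

Lemma proj_sphere p : lsum p != 0 -> complex.Re (lform p p) = 0 ->
  @HC_sphere R (1 + m) (proj p).
Proof.
move=> s0 h; apply/HC_sphere_def.
have : complex.Re (herm (proj p) (proj p)) = 0.
  by rewrite herm_lift projK // lform_scale mulcJ ReM /= mul0r subr0 h mulr0.
by rewrite herm_self /= => /eqP; rewrite oppr_eq0 => /eqP.
Qed.

Definition pt x : bdry :=
  exist _ (proj (hnull x)) (mem_set (proj_sphere (hnull_neq0 x) (hnull_isotropic x))).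
Definition inf : bdry :=
  exist _ (proj linf) (mem_set (proj_sphere linf_neq0 linf_isotropic)).

Lemma ptE x : set_val (pt x) = proj (hnull x). Proof. by []. Qed.
Lemma infE : set_val inf = proj linf. Proof. by []. Qed.

Lemma hm_proj p q : lsum p != 0 -> lsum q != 0 ->
  hm (proj p) (proj q) = 4 / (cm (lsum p) * cm (lsum q)) * cm (lform p q).
Proof.
move=> hp hq; rewrite /hm herm_lift !projK // lform_scale !cmM cmJ !cmM !cmV.
have -> : cm (2 : R[i]) = 2.
  by have -> : (2 : R[i]) = 2%:C; [rewrite rmorph_nat|rewrite cm_real ger0_norm].
by rewrite invfM; ring.
Qed.

(** The form on null lifts recovers the Heisenberg distance: its real part sees
    the horizontal coordinate of [x^-1 y], its imaginary part the vertical one. *)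
Lemma lform_hnull x y : complex.Re (lform (hnull x) (hnull y)) = - nr (x.1 - y.1) ^+ 2 / 2 /\
  complex.Im (lform (hnull x) (hnull y)) = (hmul (hinv x) y).2 / 2.
Proof.
rewrite /hnull lformE.
have -> : (2^-1 : R[i]) = (2^-1)%:C by rewrite fmorphV rmorph_nat.
rewrite !(ReD, ReN, ReM, ImM, ImD, ImN, ReJ, ImJ) /=.
rewrite -/(rd _ _) -/(om _ _) !(nr_sqr, rdDl, rdDr, rdNl, rdNr, omNr) (rdC x.1) (omC x.1).
by split; field.
Qed.

Lemma cm_lform_hnull x y : hdist x y ^+ 2 <= 2 * cm (lform (hnull x) (hnull y)).
Proof.
have [h1 h2] := lform_hnull x y.
have g0 := gauge_ge0 (hmul (hinv x) y).
have := Re_le_cm (- lform (hnull x) (hnull y)); rewrite cmN ReN h1.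
have := Im_le_cm (- lform (hnull x) (hnull y)); rewrite cmN ImN h2.
have := Im_le_cm (lform (hnull x) (hnull y)); rewrite h2.
set c := cm _ => c1 c2 c3.
have s0 := sqrtr_ge0 (2 * c); have : Num.sqrt (2 * c) ^+ 2 = 2 * c.
  by rewrite sqr_sqrtr // mulr_ge0 // cm_ge0.
move: (Num.sqrt (2 * c)) s0 => t t0 tE; rewrite -tE.
rewrite ler_pXn2r ?nnegrE ?hdist_ge0 // /hdist gauge_le // tE.
apply/andP; split; last by rewrite ler_norml; lra.
rewrite -(ler_pXn2r (n:=2)) ?nnegrE ?nr_ge0 // tE /= (addrC (- x.1)) (nrB y.1); lra.
Qed.

Lemma cm_lsum_hnull x : 1 <= cm (lsum (hnull x)) /\
  gauge x ^+ 2 <= cm (lsum (hnull x)) <= 1 + 2 * gauge x ^+ 2.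
Proof.
rewrite lsum_hnull; have n0 := sqr_ge0 (nr x.1); have s0 := snd_le_gauge x.
have n1 : nr x.1 ^+ 2 <= gauge x ^+ 2.
  by rewrite ler_pXn2r ?nnegrE ?nr_ge0 ?gauge_ge0 // nr_le_gauge.
set c := _ +i* _.
have a3 : nr x.1 ^+ 2 + 1 <= cm c := Re_le_cm c.
have a2 : x.2 <= cm c := Im_le_cm c.
have a1 : - x.2 <= cm c by have := Im_le_cm (- c); rewrite cmN ImN.
have a4 : cm c <= `|nr x.1 ^+ 2 + 1| + `|x.2| := cm_le_ReIm c.
have c0 := cm_ge0 c.
split; first by lra.
apply/andP; split; last by move: a4; rewrite ger0_norm; lra.
have s1 := sqrtr_ge0 (cm c); have : Num.sqrt (cm c) ^+ 2 = cm c by rewrite sqr_sqrtr.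
move: (Num.sqrt (cm c)) s1 => t t0 tE; rewrite -tE.
rewrite ler_pXn2r ?nnegrE ?gauge_ge0 // gauge_le // tE.
apply/andP; split; last by rewrite ler_norml; lra.
rewrite -(ler_pXn2r (n:=2)) ?nnegrE ?nr_ge0 // tE; lra.
Qed.

Lemma pt_inj : injective pt.
Proof.
move=> x y xy; apply: hdist_eq0; apply/eqP; rewrite -sqrf_eq0 eq_le sqr_ge0 andbT.
apply: (le_trans (cm_lform_hnull x y)); rewrite pmulr_rle0 //.
have := hm_proj (hnull_neq0 x) (hnull_neq0 y); rewrite -!ptE xy bhmxx => /esym/eqP.
rewrite mulf_eq0 => /orP[|/eqP -> //].
by rewrite gt_eqF // divr_gt0 // mulr_gt0 // cm_gt0 hnull_neq0.
Qed.

Lemma lform_inf x : lform (hnull x) linf = - 2^-1.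
Proof.
by rewrite lformE hdot0r rmorph0 rmorph1 mulr0 !add0r !mulr1.
Qed.

Lemma cm_half : cm (2^-1 : R[i]) = 2^-1.
Proof.
have -> : (2^-1 : R[i]) = (2^-1)%:C by rewrite fmorphV rmorph_nat.
by rewrite cm_real ger0_norm.
Qed.

Lemma hm_inf x : hm (set_val (pt x)) (set_val inf) = 2 / cm (lsum (hnull x)).
Proof.
rewrite hm_proj ?hnull_neq0 ?linf_neq0 // lform_inf cmN cm_half lsum_inf cm1 mulr1.
by field; rewrite gt_eqF // cm_gt0 hnull_neq0.
Qed.

Lemma lsum_hnull0 : lsum (hnull h0) = 1.
Proof. by rewrite lsum_hnull nr0 expr0n add0r. Qed.

Lemma hm_pt0 x : gauge x ^+ 2 <= hm (set_val (pt x)) (set_val (pt h0)) * cm (lsum (hnull x)) / 2.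
Proof.
have := cm_lform_hnull x h0; rewrite hdistC hdist0.
rewrite hm_proj ?hnull_neq0 // lsum_hnull0 cm1.
have c0 : 0 < cm (lsum (hnull x)) by rewrite cm_gt0 hnull_neq0.
rewrite mulr1; set c := cm (lform _ _).
have -> : 4 / cm (lsum (hnull x)) * c * cm (lsum (hnull x)) / 2 = 2 * c.
  by field; rewrite gt_eqF.
by [].
Qed.

Lemma pt_neq_inf x : pt x <> inf.
Proof.
move=> e; have := hm_inf x; rewrite e bhmxx => /esym/eqP.
by rewrite gt_eqF // divr_gt0 // cm_gt0 hnull_neq0.
Qed.

(** This lemma and the next three translate neighbourhoods of infinity, of the
    origin and of a finite point into bounds on the gauge. *)
Lemma bounded_far_inf r : exists2 d, 0 < d & forall x, gauge x <= r -> d <= bdist (pt x) inf.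
Proof.
exists (2 / (1 + 2 * r ^+ 2)).
  by rewrite divr_gt0 // ltr_pwDl // mulr_ge0 // sqr_ge0.
move=> x xr; apply: (le_trans _ (hm_le_bdist _ _)); rewrite hm_inf.
have [c1 /andP[_ c2]] := cm_lsum_hnull x.
have : gauge x ^+ 2 <= r ^+ 2.
  by rewrite ler_pXn2r ?nnegrE ?gauge_ge0 // (le_trans (gauge_ge0 x)).
move=> h; rewrite ler_pM2l // lef_pV2 ?posrE; lra.
Qed.

Lemma far_inf_bounded x (d : R) : 0 < d -> d <= bdist (pt x) inf -> gauge x <= 2 / d.
Proof.
move=> d0 h; have [c1 /andP[c2 _]] := cm_lsum_hnull x.
rewrite ler_pdivlMr // -(ler_pXn2r (n:=2)) ?nnegrE ?mulr_ge0 ?gauge_ge0 ?(ltW d0) //.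
have := bdist_le_hm (pt x) inf; rewrite hm_inf => h1.
have h2 : d ^+ 2 <= bdist (pt x) inf ^+ 2.
  by rewrite ler_pXn2r ?nnegrE ?bdist_ge0 // ltW.
have c0 : 0 < cm (lsum (hnull x)) by lra.
have h3 : d ^+ 2 * cm (lsum (hnull x)) <= 4.
  have : d ^+ 2 <= 4 / cm (lsum (hnull x)) by lra.
  by rewrite ler_pdivlMr.
rewrite exprMn; have := ler_wpM2r (sqr_ge0 d) c2; lra.
Qed.

Lemma large_far_0 r : 0 < r ->
  exists2 d, 0 < d & forall x, r <= gauge x -> d <= bdist (pt x) (pt h0).
Proof.
move=> r0; have r20 : 0 < r ^+ 2 by rewrite exprn_gt0.
exists (2 * r ^+ 2 / (1 + 2 * r ^+ 2)); first by rewrite divr_gt0 //; lra.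
move=> x xr; apply: (le_trans _ (hm_le_bdist _ _)).
have [c1 /andP[_ c2]] := cm_lsum_hnull x; have := hm_pt0 x.
set h := hm _ _ => h1; have hge : 0 <= h by exact: hm_ge0.
have h2 : r ^+ 2 <= gauge x ^+ 2 by rewrite ler_pXn2r ?nnegrE ?gauge_ge0 // ltW.
have h3 : 2 * gauge x ^+ 2 <= h * (1 + 2 * gauge x ^+ 2).
  by have := ler_wpM2l hge c2; lra.
rewrite ler_pdivrMr; last by lra.
have [h4|h4] := leP 1 h; first by have := ler_wpM2r (ltW r20) h4; lra.
have h5 : 0 <= 1 - h by lra.
by have := ler_wpM2l h5 h2; lra.
Qed.

Lemma near_pt_gauge x r : r < gauge x ->
  exists2 d, 0 < d & forall y, bdist (pt x) (pt y) < d -> r < gauge y.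
Proof.
move=> rx; have [cx1 _] := cm_lsum_hnull x; set cx := cm _ in cx1.
have d0 : 0 < 2 * (gauge x - r) ^+ 2 / (cx * (1 + 2 * r ^+ 2)).
  rewrite divr_gt0 ?mulr_gt0 ?exprn_gt0 ?subr_gt0 //; first by lra.
  by rewrite ltr_pwDl // mulr_ge0 // sqr_ge0.
exists (2 * (gauge x - r) ^+ 2 / (cx * (1 + 2 * r ^+ 2))) => // y.
apply: contraTT; rewrite -!leNgt => yr.
apply: (le_trans _ (hm_le_bdist _ _)); rewrite hm_proj ?hnull_neq0 // -/cx.
have [cy1 /andP[_ cy2]] := cm_lsum_hnull y; set cy := cm (lsum (hnull y)) in cy1 cy2 *.
have h1 := cm_lform_hnull x y; set c := cm (lform _ _) in h1 *.
have h2 : gauge x - r <= hdist x y.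
  by have := gauge_hdist x y; rewrite ler_norml; lra.
have h3 : (gauge x - r) ^+ 2 <= hdist x y ^+ 2.
  by rewrite ler_pXn2r ?nnegrE ?hdist_ge0 //; lra.
have h4 : gauge y ^+ 2 <= r ^+ 2.
  by rewrite ler_pXn2r ?nnegrE ?gauge_ge0 // (le_trans (gauge_ge0 y)).
have -> : 4 / (cx * cy) * c = 4 * c / (cx * cy) by rewrite mulrAC.
have r0 := sqr_ge0 r.
have D1 : 0 < cx * (1 + 2 * r ^+ 2) by rewrite mulr_gt0 //; lra.
have D2 : 0 < cx * cy by rewrite mulr_gt0 //; lra.
have D3 : cx * cy <= cx * (1 + 2 * r ^+ 2) by rewrite ler_wpM2l //; lra.
have N0 := sqr_ge0 (gauge x - r).
apply: ler_pM; [lra|by rewrite invr_ge0 ltW|lra|].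
by rewrite lef_pV2 ?posrE.
Qed.

(** An isotropic vector with w = 0 is a multiple of [linf]; otherwise rescale it
    to w = 1. *)
Lemma boundary_chart (xi : bdry) : xi = inf \/ exists x, xi = pt x.
Proof.
have Q0 : complex.Re (lform (lift (set_val xi)) (lift (set_val xi))) = 0.
  by rewrite -herm_lift herm_self /= defect_boundary oppr0.
set p := lift (set_val xi) in Q0.
have pE : set_val xi = proj p by rewrite liftK.
have s2 : lsum p = 2 by rewrite /lsum /=; ring.
clearbody p.
have [w0|w0] := eqVneq p.2 0.
  left; apply: val_inj; rewrite [RHS]infE [LHS]pE.
  move: Q0; rewrite Re_lform w0 /= !mulr0 addr0 subr0 => z0.
  have {}z0 : p.1.1 = 0 by apply/eqP; rewrite -nr_eq0 -sqrf_eq0 nr_sqr z0.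
  have u2 : p.1.2 = 2 by move: s2; rewrite /lsum w0 addr0.
  have -> : p = lscale 2 linf.
    by rewrite /lscale /= scaler0 mulr1 mulr0 -z0 -u2 -w0; case: (p) => -[].
  by rewrite proj_scale // two_neq0.
right; pose z := (p.2)^-1 *: p.1.1; pose u := p.1.2 / p.2.
have pz : p = lscale p.2 (z, u, 1).
  rewrite /lscale /z /u /= scalerA divff // scale1r mulr1 (mulrC p.2) divfK //.
  by case: (p) => -[].
have uz : complex.Re u = nr z ^+ 2.
  move: Q0; rewrite pz lform_scale mulcJ ReM /= mul0r subr0 => /eqP.
  rewrite mulf_eq0 sqrf_eq0 cm_eq0 (negbTE w0) /= Re_lform /= mulr1 mulr0 addr0.
  by rewrite subr_eq0 nr_sqr => /eqP ->.
exists (z, complex.Im u); apply: val_inj; rewrite [RHS]ptE [LHS]pE pz proj_scale //.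
by rewrite /hnull /= -uz; congr (proj (_, _, _)); apply: eqC.
Qed.

End Chart.

(** * Explicit conformal maps *)

Section ExplicitConf.
Variables (R : realType) (m : nat).
Local Notation V := 'rV[R[i]]_m.
Local Notation heis := (heis R m).
Local Notation lvec := (lvec R m).
Local Notation Conf := (@Conf R (1 + m)).
Implicit Types (a x y : heis) (s r : R) (p q : lvec) (phi : V -> V).

Lemma lmap_proj k L p : similitude k L -> lsum p != 0 -> lmap L (proj p) = proj (L p).
Proof.
case=> _ Lh _ _ s0; rewrite /lmap projK //.
have c0 : 2 / lsum p != 0 by rewrite mulf_neq0 ?two_neq0 ?invr_eq0.
by have [d d0 ->] := Lh _ p c0; rewrite proj_scale.
Qed.

(** An equality of vectors up to a scalar computes the action on the boundary. *)
Lemma lmap_boundary k L (g : HC_boundary R (1 + m) -> HC_boundary R (1 + m)) :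
  similitude k L -> (forall xi, set_val (g xi) = lmap L (set_val xi)) ->
  forall xi eta p q c, set_val xi = proj p -> set_val eta = proj q ->
  lsum p != 0 -> c != 0 -> L p = lscale c q -> g xi = eta.
Proof.
move=> Ls gE xi eta p q c xiE etaE s0 c0 LE; apply: val_inj.
transitivity (lmap L (set_val xi)); first exact: gE.
by rewrite xiE (lmap_proj Ls) // LE proj_scale.
Qed.

Lemma lscale1 p : lscale 1 p = p.
Proof. by case: p => -[z u] w; rewrite /lscale /= scale1r !mul1r. Qed.

Lemma conjM (b c : R[i]) : ((b * c)^*)%R = (b^*)%R * (c^*)%R.
Proof. exact: rmorphM. Qed.
Lemma conjD (b c : R[i]) : ((b + c)^*)%R = (b^*)%R + (c^*)%R.
Proof. exact: rmorphD. Qed.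
Lemma conjB (b c : R[i]) : ((b - c)^*)%R = (b^*)%R - (c^*)%R.
Proof. exact: rmorphB. Qed.
Lemma conj2 : ((2 : R[i])^*)%R = 2.
Proof. exact: rmorph_nat. Qed.

Lemma conjV (b : R[i]) : ((b^-1)^*)%R = ((b^*)%R)^-1.
Proof. exact: fmorphV. Qed.
Lemma conj_half : ((2^-1 : R[i])^*)%R = 2^-1.
Proof. by rewrite fmorphV rmorph_nat. Qed.

(** The unipotent map that sends [hnull x] to [hnull (hmul a x)]. *)
Definition ltrans a p : lvec := (p.1.1 + p.2 *: a.1,
  p.1.2 + 2 * hdot p.1.1 a.1 + ((nr a.1 ^+ 2) +i* a.2) * p.2, p.2).

Lemma ltrans_form a p q : lform (ltrans a p) (ltrans a q) = lform p q.
Proof.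
case: p q => [[z u] w] [[z' u'] w']; rewrite /ltrans /= !lformE.
rewrite !(hdotDl, hdotDr, hdotZl, hdotZr) hdot_self -nr_sqr.
set c := _ +i* _.
have cc : (c^*)%R = 2 * (nr a.1 ^+ 2)%:C - c.
  by apply: eqC; rewrite !(ReD, ImD, ReN, ImN, ReM, ImM) /= ?mul0r; ring.
have -> : hdot a.1 z' = ((hdot z' a.1)^*)%R by rewrite (hdotC z').
rewrite !(conjD, conjM, conj2) cc.
by have t0 := two_neq0 R; field.
Qed.

Lemma ltrans_similitude a : similitude 1 (ltrans a).
Proof.
split=> // [c p c0|p q|p]; rewrite ?ltrans_form ?mul1r //.
exists c => //; case: p => -[z u] w; rewrite /ltrans /lscale /=.
by rewrite scalerDr scalerA hdotZl; congr (_, _, _); ring.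
Qed.

Lemma ltransK a : cancel (ltrans a) (ltrans (hinv a)).
Proof.
case=> -[z u] w; rewrite /ltrans /= scalerN addrK nrN; congr (_, _, _).
rewrite hdotNr hdotDl hdotZl hdot_self -nr_sqr.
set c := _ +i* a.2; set d := _ +i* - a.2.
have -> : d = 2 * (nr a.1 ^+ 2)%:C - c.
  by apply: eqC; rewrite !(ReD, ImD, ReN, ImN, ReM, ImM) /= ?mul0r; ring.
ring.
Qed.

Lemma Conf_trans a : exists g, [/\ Conf g, g (inf R m) = inf R m &
  forall x, g (pt x) = pt (hmul a x)].
Proof.
have s2 := ltransK (hinv a); rewrite hinvK in s2.
have [g gC gE] := lmap_Conf (ltrans_similitude a) (ltrans_similitude (hinv a)) (ltransK a) s2.
have M := lmap_boundary (ltrans_similitude a) gE; have n1 := oner_neq0 R[i].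
exists g; split=> [//||x].
  apply: (M _ _ _ _ _ (infE R m) (infE R m) (linf_neq0 R m) n1).
  by rewrite lscale1 /ltrans /= scale0r hdot0l !mulr0 !addr0.
apply: (M _ _ _ _ _ (ptE x) (ptE _) (hnull_neq0 x) n1).
rewrite lscale1 /ltrans /hnull /= scale1r mulr1 addrC; congr (_, _, _).
apply: eqC; rewrite !(ReD, ImD, ReM, ImM) /= -/(rd _ _) -/(om _ _).
  by rewrite !nr_sqr rdDl !rdDr (rdC x.1); ring.
by ring.
Qed.

Definition ldil s p : lvec := (s%:C *: p.1.1, (s ^+ 2)%:C * p.1.2, p.2).

Lemma ldil_form s p q : lform (ldil s p) (ldil s q) = (s ^+ 2)%:C * lform p q.
Proof.
case: p q => [[z u] w] [[z' u'] w']; rewrite /ldil /= !lformE hdotZl hdotZr conjM.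
have cR (t : R) : (t%:C^*)%R = t%:C by apply: eqC; rewrite ?ReJ ?ImJ //= oppr0.
have sE : (s ^+ 2)%:C = s%:C * s%:C by rewrite -rmorphM.
by rewrite !cR sE; ring.
Qed.

Lemma ldil_similitude s : 0 < s -> similitude (s ^+ 2) (ldil s).
Proof.
move=> s0; split=> [|c p c0|p q|p]; rewrite ?ldil_form.
- by rewrite exprn_gt0.
- exists c => //; case: p => -[z u] w; rewrite /ldil /lscale /= !scalerA (mulrC c s%:C).
  by rewrite mulrCA.
- by rewrite cmM cm_real ger0_norm ?sqr_ge0.
- by rewrite ReM /= mul0r subr0.
Qed.

Lemma ldilK s : s != 0 -> cancel (ldil s) (ldil s^-1).
Proof.
move=> s0 [[z u] w]; rewrite /ldil /= scalerA mulrA -!rmorphM mulVf // -exprMn mulVf //.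
by rewrite expr1n scale1r mul1r.
Qed.

Lemma Conf_dil s : 0 < s -> exists g, [/\ Conf g, g (inf R m) = inf R m &
  forall x, g (pt x) = pt (hdil s x)].
Proof.
move=> s0; have s'0 : 0 < s^-1 by rewrite invr_gt0.
have s2 := ldilK (lt0r_neq0 s'0); rewrite invrK in s2.
have [g gC gE] := lmap_Conf (ldil_similitude s0) (ldil_similitude s'0) (ldilK (lt0r_neq0 s0)) s2.
have M := lmap_boundary (ldil_similitude s0) gE; have n1 := oner_neq0 R[i].
exists g; split=> [//||x].
  have s20 : (s ^+ 2)%:C != 0.
    by apply/eqP => /(congr1 (@complex.Re R)) /= /eqP; rewrite expf_eq0 /= gt_eqF.
  apply: (M _ _ _ _ _ (infE R m) (infE R m) (linf_neq0 R m) s20).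
  by rewrite /ldil /lscale /= !scaler0 mulr0.
apply: (M _ _ _ _ _ (ptE x) (ptE _) (hnull_neq0 x) n1).
have nE : nr (s%:C *: x.1) ^+ 2 = s ^+ 2 * nr x.1 ^+ 2.
  by rewrite nrZ exprMn real_normK ?num_real.
rewrite lscale1 /ldil /hnull [(hdil _ _).1]/= nE; congr (_, _, _).
move: (nr x.1 ^+ 2) => N.
by apply: eqC; rewrite !(ReM, ImM) /=; ring.
Qed.

Definition luni phi p : lvec := (phi p.1.1, p.1.2, p.2).

Lemma Conf_unitary phi phi' : (forall z w, hdot (phi z) (phi w) = hdot z w) ->
  (forall (c : R[i]) z, phi (c *: z) = c *: phi z) -> cancel phi phi' -> cancel phi' phi ->
  exists g, [/\ Conf g, g (inf R m) = inf R m &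
    forall x, g (pt x) = pt (phi x.1, x.2)].
Proof.
have sim f : (forall z w, hdot (f z) (f w) = hdot z w) ->
    (forall (c : R[i]) z, f (c *: z) = c *: f z) -> similitude 1 (luni f).
  move=> fh fZ; have F p q : lform (luni f p) (luni f q) = lform p q.
    by case: p q => [[z u] w] [[z' u'] w']; rewrite /luni /= !lformE fh.
  split=> // [c p c0|p q|p]; rewrite ?F ?mul1r //.
  by exists c => //; case: p => -[z u] w; rewrite /luni /lscale /= fZ.
move=> ph phZ phK ph'K.
have ph'h z w : hdot (phi' z) (phi' w) = hdot z w by rewrite -ph !ph'K.
have ph'Z (c : R[i]) z : phi' (c *: z) = c *: phi' z.
  by rewrite -[in LHS](ph'K z) -phZ phK.
have s1 := sim _ ph phZ; have s2 := sim _ ph'h ph'Z.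
have LK : cancel (luni phi) (luni phi') by move=> [[z u] w]; rewrite /luni /= phK.
have L'K : cancel (luni phi') (luni phi) by move=> [[z u] w]; rewrite /luni /= ph'K.
have [g gC gE] := lmap_Conf s1 s2 LK L'K.
have M := lmap_boundary s1 gE; have n1 := oner_neq0 R[i].
exists g; split=> [//||x].
  apply: (M _ _ _ _ _ (infE R m) (infE R m) (linf_neq0 R m) n1).
  by rewrite lscale1 /luni /= -(scale0r 0) phZ !scale0r.
apply: (M _ _ _ _ _ (ptE x) (ptE _) (hnull_neq0 x) n1).
by rewrite lscale1 /luni /hnull /= !nr_sqr /rd ph.
Qed.

Definition lanti phi p : lvec := (phi p.1.1, ((p.1.2)^*)%R, ((p.2)^*)%R).

Lemma Conf_antiunitary phi phi' :
  (forall z w, hdot (phi z) (phi w) = ((hdot z w)^*)%R) ->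
  (forall (c : R[i]) z, phi (c *: z) = (c^*)%R *: phi z) ->
  cancel phi phi' -> cancel phi' phi ->
  exists g, [/\ Conf g, g (inf R m) = inf R m &
    forall x, g (pt x) = pt (phi x.1, - x.2)].
Proof.
have sim f : (forall z w, hdot (f z) (f w) = ((hdot z w)^*)%R) ->
    (forall (c : R[i]) z, f (c *: z) = (c^*)%R *: f z) -> similitude 1 (lanti f).
  move=> fh fZ; have F p q : lform (lanti f p) (lanti f q) = ((lform p q)^*)%R.
    case: p q => [[z u] w] [[z' u'] w']; rewrite /lanti /= !lformE fh.
    by rewrite conjB !(conjM, conjD) conj_half.
  split=> // [c p c0|p q|p]; rewrite ?F ?mul1r ?cmJ ?ReJ //.
  exists ((c^*)%R); first by rewrite fmorph_eq0.
  by case: p => -[z u] w; rewrite /lanti /lscale /= fZ !conjM.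
move=> ph phZ phK ph'K.
have ph'h z w : hdot (phi' z) (phi' w) = ((hdot z w)^*)%R.
  by rewrite -[in RHS](ph'K z) -[in RHS](ph'K w) ph conjCK.
have ph'Z (c : R[i]) z : phi' (c *: z) = (c^*)%R *: phi' z.
  by rewrite -[in LHS](ph'K z) -[in LHS](conjCK c) -phZ phK.
have s1 := sim _ ph phZ; have s2 := sim _ ph'h ph'Z.
have LK : cancel (lanti phi) (lanti phi').
  by move=> [[z u] w]; rewrite /lanti /= phK !conjCK.
have L'K : cancel (lanti phi') (lanti phi).
  by move=> [[z u] w]; rewrite /lanti /= ph'K !conjCK.
have [g gC gE] := lmap_Conf s1 s2 LK L'K.
have M := lmap_boundary s1 gE; have n1 := oner_neq0 R[i].
exists g; split=> [//||x].
  apply: (M _ _ _ _ _ (infE R m) (infE R m) (linf_neq0 R m) n1).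
  rewrite lscale1 /lanti /= rmorph1 rmorph0.
  by rewrite -(scale0r 0) phZ rmorph0 !scale0r.
apply: (M _ _ _ _ _ (ptE x) (ptE _) (hnull_neq0 x) n1).
rewrite lscale1 /lanti /hnull /= rmorph1.
congr (_, _, _); apply: eqC; rewrite ?ReJ ?ImJ //=.
by rewrite !nr_sqr /rd ph ReJ.
Qed.

Definition lswap p : lvec := (p.1.1, p.2, p.1.2).

Lemma Conf_swap : exists g, [/\ Conf g, g (inf R m) = pt h0 & g (pt h0) = inf R m].
Proof.
have F p q : lform (lswap p) (lswap q) = lform p q.
  by case: p q => [[z u] w] [[z' u'] w']; rewrite /lswap /= !lformE (addrC (w * _)).
have sim : similitude 1 lswap.
  split=> // [c p c0|p q|p]; rewrite ?F ?mul1r //.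
  by exists c.
have LK : cancel lswap lswap by case=> -[].
have [g gC gE] := lmap_Conf sim sim LK LK.
have e0 : hnull (h0 : heis) = lswap (linf R m).
  by rewrite /hnull /lswap /= nr0 expr0n.
have M := lmap_boundary sim gE; have n1 := oner_neq0 R[i].
exists g; split=> //.
  apply: (M _ _ _ _ _ (infE R m) (ptE h0) (linf_neq0 R m) n1).
  by rewrite lscale1 e0.
apply: (M _ _ _ _ _ (ptE h0) (infE R m) (hnull_neq0 h0) n1).
by rewrite lscale1 e0.
Qed.

End ExplicitConf.

(** * Uniform quasi-similarity in a convergence group *)

Section ConvergenceDynamics.
Variables (R : realType) (m : nat).
Local Notation heis := (heis R m).
Local Notation bdry := (HC_boundary R (1 + m)).
Local Notation inf := (inf R m).
Variable G : set (bdry -> bdry).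
Hypotheses (convG : convergence_group G) (ConfG : @Conf R (1 + m) `<=` G).
Implicit Types (a x y z : heis) (s r : R) (k : heis -> heis).

(** The action of an element of G fixing infinity, read in Heisenberg
    coordinates. *)
Definition lifts (g : bdry -> bdry) k := [/\ G g, g inf = inf & forall x, g (pt x) = pt (k x)].
Definition acts k := exists g, lifts g k.

Lemma G_homeo g : G g -> homeomorphism g.
Proof. by case: convG => -[h _ _ _] _; exact: h. Qed.

Lemma homeo_inj (g : bdry -> bdry) : homeomorphism g -> injective g.
Proof. by case=> _ [g' [gK _ _]]; exact: can_inj gK. Qed.

Lemma acts_id : acts id.
Proof. by exists id; split=> //; case: convG => -[]. Qed.

Lemma acts_comp k k' : acts k -> acts k' -> acts (k \o k').
Proof.
case=> g [gG gi gk] [g' [g'G g'i g'k]]; exists (g \o g'); split=> /=.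
- by case: convG => -[_ _ c _] _; exact: c.
- by rewrite g'i gi.
- by move=> x; rewrite g'k gk.
Qed.

Lemma acts_of_stab g : G g -> g inf = inf -> exists k, lifts g k.
Proof.
move=> gG gi; have ginj := homeo_inj (G_homeo gG).
have ex x : exists y, g (pt x) = pt y.
  have [e|//] := boundary_chart (g (pt x)).
  by case: (@pt_neq_inf R m x); apply: ginj; rewrite gi.
by have [k hk] := choice ex; exists k.
Qed.

Lemma acts_inv k : acts k -> exists k', [/\ acts k', cancel k k' & cancel k' k].
Proof.
case=> g [gG gi gk]; have [_ [g' [gK g'K _]]] := G_homeo gG.
have g'G : G g' by case: convG => -[_ _ _ c] _; exact: c gG gK g'K.
have g'i : g' inf = inf by rewrite -{1}gi gK.
have [k' [_ _ k'E]] := acts_of_stab g'G g'i.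
exists k'; split; first by exists g'.
  by move=> x; apply: (@pt_inj R m); rewrite -k'E -gk gK.
by move=> x; apply: (@pt_inj R m); rewrite -gk -k'E g'K.
Qed.

Lemma acts_inj k : acts k -> injective k.
Proof. by move=> /acts_inv[k' [_ kK _]]; exact: can_inj kK. Qed.

Lemma acts_trans a : acts (hmul a).
Proof. by have [g [gC gi gx]] := Conf_trans a; exists g; split=> //; exact: ConfG. Qed.

Lemma acts_dil s : 0 < s -> acts (hdil s).
Proof.
by move=> s0; have [g [gC gi gx]] := Conf_dil m s0; exists g; split=> //; exact: ConfG.
Qed.

Lemma acts_iter k j : acts k -> acts (iter j k).
Proof. by move=> ka; elim: j => [|j IH]; [exact: acts_id|exact: acts_comp ka IH]. Qed.

Lemma pt0_neq_inf : 0 < bdist (pt (h0 : heis)) inf.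
Proof.
rewrite lt_neqAle bdist_ge0 andbT; apply/eqP => /esym/bdist0_eq.
exact: pt_neq_inf.
Qed.

(** If every map fixes the origin and infinity, the attractor and the repeller
    can only be these two points: a fixed point other than the repeller is the
    attractor. *)
Lemma fixed_pair_alternative (k : nat -> heis -> heis) :
  (forall j, acts (k j)) -> (forall j, k j h0 = h0) ->
  exists2 phi : nat -> nat, {homo phi : i j / (i < j)%N} &
  [\/ exists2 u : nat -> bdry -> bdry, forall j, lifts (u j) (k j) &
        exists2 h, homeomorphism h & forall e, 0 < e -> exists N, forall j, (N <= j)%N ->
          forall xi, bdist (h xi) (u (phi j) xi) < e,
      forall r M, 0 < r -> exists N, forall j, (N <= j)%N -> forall x,
        r <= gauge x -> M < gauge (k (phi j) x) |
      forall M e, 0 < e -> exists N, forall j, (N <= j)%N -> forall x,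
        gauge x <= M -> gauge (k (phi j) x) < e].
Proof.
move=> ka k0; have [u hu] := choice ka.
have uG j : G (u j) by case: (hu j).
have [phi phi_mono alt] := (proj2 convG) u uG; exists phi => //.
case: alt => [[h hh uh]|[a [r ar]]].
  constructor 1; exists u => //; exists h => // e e0.
  move/boundary_uniformP: uh => /(_ e e0)[N hN].
  by exists N => j Nj xi; exact: hN.
(* values away from the repeller converge to the attractor *)
have away eta : eta <> r -> forall e : R, 0 < e -> exists N,
    forall j, (N <= j)%N -> forall xi, (bdist r eta <= bdist r xi) ->
      bdist a (u (phi j) xi) < e.
  move=> er e e0; have re : 0 < bdist r eta.
    rewrite lt_neqAle bdist_ge0 andbT; apply/eqP => /esym/bdist0_eq re.
    by apply: er; rewrite re.
  have := ar _ (boundary_open_ball r (bdist r eta)); rewrite /= bdistxx => /(_ re).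
  move=> /boundary_uniformP/(_ e e0)[N hN]; exists N => j Nj xi h.
  by apply: hN => //=; apply/negP; rewrite -leNgt.
have fixa eta : eta <> r -> (forall j, u j eta = eta) -> a = eta.
  move=> er ue.
  apply: bdist0_eq; apply: (@eq_small _ _ _ 1) => e e0.
  have [N hN] := away _ er e e0; have := hN N (leqnn N) eta (lexx _).
  by rewrite ue subr0 ger0_norm ?bdist_ge0 // mul1r => /ltW.
have uinf j : u j inf = inf by case: (hu j).
have u0 j : u j (pt h0) = pt h0 by case: (hu j) => _ _ ->; rewrite k0.
have n0 := pt0_neq_inf.
have uE j x : u j (pt x) = pt (k j x) by case: (hu j).
have [ri|ri] := pselect (r = inf); last first.
  have ai : a = inf by apply: fixa => // e; apply: ri.
  have r0 : r = pt h0.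
    apply: contrapT => r0; have a0 : a = pt h0 by apply: fixa => // e; apply: r0.
    have n1 : 0 < bdist a inf by rewrite a0.
    by rewrite ai bdistxx ltxx in n1.
  constructor 2 => t M t0.
  have [d d0 hd] := large_far_0 m t0.
  have [d' d'0 hd'] := bounded_far_inf m M.
  have := ar _ (boundary_open_ball r d); rewrite /= bdistxx => /(_ d0).
  move=> /boundary_uniformP/(_ d' d'0)[N hN]; exists N => j Nj x tx.
  rewrite ltNge; apply/negP => /hd'.
  apply/negP; rewrite -ltNge -uE bdistC -ai; apply: hN => //=.
  by apply/negP; rewrite -leNgt r0 bdistC hd.
have a0 : a = pt h0.
  apply: fixa => // e.
  have n1 : 0 < bdist r inf by rewrite -e.
  by rewrite ri bdistxx ltxx in n1.
constructor 3 => M e e0.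
have [d d0 hd] := large_far_0 m e0.
have [d' d'0 hd'] := bounded_far_inf m M.
have := ar _ (boundary_open_ball r d'); rewrite /= bdistxx => /(_ d'0).
move=> /boundary_uniformP/(_ d d0)[N hN]; exists N => j Nj x xM.
rewrite ltNge; apply/negP => /hd.
apply/negP; rewrite -ltNge -uE bdistC -a0; apply: hN => //=.
by apply/negP; rewrite -leNgt ri bdistC hd'.
Qed.

(** Otherwise, rescaling by dilations before and after yields maps k_j and points
    with gauge x_j = gauge (k_j x_j) = 1, gauge y_j <= 1 and gauge (k_j y_j)
    unbounded.  The behaviour at x_j excludes an attractor-repeller pair, that at
    y_j a limit homeomorphism, which fixes infinity. *)
Lemma weak_quasisymmetry : exists2 C, 1 <= C & forall k, acts k -> k h0 = h0 ->
  forall x y, gauge y <= gauge x -> gauge (k y) <= C * gauge (k x).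
Proof.
apply: contrapT => H.
have ex j : exists k x y, [/\ acts k, k h0 = h0, gauge x = 1, gauge (k x) = 1 &
    gauge y <= 1 /\ j.+1%:R < gauge (k y)].
  apply: contrapT => Hj; apply: H; exists j.+1%:R; first by rewrite ler1n.
  move=> k ka k0 x y yx; rewrite leNgt; apply/negP => ky; apply: Hj.
  have xn : x <> h0.
    move=> x0; move: yx ky; rewrite x0 gauge0 => yx.
    have -> : y = h0 by apply: gauge_eq0; apply/eqP; rewrite eq_le yx gauge_ge0.
    by rewrite k0 gauge0 mulr0 ltxx.
  have gx := gauge_gt0 xn.
  have gkx : 0 < gauge (k x).
    by apply: gauge_gt0 => e; apply: xn; apply: (acts_inj ka); rewrite e k0.
  have gxi : 0 < (gauge x)^-1 by rewrite invr_gt0.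
  have gkxi : 0 < (gauge (k x))^-1 by rewrite invr_gt0.
  have dK z : hdil (gauge x) (hdil (gauge x)^-1 z) = z.
    by rewrite hdil_comp divff ?hdil1 // gt_eqF.
  exists (hdil (gauge (k x))^-1 \o (k \o hdil (gauge x))), (hdil (gauge x)^-1 x),
    (hdil (gauge x)^-1 y).
  have gd z : gauge (hdil (gauge x)^-1 z) = (gauge x)^-1 * gauge z by rewrite gauge_dil // ltW.
  have gd' z : gauge (hdil (gauge (k x))^-1 z) = (gauge (k x))^-1 * gauge z.
    by rewrite gauge_dil // ltW.
  split; rewrite /= ?dK ?gd ?gd' ?mulVf ?gt_eqF //.
  - by apply: acts_comp; [exact: acts_dil|apply: acts_comp => //; exact: acts_dil].
  - by rewrite hdil_h0 k0 hdil_h0.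
  - by rewrite mulrC ler_pdivrMr // mul1r; split=> //; rewrite mulrC ltr_pdivlMr.
have [k hk] := choice ex; have [x hx] := choice hk; have [y hy] := choice hx.
have ka j : acts (k j) by case: (hy j).
have k0 j : k j h0 = h0 by case: (hy j).
have [phi phi_mono [[u hu [h hh uh]]|B|B]] := fixed_pair_alternative ka k0.
- have [hc [h' [hK h'K h'c]]] := hh.
  have hinf : h inf = inf.
    apply: bdist0_eq; apply: (@eq_small _ _ _ 1) => e e0; have [N hN] := uh e e0.
    have := hN N (leqnn N) inf; have [_ -> _] := hu (phi N).
    by rewrite subr0 ger0_norm ?bdist_ge0 // mul1r => /ltW.
  have [d d0 hd] := bounded_far_inf m (1 : R).
  have [d' d'0 hd'] := proj1 (boundary_continuousP _) h'c inf d d0.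
  have d'20 : 0 < d' / 2 by rewrite divr_gt0.
  have [N hN] := uh _ d'20.
  pose M := 2 / (d' / 2).
  have [J NJ MJ] : exists2 J, (N <= J)%N & M <= J%:R.
    exists (maxn N (Num.bound M)); first by rewrite leq_maxl.
    have : M < (Num.bound M)%:R by rewrite archi_boundP // ltW // divr_gt0.
    by move=> /ltW /le_trans; apply; rewrite ler_nat leq_maxr.
  have Jphi j : (j <= phi j)%N.
    by elim: j => // j IH; rewrite (leq_ltn_trans IH) // phi_mono.
  have [_ _ _ _ [y1 ky]] := hy (phi J).
  have [_ _ uE] := hu (phi J).
  have far : d' <= bdist (h (pt (y (phi J)))) inf.
    rewrite leNgt; apply/negP => far; have := hd _ y1; apply/negP; rewrite -ltNge.
    have := hd' (h (pt (y (phi J)))); rewrite bdistC => /(_ far).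
    by rewrite hK -{1}hinf hK bdistC.
  have := hN J NJ (pt (y (phi J))); rewrite uE => close.
  have := @far_inf_bounded R m (k (phi J) (y (phi J))) (d' / 2) d'20.
  have := bdist_tri (pt (k (phi J) (y (phi J)))) (h (pt (y (phi J)))) inf.
  move=> tri bnd; have {}bnd : gauge (k (phi J) (y (phi J))) <= M by apply: bnd; lra.
  have : J%:R <= (phi J).+1%:R :> R by rewrite ler_nat (leq_trans (Jphi J)).
  lra.
- have [N hN] := B 1 1 ltr01; have [_ _ x1 kx1 _] := hy (phi N).
  by have := hN N (leqnn N) (x (phi N)); rewrite x1 kx1 lexx ltxx => /(_ isT).
- have [N hN] := B 1 1 ltr01; have [_ _ x1 kx1 _] := hy (phi N).
  by have := hN N (leqnn N) (x (phi N)); rewrite x1 kx1 lexx ltxx => /(_ isT).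
Qed.

(** The iterates of k keep x bounded and y away from the origin, so neither fixed
    point attracts.  In the remaining case, a late iterate of x is an earlier iterate
    of another point w of its orbit, so h x and h w are close, and so are x and w; but
    w lies in the smaller ball. *)
Lemma no_two_basins k x y r : acts k -> k h0 = h0 -> 0 < gauge x -> 0 < gauge y ->
  r < gauge x ->
  (forall z, gauge z <= gauge x -> gauge (k z) <= r) ->
  (forall z, gauge y <= gauge z -> gauge y <= gauge (k z)) -> False.
Proof.
move=> ka k0 x0 y0 rx hx hy.
have it0 j : iter j k h0 = h0 by elim: j => //= j ->.
have itx j : gauge (iter j k x) <= gauge x.
  by elim: j => //= j IH; apply: le_trans (ltW rx); exact: hx.
have itx1 j : gauge (iter j.+1 k x) <= r by rewrite /=; apply: hx.
have ity j : gauge y <= gauge (iter j k y) by elim: j => //= j IH; exact: hy.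
have ita j : acts (iter j k) by exact: acts_iter.
have [phi phi_mono [[u hu [h hh uh]]|B|B]] := fixed_pair_alternative ita it0.
- have [_ [h' [hK h'K h'c]]] := hh.
  have [d d0 hd] := near_pt_gauge rx.
  have [d' d'0 hd'] := proj1 (boundary_continuousP _) h'c (h (pt x)) d d0.
  have d'20 : 0 < d' / 2 by rewrite divr_gt0.
  have [N hN] := uh _ d'20.
  have lt := phi_mono N N.+1 (ltnSn N).
  (* the exponent is phi N.+1 - phi N, written as a successor for itx1 *)
  pose w := iter (phi N.+1 - phi N).-1.+1 k x.
  have ew : iter (phi N) k w = iter (phi N.+1) k x.
    by rewrite -iterD prednK ?subn_gt0 // subnKC // ltnW.
  have E : u (phi N) (pt w) = u (phi N.+1) (pt x).
    by have [_ _ ->] := hu (phi N); have [_ _ ->] := hu (phi N.+1); rewrite ew.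
  have close : bdist (h (pt x)) (h (pt w)) < d'.
    have h1 := hN N (leqnn N) (pt w); have h2 := hN N.+1 (leqnSn N) (pt x).
    have := bdist_tri (u (phi N) (pt w)) (h (pt x)) (h (pt w)).
    move: h1 h2; rewrite E (bdistC (h (pt w))); lra.
  have := hd' _ close; rewrite !hK => /hd.
  by rewrite ltNge itx1.
- have [N hN] := B _ (gauge x) x0.
  by have := hN N (leqnn N) x (lexx _); rewrite ltNge itx.
- have [N hN] := B (gauge y) _ y0.
  by have := hN N (leqnn N) y (lexx _); rewrite ltNge ity.
Qed.

(** If the bound fails for x and y, a dilation can be chosen so that [hdil t \o k]
    maps the ball through y into a smaller one and the complement of the ball
    through x into itself. *)
Lemma quasi_similarity0 : exists2 C, 1 <= C & forall k, acts k -> k h0 = h0 ->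
  forall x y, gauge (k x) * gauge y <= C * (gauge (k y) * gauge x).
Proof.
have [C C1 hC] := weak_quasisymmetry.
have C0 : 0 < C by apply: lt_le_trans C1.
exists (C ^+ 2); first by rewrite exprn_ege1.
move=> k ka k0 x y.
have pos z : z <> h0 -> 0 < gauge z /\ 0 < gauge (k z).
  move=> zn; split; apply: gauge_gt0 => // e.
  by apply: zn; apply: (acts_inj ka); rewrite e k0.
have [->|xn] := pselect (x = h0).
  by rewrite k0 gauge0 mul0r !mulr0.
have [->|yn] := pselect (y = h0); first by rewrite k0 gauge0 mul0r !mulr0.
have [x0 kx0] := pos _ xn; have [y0 ky0] := pos _ yn.
rewrite leNgt; apply/negP => H.
have q1 : 0 < gauge (k x) by [].
have q2 : 0 < C * gauge (k y) by rewrite mulr_gt0.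
pose t1 := C * gauge x / gauge (k x); pose t2 := gauge y / (C * gauge (k y)).
have lt : t1 < t2.
  rewrite /t1 /t2 (ltr_pdivrMr _ _ q1) mulrAC (ltr_pdivlMr _ _ q2).
  by have := H; rewrite expr2; lra.
have p1 : 0 < t1 by rewrite divr_gt0 // mulr_gt0.
pose t := (t1 + t2) / 2.
have h1 : t1 < t by rewrite /t; lra.
have h2 : t < t2 by rewrite /t; lra.
have t0 : 0 < t by lra.
rewrite /t1 (ltr_pdivrMr _ _ q1) in h1; rewrite /t2 (ltr_pdivlMr _ _ q2) in h2.
pose k' := hdil t \o k.
have k'a : acts k' by apply: acts_comp => //; exact: acts_dil.
have k'0 : k' h0 = h0 by rewrite /k' /= k0 hdil_h0.
have gk' z : gauge (k' z) = t * gauge (k z) by rewrite gauge_dil // ltW.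
apply: (@no_two_basins k' y x (C * gauge (k' y))) => //.
- by rewrite gk'; lra.
- by move=> z zy; exact: hC.
- move=> z xz; have := hC _ k'a k'0 _ _ xz; rewrite gk' => h.
  by rewrite -(ler_pM2l C0); lra.
Qed.

(** Conjugating by translations moves the base point of [quasi_similarity0]; two
    applications change both endpoints. *)
Lemma quasi_similarity : exists2 C, 1 <= C & forall k, acts k ->
  forall x y z w, hdist (k x) (k y) * hdist z w <= C * (hdist (k z) (k w) * hdist x y).
Proof.
have [C C1 hC] := quasi_similarity0.
have C0 : 0 <= C by apply: le_trans C1.
exists (C ^+ 2); first by rewrite exprn_ege1.
move=> k ka.
have base x y z : hdist (k x) (k y) * hdist x z <= C * (hdist (k x) (k z) * hdist x y).
  pose k' := hmul (hinv (k x)) \o (k \o hmul x).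
  have k'a : acts k'.
    by apply: acts_comp; [exact: acts_trans|apply: acts_comp => //; exact: acts_trans].
  have k'0 : k' h0 = h0 by rewrite /k' /= hmul0r hmulVl.
  have := hC k' k'a k'0 (hmul (hinv x) y) (hmul (hinv x) z).
  by rewrite /k' /= !hmulVK.
move=> x y z w.
have [e|xw] := pselect (x = w).
  subst w; apply: (@le_trans _ _ (C * (hdist (k z) (k x) * hdist x y))).
    by rewrite (hdistC z) (hdistC (k z)); exact: base.
  rewrite ler_wpM2r ?mulr_ge0 ?hdist_ge0 // expr2 ler_peMr //.
have d0 := hdist_gt0 xw.
have kd0 : 0 < hdist (k x) (k w) by apply: hdist_gt0 => /(acts_inj ka).
have dd := mulr_gt0 d0 kd0.
rewrite -(ler_pM2r dd).
have h1 := base x y w; have h2 := base w x z.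
rewrite (hdistC (k w) (k x)) (hdistC w z) (hdistC (k w) (k z)) (hdistC w x) in h2.
have := ler_pM (mulr_ge0 (hdist_ge0 _ _) (hdist_ge0 _ _))
  (mulr_ge0 (hdist_ge0 _ _) (hdist_ge0 _ _)) h1 h2.
set A := hdist (k x) (k y); set B := hdist z w; set D := hdist (k z) (k w).
set E := hdist x y; set F := hdist x w; set H := hdist (k x) (k w).
have -> : A * F * (H * B) = A * B * (F * H) by ring.
by have -> : C * (H * E) * (C * (D * F)) = C ^+ 2 * (D * E) * (F * H) by ring.
Qed.

End ConvergenceDynamics.

(** * A homomorphism from covering numbers *)

Section CoveringCounts.
Variables (R : realType) (T : Type) (l : T -> R) (H : set (T -> T)).
Variables (c : R) (dil : R -> T -> T) (x0 : T).
Hypothesis H_id : H id.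
Hypothesis H_comp : forall f g, H f -> H g -> H (f \o g).
Hypothesis H_inv : forall f, H f -> exists g, [/\ H g, cancel f g & cancel g f].
Hypothesis H_quasi : forall f x y, H f -> (l (f x) - l x) - (l (f y) - l y) <= c.
Hypothesis H_dil : forall u, H (dil u).
Hypothesis l_dil : forall u x, l (dil u x) = l x + u.

Section FixedScale.
Variable eta : R.
Hypothesis eta0 : 0 < eta.

(** Smallness is tested after applying any element of H, so that images of small
    sets under H are small and counts are invariant. *)
Definition small (E : set T) := forall h, H h -> forall x y, E x -> E y ->
  l (h x) - l (h y) <= eta.

Definition covers (P : set T) (k : nat) := exists (I : finType) (E : I -> set T),
  [/\ (#|I| <= k)%N, forall i, small (E i) & forall x, P x -> exists i, E i x].

Definition shell (a b : R) : set T := [set x | a <= l x <= b].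

Hypothesis cover01 : exists k, covers (shell 0 1) k.

(** The least number of small sets covering P; arbitrary when no finite cover
    exists. *)
Definition cnt (P : set T) : nat := get [set k | covers P k /\ forall j, covers P j -> (k <= j)%N].

Lemma cntP P : (exists k, covers P k) ->
  covers P (cnt P) /\ forall j, covers P j -> (cnt P <= j)%N.
Proof.
move=> [k0 hk0].
have exb : exists k, `[< covers P k >] by exists k0; apply/asboolP.
have [k /asboolP hk kmin] := ex_minnP exb.
apply: (@getPex _ [set k | covers P k /\ forall j, covers P j -> (k <= j)%N]).
by exists k; split=> // j /asboolP; exact: kmin.
Qed.

Lemma coversS P Q k : P `<=` Q -> covers Q k -> covers P k.
Proof. by move=> PQ [I [E [h1 h2 h3]]]; exists I, E; split=> // x /PQ/h3. Qed.

Lemma cnt_le P Q : P `<=` Q -> (exists k, covers Q k) -> (cnt P <= cnt Q)%N.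
Proof.
move=> PQ exQ; have [hQ _] := cntP exQ.
have hP := coversS PQ hQ.
by have [_] := cntP (ex_intro _ _ hP); exact.
Qed.

Lemma coversU P Q a b : covers P a -> covers Q b -> covers (P `|` Q) (a + b).
Proof.
move=> [I [E [i1 i2 i3]]] [J [F [j1 j2 j3]]].
exists (I + J)%type, (fun i => match i with inl i => E i | inr j => F j end); split.
- by rewrite card_sum leq_add.
- by case.
- by move=> x [/i3[i ?]|/j3[j ?]]; [exists (inl i)|exists (inr j)].
Qed.

Lemma cntU P Q : (exists k, covers P k) -> (exists k, covers Q k) ->
  (cnt (P `|` Q) <= cnt P + cnt Q)%N.
Proof.
move=> exP exQ; have [hP _] := cntP exP; have [hQ _] := cntP exQ.
have hU := coversU hP hQ.
by have [_] := cntP (ex_intro _ _ hU); exact.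
Qed.

(** Counts are additive over such a pair, as a small set serves only one of
    them. *)
Definition separated (P Q : set T) := forall E, small E ->
  forall x y, E x -> E y -> P x -> Q y -> False.

Lemma cnt_separated P Q : separated P Q -> (exists k, covers (P `|` Q) k) ->
  (cnt P + cnt Q <= cnt (P `|` Q))%N.
Proof.
move=> sep exU; have [[I [E [Ik Es EU]]] _] := cntP exU.
pose A := [pred i | `[< exists2 x, E i x & P x >]].
pose B := [pred i | `[< exists2 x, E i x & Q x >]].
have AB i : (i \in [predI A & B]) = false.
  apply/negP => /andP[/asboolP[x Ex Px] /asboolP[y Ey Qy]].
  exact: (sep _ (Es i) x y).
have sub (S : set T) (D : pred I) : (forall i x, E i x -> S x -> D i) ->
    S `<=` P `|` Q -> covers S #|D|.
  move=> SD SPQ; exists {i | D i}, (fun i => E (val i)); split.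
  - by rewrite card_sig.
  - by move=> i; exact: Es.
  - move=> x Sx; have [i Eix] := EU x (SPQ x Sx).
    by exists (exist _ i (SD i x Eix Sx)).
have hP : covers P #|A| by apply: sub => [i x Ex Px|x Px]; [apply/asboolP; exists x|left].
have hQ : covers Q #|B| by apply: sub => [i x Ex Px|x Px]; [apply/asboolP; exists x|right].
have [_ cP] := cntP (ex_intro _ _ hP); have [_ cQ] := cntP (ex_intro _ _ hQ).
apply: leq_trans Ik; apply: leq_trans (max_card [predU A & B]).
rewrite -(leq_add2r #|[predI A & B]|) cardUI.
have -> : #|[predI A & B]| = 0%N by apply: eq_card0 => i; rewrite AB.
by rewrite addn0 leq_add ?cP ?cQ.
Qed.

Lemma covers_move f P k : H f -> covers P k -> covers [set x | P (f x)] k.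
Proof.
move=> Hf [I [E [h1 h2 h3]]]; exists I, (fun i => [set x | E i (f x)]); split=> //.
  move=> i h Hh x y Ex Ey; have [g [Hg fK gK]] := H_inv Hf.
  by have := h2 i (h \o g) (H_comp Hh Hg) _ _ Ex Ey; rewrite /= !fK.
by move=> x /h3[i Ei]; exists i.
Qed.

Lemma cnt_move f P : H f -> (exists k, covers P k) -> cnt [set x | P (f x)] = cnt P.
Proof.
move=> Hf exP; have [g [Hg fK gK]] := H_inv Hf.
have [hP minP] := cntP exP.
have hf := covers_move Hf hP; have [hm minf] := cntP (ex_intro _ _ hf).
apply/eqP; rewrite eqn_leq minf //= minP //.
by apply: coversS (covers_move Hg hm) => x Px /=; rewrite gK.
Qed.

Lemma cover_shell a b : exists k, covers (shell a b) k.
Proof.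
have shift a' k : covers (shell 0 1) k -> covers (shell a' (a' + 1)) k.
  move=> h; apply: coversS (covers_move (H_dil (- a')) h) => x /=.
  by rewrite /shell /= l_dil; lra.
have many N : exists k, covers (shell a (a + N%:R)) k.
  elim: N => [|N [k hk]].
    have [k hk] := cover01; exists k; apply: coversS (shift a k hk) => x.
    by rewrite /shell /=; lra.
  have [k' hk'] := cover01; exists (k + k')%N.
  apply: coversS (coversU hk (shift (a + N%:R) _ hk')) => x.
  rewrite /shell /= -natr1 => /andP[h1 h2].
  by have [h|h] := leP (l x) (a + N%:R); [left|right]; lra.
have [k hk] := many (Num.bound (b - a)).
exists k; apply: coversS hk => x; rewrite /shell /= => /andP[h1 h2].
have := @archi_boundP R `|b - a|; have := ler_norm (b - a) => h3 /(_ (normr_ge0 _)) h4.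
have [h5|h5] := leP 0 (b - a); last by lra.
have := archi_boundP h5; lra.
Qed.

Definition psi (u : R) : R := (cnt (shell 0 u))%:R.

Lemma cnt_shell a u : cnt (shell a (a + u)) = cnt (shell 0 u).
Proof.
rewrite -(@cnt_move (dil (- a)) (shell 0 u) (H_dil _) (cover_shell _ _)).
congr cnt; apply/seteqP; split=> x; rewrite /shell /= l_dil; lra.
Qed.

Lemma separated_levels P Q h a b : H h -> eta < b - a ->
  (forall x, P x -> b <= l (h x)) -> (forall x, Q x -> l (h x) <= a) -> separated P Q.
Proof.
by move=> Hh ab hP hQ E Es x y Ex Ey /hP h1 /hQ h2; have := Es h Hh x y Ex Ey; lra.
Qed.

Lemma psi_mono u v : u <= v -> psi u <= psi v.
Proof.
move=> uv; rewrite ler_nat; apply: cnt_le (cover_shell _ _) => x.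
by rewrite /shell /=; lra.
Qed.

Lemma psi_subadd u v : 0 <= u -> 0 <= v -> psi (u + v) <= psi u + psi v.
Proof.
move=> u0 v0; rewrite /psi -(cnt_shell u v) -natrD ler_nat.
apply: leq_trans (cntU (cover_shell _ _) (cover_shell _ _)).
apply: cnt_le; last first.
  have [h1 _] := cntP (cover_shell 0 u); have [h2 _] := cntP (cover_shell u (u + v)).
  by exists (cnt (shell 0 u) + cnt (shell u (u + v)))%N; exact: coversU.
move=> x; rewrite /shell /= => /andP[h1 h2].
by have [h|h] := leP (l x) u; [left|right]; lra.
Qed.

(** Two shells a gap of 2 eta apart are separated. *)
Lemma psi_superadd u v : 0 <= u -> 0 <= v -> psi u + psi v <= psi (u + v + 2 * eta).
Proof.
move=> u0 v0; rewrite /psi -(cnt_shell (u + 2 * eta) v) -natrD ler_nat addnC.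
have sub : shell (u + 2 * eta) (u + 2 * eta + v) `|` shell 0 u
    `<=` shell 0 (u + v + 2 * eta).
  by move=> x; rewrite /shell /= => -[]; have := eta0; lra.
have [h1 _] := cntP (cover_shell 0 (u + v + 2 * eta)).
apply: leq_trans (cnt_le sub (cover_shell _ _)); apply: cnt_separated.
  apply: (@separated_levels _ _ id u (u + 2 * eta)) => //; first by have := eta0; lra.
    by move=> x; rewrite /shell /=; lra.
  by move=> x; rewrite /shell /=; lra.
by exists (cnt (shell 0 (u + v + 2 * eta))); exact: coversS h1.
Qed.

Lemma psi_ge1 u : 0 <= u -> 1 <= psi u.
Proof.
move=> u0; rewrite /psi ler1n lt0n; apply/negP => /eqP c0.
have [[I [E [I0 _ hE]]] _] := cntP (cover_shell 0 u); rewrite c0 in I0.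
have [|i _] := hE (dil (- l x0) x0); first by rewrite /shell /= l_dil; lra.
by have := fintype0 i; move: I0; rewrite leqn0 => /eqP ->.
Qed.

Lemma psi_ratio u v : 0 <= u -> 0 < v -> psi u * v <= (u + 2 * eta) * psi v.
Proof.
move=> u0 v0; have e0 := eta0.
have sup j : j%:R * psi u <= psi (j%:R * (u + 2 * eta)).
  elim: j => [|j IH]; first by rewrite !mul0r (le_trans ler01) // psi_ge1.
  rewrite -natr1 !mulrDl !mul1r; apply: (@le_trans _ _ (psi (j%:R * (u + 2 * eta)) + psi u)).
    by rewrite lerD2r.
  have j0 : 0 <= j%:R * (u + 2 * eta) by rewrite mulr_ge0 //; lra.
  by apply: (le_trans (psi_superadd j0 u0)); apply: psi_mono; lra.
have sub j : psi (j.+1%:R * v) <= j.+1%:R * psi v.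
  elim: j => [|j IH]; first by rewrite !mul1r.
  rewrite -natr1 !mulrDl !mul1r; apply: le_trans (lerD IH (lexx _)).
  by apply: psi_subadd; [rewrite mulr_ge0 // ltW|exact: ltW].
have pv : 1 <= psi v by apply: psi_ge1; exact: ltW.
have key j : j%:R * (psi u * v - (u + 2 * eta) * psi v) <= v * psi v.
  pose w := j%:R * (u + 2 * eta) / v.
  have w0 : 0 <= w by rewrite divr_ge0 ?mulr_ge0 ?(ltW v0) //; lra.
  have [N hN1 hN2] : exists2 N : nat, w <= N.+1%:R & N.+1%:R <= w + 1.
    have /andP[h1 h2] := truncn_itv w0.
    by exists (Num.truncn w); [exact: ltW|rewrite -natr1 lerD2r].
  have h1 : psi (j%:R * (u + 2 * eta)) <= (w + 1) * psi v.
    apply: (@le_trans _ _ (psi (N.+1%:R * v))).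
      by apply: psi_mono; rewrite -ler_pdivrMr.
    by apply: (le_trans (sub N)); rewrite ler_wpM2r //; lra.
  have h2 := le_trans (sup j) h1.
  have h3 : j%:R * psi u * v <= (w + 1) * psi v * v by rewrite ler_wpM2r // ltW.
  have : (w + 1) * psi v * v = j%:R * ((u + 2 * eta) * psi v) + v * psi v.
    by rewrite /w; field; rewrite gt_eqF.
  by move=> e; rewrite e in h3; lra.
rewrite leNgt; apply/negP => lt; set d := psi u * v - (u + 2 * eta) * psi v in key.
have d0 : 0 < d by rewrite /d subr_gt0.
have b0 : 0 <= v * psi v / d by rewrite divr_ge0 ?(ltW d0) // mulr_ge0 ?(ltW v0) //; lra.
have := archi_boundP b0; rewrite ltr_pdivrMr // => h.
by have := key (Num.bound (v * psi v / d)); rewrite leNgt h.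
Qed.

(** Fekete argument: psi is subadditive, and superadditive up to a shift by
    2 eta, so it is linear up to an error proportional to its slope kappa. *)
Lemma density : exists2 kappa, 0 < kappa &
  forall u, 0 <= u -> kappa * u <= psi u <= kappa * (u + 2 * eta).
Proof.
have e0 := eta0.
pose S := [set psi u / (u + 2 * eta) | u in [set u | 0 <= u]].
have ubS v : 0 < v -> ubound S (psi v / v).
  move=> v0 _ [u /= u0 <-]; rewrite ler_pdivrMr; last by lra.
  by rewrite mulrAC ler_pdivlMr // (mulrC (psi v)) psi_ratio.
have S0 : S !=set0 by exists (psi 0 / (0 + 2 * eta)); exists 0; first exact: lexx.
have hS : has_sup S by split=> //; exists (psi 1 / 1); exact: ubS.
have up u : 0 <= u -> psi u / (u + 2 * eta) <= sup S.
  by move=> u0; apply: (sup_upper_bound hS); exists u.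
exists (sup S).
  apply: lt_le_trans (up 0 (lexx 0)); rewrite divr_gt0 //; last by lra.
  by apply: lt_le_trans ltr01 _; exact: psi_ge1.
move=> u u0; apply/andP; split; last first.
  by have := up u u0; rewrite ler_pdivrMr //; lra.
have [->|un] := eqVneq u 0; first by rewrite mulr0 (le_trans ler01) // psi_ge1.
have up0 : 0 < u by rewrite lt_neqAle eq_sym un.
by rewrite -ler_pdivlMr //; apply: sup_le_ub => //; exact: ubS.
Qed.

(** The region between the level - s of l and the level 0 of [l \o f]. *)
Definition below (f : T -> T) (s : R) : set T := [set x | - s <= l x /\ l (f x) <= 0].

(** Cut the region P along a level of [l \o b]: the count is additive up to the
    count of a shell of width 2 eta around the cut. *)
Lemma cut_count (P : set T) b s s' M : H b ->
  (forall x, P x -> l x <= M) ->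
  (forall x, l (b x) + s <= 0 -> P x) ->
  (forall x, P x -> 0 <= l (b x) + s -> - s' <= l x) ->
  `|(cnt [set x | - s' <= l x /\ P x])%:R -
     ((cnt [set x | 0 <= l (b x) + s /\ P x])%:R +
      (cnt [set x | - s' <= l x /\ l (b x) + s <= 0])%:R)| <= psi (2 * eta).
Proof.
move=> Hb PM qP Pq; have e0 := eta0.
set A := [set x | - s' <= l x /\ P x]; set C := [set x | 0 <= l (b x) + s /\ P x].
set D := [set x | - s' <= l x /\ l (b x) + s <= 0].
have exS : exists k, covers (shell (- s') M) k by exact: cover_shell.
have AS : A `<=` shell (- s') M by move=> x [h /PM]; rewrite /shell /=; lra.
have CA : C `<=` A by move=> x [h Px]; split=> //; exact: Pq.
have DA : D `<=` A by move=> x [h q0]; split=> //; exact: qP.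
have ex Q : Q `<=` A -> exists k, covers Q k.
  by move=> QA; have [k hk] := exS; exists k; apply: coversS hk => x /QA/AS.
have h1 : (cnt A <= cnt C + cnt D)%N.
  apply: leq_trans (cntU (ex _ CA) (ex _ DA)).
  apply: cnt_le; last by apply: ex => x [/CA|/DA].
  by move=> x [h Px]; have [q|q] := leP 0 (l (b x) + s); [left|right; split=> //; exact: ltW].
pose C1 := [set x | 2 * eta <= l (b x) + s /\ P x].
pose B := [set x | shell (- s) (- s + 2 * eta) (b x)].
have C1A : C1 `<=` A by move=> x [h Px]; split=> //; apply: Pq => //; lra.
have exB : exists k, covers B k.
  by have [k hk] := cover_shell (- s) (- s + 2 * eta); exists k; exact: covers_move.
have cB : (cnt B)%:R = psi (2 * eta).
  by rewrite /B (cnt_move Hb (cover_shell _ _)) cnt_shell.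
have h2 : (cnt C <= cnt C1 + cnt B)%N.
  apply: leq_trans (cntU (ex _ C1A) exB).
  apply: cnt_le.
    move=> x [h Px]; have [q|q] := leP (2 * eta) (l (b x) + s); [by left|right].
    by rewrite /B /shell /=; lra.
  have [k1 hk1] := ex _ C1A; have [k2 hk2] := exB.
  by exists (k1 + k2)%N; exact: coversU.
have C1D : C1 `|` D `<=` A by move=> x [/C1A|/DA].
have h3 : (cnt C1 + cnt D <= cnt A)%N.
  apply: leq_trans (cnt_le C1D (ex _ (fun x h => h))).
  apply: cnt_separated (ex _ C1D).
  apply: (@separated_levels _ _ b (- s) (2 * eta - s)) => //; first by lra.
    by move=> x [h _]; lra.
  by move=> x [_ h]; lra.
have {}h1 : (cnt A)%:R <= (cnt C)%:R + (cnt D)%:R :> R by rewrite -natrD ler_nat.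
have {}h2 : (cnt C)%:R <= (cnt C1)%:R + psi (2 * eta) by rewrite -cB -natrD ler_nat.
have {}h3 : (cnt C1)%:R + (cnt D)%:R <= (cnt A)%:R :> R by rewrite -natrD ler_nat.
have p0 : 0 <= psi (2 * eta) by rewrite (le_trans ler01) // psi_ge1; lra.
by rewrite ler_norml; lra.
Qed.

Lemma l_move f : H f -> forall x, `|l (f x) - (l x + (l (f x0) - l x0))| <= c.
Proof.
by move=> Hf x; have := H_quasi x x0 Hf; have := H_quasi x0 x Hf; rewrite ler_norml; lra.
Qed.

(** Up to the factor - kappa, the height by which f raises level sets. *)
Definition excess f s : R := (cnt (below f s))%:R - (cnt (below id s))%:R.

Lemma cover_below f s : H f -> exists k, covers (below f s) k.
Proof.
move=> Hf; have [k hk] := cover_shell (- s) (c - (l (f x0) - l x0)).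
exists k; apply: coversS hk => x [h1 h2]; rewrite /shell /=.
by have := l_move Hf x; rewrite ler_norml; lra.
Qed.

(** Transport the regions of [f \o g] and g by g: they become regions below the
    level sets of f and l, ending at a deep level of [l \o g^-1].  Cutting the
    common deeper regions along that level and along a level of l expresses
    the defect of additivity by four cutting errors. *)
Lemma excess_additive f g : H f -> H g -> exists s0, forall s, s0 <= s ->
  `|excess (f \o g) s - excess g s - excess f s| <= 4 * psi (2 * eta).
Proof.
move=> Hf Hg; have [g' [Hg' gK g'K]] := H_inv Hg.
pose df := l (f x0) - l x0; pose dg' := l (g' x0) - l x0.
have lf := l_move Hf; have lg' := l_move Hg'; rewrite -/df in lf; rewrite -/dg' in lg'.
have c0 : 0 <= c by apply: le_trans (lf x0).
exists (`|df| + `|dg'| + 2 * c) => s hs.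
pose s' := s + `|dg'| + c.
have n1 := ler_norm df; have n2 := ler_norm dg'.
have n3 := ler_norm (- df); have n4 := ler_norm (- dg'); rewrite normrN in n3; rewrite normrN in n4.
have cut h b : H h -> H b -> (h = f \/ h = id) -> (b = g' \/ b = id) ->
  `|(cnt (below h s'))%:R - ((cnt [set x | 0 <= l (b x) + s /\ l (h x) <= 0])%:R +
      (cnt [set x | - s' <= l x /\ l (b x) + s <= 0])%:R)| <= psi (2 * eta).
  move=> Hh Hb hE bE.
  have lh x : `|l (h x) - l x| <= `|df| + c.
    case: hE => -> /=; last by rewrite subrr normr0; lra.
    by have := lf x; rewrite !ler_norml; lra.
  have lb x : `|l (b x) - l x| <= `|dg'| + c.
    case: bE => -> /=; last by rewrite subrr normr0; lra.
    by have := lg' x; rewrite !ler_norml; lra.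
  apply: (@cut_count [set x | l (h x) <= 0] b s s' (`|df| + c)) => //= x.
  - by have := lh x; rewrite ler_norml; lra.
  - by have := lh x; have := lb x; rewrite !ler_norml; lra.
  - by have := lb x; rewrite !ler_norml /s'; lra.
have e1 : cnt (below (f \o g) s) = cnt [set x | 0 <= l (g' x) + s /\ l (f x) <= 0].
  rewrite -(cnt_move Hg' (cover_below s (H_comp Hf Hg))); congr cnt.
  by apply/seteqP; split=> x /=; rewrite /below /= g'K => -[h1 h2]; split=> //; lra.
have e2 : cnt (below g s) = cnt [set x | 0 <= l (g' x) + s /\ l x <= 0].
  rewrite -(cnt_move Hg' (cover_below s Hg)); congr cnt.
  by apply/seteqP; split=> x /=; rewrite /below /= g'K => -[h1 h2]; split=> //; lra.
have e3 h : cnt (below h s) = cnt [set x | 0 <= l x + s /\ l (h x) <= 0].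
  by congr cnt; apply/seteqP; split=> x /= [h1 h2]; split=> //; lra.
have k1 := cut f g' Hf Hg' (or_introl erefl) (or_introl erefl).
have k2 := cut id g' H_id Hg' (or_intror erefl) (or_introl erefl).
have k3 := cut f id Hf H_id (or_introl erefl) (or_intror erefl).
have k4 := cut id id H_id H_id (or_intror erefl) (or_intror erefl).
rewrite /excess e1 e2 (e3 f) (e3 id).
move: k1 k2 k3 k4; rewrite /= !ler_norml; lra.
Qed.

Lemma excess_bound f kappa : H f -> 0 < kappa ->
  (forall u, 0 <= u -> kappa * u <= psi u <= kappa * (u + 2 * eta)) ->
  exists s0, forall s, s0 <= s ->
    `|excess f s + kappa * (l (f x0) - l x0)| <= kappa * (c + 2 * eta).
Proof.
move=> Hf k0 hk; have lf := l_move Hf; set d := l (f x0) - l x0 in lf *.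
have c0 : 0 <= c by apply: le_trans (lf x0).
exists (`|d| + c) => s hs.
have n1 := ler_norm d; have n3 := ler_norm (- d); rewrite normrN in n3.
have u1 : (cnt (below f s))%:R <= psi (s - d + c).
  rewrite /psi -(cnt_shell (- s)) ler_nat; apply: cnt_le (cover_shell _ _) => x [h1 h2].
  by rewrite /shell /=; have := lf x; rewrite ler_norml; lra.
have u2 : psi (s - d - c) <= (cnt (below f s))%:R.
  rewrite /psi -(cnt_shell (- s)) ler_nat; apply: cnt_le (cover_below s Hf) => x.
  by rewrite /shell /below /=; have := lf x; rewrite ler_norml => ? ?; split; lra.
have e3 : (cnt (below id s))%:R = psi s.
  rewrite /psi -(cnt_shell (- s)) addNr; congr _%:R; congr cnt.
  by apply/seteqP; split=> x; rewrite /shell /below /=; [lra|move=> ?; split; lra].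
have /andP[a1 a2] := hk (s - d + c) ltac:(lra).
have /andP[b1 b2] := hk (s - d - c) ltac:(lra).
have /andP[d1 d2] := hk s ltac:(lra).
rewrite /excess e3 ler_norml; apply/andP; split; lra.
Qed.

End FixedScale.

Lemma approximate_hom eta : 0 < eta -> (exists k, covers eta (shell 0 1) k) ->
  exists v : (T -> T) -> R -> R, (forall f g, H f -> H g -> exists s0, forall s, s0 <= s ->
     `|v (f \o g) s - v f s - v g s| <= 16 * eta) /\
  (forall f, H f -> exists s0, forall s, s0 <= s ->
    `|v f s - (l (f x0) - l x0)| <= c + 2 * eta).
Proof.
move=> e0 cov; have [kappa k0 hk] := density e0 cov.
exists (fun f s => - excess eta f s / kappa); split.
  move=> f g Hf Hg; have [s0 hs0] := excess_additive e0 cov Hf Hg; exists s0 => s /hs0.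
  have /andP[_ p1] := hk (2 * eta) ltac:(lra).
  have -> : - excess eta (f \o g) s / kappa - - excess eta f s / kappa - - excess eta g s / kappa
    = - (excess eta (f \o g) s - excess eta g s - excess eta f s) / kappa by ring.
  rewrite normrM normfV normrN (gtr0_norm k0) ler_pdivrMr // => h.
  by apply: (le_trans h); lra.
move=> f Hf; have [s0 hs0] := excess_bound cov Hf k0 hk; exists s0 => s /hs0.
set d := l (f x0) - l x0 => h.
have -> : - excess eta f s / kappa - d = - (excess eta f s + kappa * d) / kappa.
  by field; rewrite gt_eqF.
by rewrite normrM normfV normrN (gtr0_norm k0) ler_pdivrMr // [X in _ <= X]mulrC.
Qed.

(** The defect of additivity of [approximate_hom] is proportional to the scale
    eta while the distance to the displacement of l stays bounded, so a limit
    as eta tends to 0 is an exact homomorphism. *)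
Lemma displacement_hom :
  (forall eta, 0 < eta -> exists k, covers eta (shell 0 1) k) ->
  exists rho : (T -> T) -> R,
    (forall f g, H f -> H g -> rho (f \o g) = rho f + rho g) /\
    (forall f, H f -> `|rho f - (l (f x0) - l x0)| <= c + 2).
Proof.
move=> cov.
have e0 (k : nat) : 0 < k.+1%:R^-1 :> R by rewrite invr_gt0 ltr0n.
have [v hv] := choice (fun k => approximate_hom (e0 k) (cov _ (e0 k))).
have [U [hU hoo]] := nat_ultra.
have UF : ProperFilter U := @ultra_proper _ _ hU.
pose disp f := l (f x0) - l x0.
have limit (w : nat -> (T -> T) -> R) :
    (forall f, H f -> U [set j | `|w j f - disp f| <= c + 2]) ->
    exists r : (T -> T) -> R, forall f, H f ->
      (forall e, 0 < e -> U [set j | `|r f - w j f| < e]) /\ `|r f - disp f| <= c + 2.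
  move=> hw; have ex f : exists q, H f ->
      (forall e, 0 < e -> U [set j | `|q - w j f| < e]) /\ `|q - disp f| <= c + 2.
    have [Hf|Hf] := pselect (H f); last by exists 0.
    by have [q hq] := ultra_lim_near hU (hw f Hf); exists q.
  by have [r hr] := choice ex; exists r.
(* the threshold on the depth depends on the maps, so at each scale the limit
   over the depth is taken first *)
have vU k f : H f -> U [set j : nat | `|v k f j%:R - disp f| <= c + 2].
  move=> Hf; have [s0 hs0] := (hv k).2 f Hf.
  apply: filterS (ultra_nat hU hoo s0) => j /= /hs0 h.
  by apply: (le_trans h); rewrite lerD2l ger_pMr // invf_le1 ?ltr0n // ler1n.
have [r hr] := choice (fun k => limit (fun j f => v k f j%:R) (vU k)).
have [rho hrho] : exists rho : (T -> T) -> R, forall f, H f ->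
    (forall e, 0 < e -> U [set k | `|rho f - r k f| < e]) /\ `|rho f - disp f| <= c + 2.
  by apply: limit => f Hf; apply: filterE => k; case: (hr k f Hf).
exists rho; split; last by move=> f /hrho[].
move=> f g Hf Hg; have Hfg := H_comp Hf Hg.
have radd k : `|r k (f \o g) - (r k f + r k g)| <= 16 * k.+1%:R^-1.
  have := (hv k).1 f g Hf Hg; move: (k.+1%:R^-1) => ek [s0 hs0].
  apply/ler_addgt0Pr => e ep; have e3 : 0 < e / 3 by rewrite divr_gt0.
  have [h1 _] := hr k _ Hfg; have [h2 _] := hr k _ Hf; have [h3 _] := hr k _ Hg.
  have [j [/= [a1 a2] [a3 a4]]] := filter_ex (filterI (filterI (h1 _ e3) (h2 _ e3))
    (filterI (h3 _ e3) (ultra_nat hU hoo s0))).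
  have := hs0 _ a4; move: a1 a2 a3; rewrite !ltr_norml !ler_norml; lra.
apply: (@eq_small _ _ _ 19) => e ep.
have [h1 _] := hrho _ Hfg; have [h2 _] := hrho _ Hf; have [h3 _] := hrho _ Hg.
have [k [/= [a1 a2] [a3 a4]]] := filter_ex (filterI (filterI (h1 _ ep) (h2 _ ep))
  (filterI (h3 _ ep) (ultra_inv hU hoo ep))).
have := radd k; move: a1 a2 a3 a4; move: (k.+1%:R^-1) => ek.
rewrite !ltr_norml !ler_norml; lra.
Qed.

End CoveringCounts.

(** * Total boundedness of the Heisenberg group *)

Section TotallyBounded.
Variables (R : realType) (m : nat).
Local Notation heis := (heis R m).
Implicit Types (x y z : heis) (r e : R).

Lemma hdist_coord r e : 0 < e -> exists2 d, 0 < d & forall x y, nr x.1 <= r ->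
  nr (x.1 - y.1) < d -> `|x.2 - y.2| < d -> hdist x y <= e.
Proof.
move=> e0; pose d := Num.min e (e ^+ 2 / (1 + 2 * `|r|)).
have e2 : 0 < e ^+ 2 by rewrite exprn_gt0.
have r0 := normr_ge0 r; have rr := ler_norm r.
have D0 : 0 < 1 + 2 * `|r| by lra.
have d0 : 0 < d by rewrite lt_min e0 divr_gt0.
have [d1 d2] : d <= e /\ d <= e ^+ 2 / (1 + 2 * `|r|).
  by rewrite !ge_min !lexx orbT.
exists d => // x y xr h1 h2.
rewrite /hdist gauge_le; last exact: ltW.
apply/andP; split=> /=.
  by rewrite (addrC (- x.1)) (nrB y.1) (le_trans (ltW h1)).
have -> : om y.1 (- x.1) = om (x.1 - y.1) x.1.
  by rewrite omNr omDl omNl om_diag; ring.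
have h3 := om_normle (x.1 - y.1) x.1.
have h4 : nr (x.1 - y.1) * nr x.1 <= d * `|r|.
  by apply: ler_pM; rewrite ?nr_ge0 //; lra.
have h5 : d * (1 + 2 * `|r|) <= e ^+ 2 by rewrite -ler_pdivlMr.
have := ler_normD (- (x.2 - y.2)) (2 * om (x.1 - y.1) x.1).
rewrite normrN normrM ger0_norm // opprB (addrC (- x.2)); lra.
Qed.

(** Otherwise choose points greedily; bounded sequences of coordinates have limits
    along an ultrafilter, so two of the points are close. *)
Lemma totally_bounded r e : 0 < e ->
  exists s : seq heis, forall x, gauge x <= r -> exists2 y, y \in s & hdist y x < e.
Proof.
move=> e0; apply: contrapT => H.
have ex (s : seq heis) : exists x, gauge x <= r /\ forall y, y \in s -> e <= hdist y x.
  apply: contrapT => Hs; apply: H; exists s => x xr.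
  apply: contrapT => Hx; apply: Hs; exists x; split=> // y ys.
  by rewrite leNgt; apply/negP => yx; apply: Hx; exists y.
have [F hF] := choice ex.
pose xs := fix xs j := if j is j'.+1 then F (xs j') :: xs j' else [::].
have mem i j : (i < j)%N -> F (xs i) \in xs j.
  elim: j => // j IH; rewrite ltnS leq_eqVlt => /orP[/eqP->|/IH h] /=.
    by rewrite inE eqxx.
  by rewrite inE h orbT.
pose x j := F (xs j).
have [U [hU hoo]] := nat_ultra.
have UF : ProperFilter U := @ultra_proper _ _ hU.
have xr j : gauge (x j) <= r by case: (hF (xs j)).
have b1 : U [set j | nr (x j).1 <= r].
  by apply: filterE => j /=; exact: le_trans (nr_le_gauge _) (xr j).
have b2 : U [set j | `|(x j).2| <= r ^+ 2].
  apply: filterE => j /=; apply: (le_trans (snd_le_gauge _)).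
  by rewrite ler_pXn2r ?nnegrE ?gauge_ge0 // (le_trans (gauge_ge0 (x j))).
have [z hz] := ultra_limV hU b1; have [t ht] := ultra_lim hU b2.
have e20 : 0 < e / 3 by rewrite divr_gt0.
have zr : nr z <= r.
  by apply: (ultra_nr_le hU hz) => j; exact: le_trans (nr_le_gauge _) (xr j).
have [d d0 hd] := hdist_coord r e20.
have near : U [set j | hdist (z, t) (x j) <= e / 3].
  by apply: filterS (filterI (hz d d0) (ht d d0)) => j [/= h1 h2]; apply: hd.
have [i hi] := filter_ex near.
have [j ij hj] := ultra_ex hU hoo i.+1 near.
have [_ far] := hF (xs j); have := far _ (mem _ _ ij).
have := hdist_tri (z, t) (x i) (x j); rewrite (hdistC (x i) (z, t)).
move: hi hj; rewrite /= -/(x i) -/(x j); lra.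
Qed.

End TotallyBounded.

(** * The scaling homomorphism and the invariant metric *)

Section ScalingHomomorphism.
Variables (R : realType) (m : nat).
Local Notation heis := (heis R m).
Local Notation bdry := (HC_boundary R (1 + m)).
Variable G : set (bdry -> bdry).
Hypotheses (convG : convergence_group G) (ConfG : @Conf R (1 + m) `<=` G).
Implicit Types (a x y z : heis) (s r : R) (k : heis -> heis).
Local Notation acts := (acts G).

Definition e1 : heis := (0, 1).

Lemma gauge_e1 : gauge e1 = 1.
Proof. by rewrite /gauge /= nr0 normr1 sqrtr1; apply/max_idPr. Qed.

(** The logarithm of the gauge is finite only off the origin. *)
Definition pointed := {x : heis | x != h0}.

Lemma e1_neq0 : e1 != h0.
Proof. by apply/eqP => e; have := gauge_e1; rewrite e gauge0 => /eqP; rewrite eq_sym oner_eq0. Qed.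

Definition lgauge (x : pointed) : R := ln (gauge (val x)).

Definition restricts (f : pointed -> pointed) k := forall x : pointed, val (f x) = k (val x).
Definition pstab : set (pointed -> pointed) :=
  [set f | exists k, [/\ acts k, k h0 = h0 & restricts f k]].

Lemma restriction k : acts k -> k h0 = h0 -> exists f, restricts f k.
Proof.
move=> ka k0; have kn (x : pointed) : k (val x) != h0.
  apply/eqP => e; have := valP x; apply/negP; rewrite negbK; apply/eqP.
  by apply: (acts_inj convG ka); rewrite e k0.
by exists (fun x : pointed => exist _ (k (val x)) (kn x)).
Qed.

Lemma gauge_pointed (x : pointed) : 0 < gauge (val x).
Proof. by apply: gauge_gt0; exact/eqP/(valP x). Qed.

(** An application of [displacement_hom] to the logarithm of the gauge.
    Quasi-similarity shows that sets of small diameter in the shell remain small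
    under the group, relative to their distance to the origin; finitely many
    cover the shell by total boundedness. *)
Lemma pstab_hom : exists (rho : (heis -> heis) -> R) (c : R),
  (forall k k', acts k -> acts k' -> k h0 = h0 -> k' h0 = h0 ->
     rho (k \o k') = rho k + rho k') /\
  (forall k, acts k -> k h0 = h0 -> forall x, x <> h0 ->
     `|rho k - (ln (gauge (k x)) - ln (gauge x))| <= c).
Proof.
have [C C1 hC] := quasi_similarity0 convG ConfG.
have [C' C'1 hC'] := quasi_similarity convG ConfG.
have C0 : 0 < C by apply: lt_le_trans C1.
have C'0 : 0 < C' by apply: lt_le_trans C'1.
have quasi (f : pointed -> pointed) (x y : pointed) : pstab f ->
    (lgauge (f x) - lgauge x) - (lgauge (f y) - lgauge y) <= ln C.
  move=> [k [ka k0 fk]]; have := hC k ka k0 (val x) (val y).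
  have gx := gauge_pointed x; have gy := gauge_pointed y.
  have gfx := gauge_pointed (f x); have gfy := gauge_pointed (f y).
  rewrite -!fk -ler_ln ?posrE ?mulr_gt0 // !lnM ?posrE ?mulr_gt0 // /lgauge; lra.
have dex u : exists f, restricts f (hdil (expR u)).
  by apply: restriction; [exact: (acts_dil ConfG (expR_gt0 u))|exact: hdil_h0].
have [dil dilE] := choice dex.
have dilH u : pstab (dil u).
  by exists (hdil (expR u)); split; [exact: (acts_dil ConfG (expR_gt0 u))|exact: hdil_h0|].
have ldil u (x : pointed) : lgauge (dil u x) = lgauge x + u.
  rewrite /lgauge dilE gauge_dil ?expR_ge0 // lnM ?posrE ?expR_gt0 ?gauge_pointed //.
  by rewrite expRK addrC.
have Hid : pstab id by exists id; split=> //; exact: (acts_id convG).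
have Hcomp f g : pstab f -> pstab g -> pstab (f \o g).
  move=> [k [ka k0 fk]] [k' [k'a k'0 gk']]; exists (k \o k'); split.
  - exact: (acts_comp convG ka k'a).
  - by rewrite /= k'0 k0.
  - by move=> x /=; rewrite fk gk'.
have Hinv f : pstab f -> exists g, [/\ pstab g, cancel f g & cancel g f].
  move=> [k [ka k0 fk]]; have [k' [k'a kK k'K]] := acts_inv convG ka.
  have k'0 : k' h0 = h0 by rewrite -{1}k0 kK.
  have [g gk'] := restriction k'a k'0; exists g; split; first by exists k'.
    by move=> x; apply: val_inj; rewrite gk' fk kK.
  by move=> x; apply: val_inj; rewrite fk gk' k'K.
pose p1 : pointed := exist _ e1 e1_neq0.
have cov eta : 0 < eta -> exists j, covers lgauge pstab eta (shell lgauge 0 1) j.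
  move=> eta0; pose d := (1 - expR (- eta)) / C'.
  have x1 : expR (- eta) < 1 by rewrite expR_lt1; lra.
  have d0 : 0 < d by rewrite divr_gt0 // subr_gt0.
  have d20 : 0 < d / 2 by rewrite divr_gt0.
  have [s hs] := totally_bounded m (expR 1) d20.
  exists (size s), 'I_(size s), (fun i : 'I_(size s) => [set x : pointed |
    shell lgauge 0 1 x /\ hdist (nth h0 s i) (val x) < d / 2]); split.
  - by rewrite card_ord.
  - move=> i f [k [ka k0 fk]] x y [/andP[lx _] hx] [_ hy].
    have gx := gauge_pointed x; have gfx := gauge_pointed (f x).
    have gfy := gauge_pointed (f y).
    have gx1 : 1 <= gauge (val x) by move: lx; rewrite -ln1 ler_ln ?posrE.
    have xy : hdist (val x) (val y) < d.
      have := hdist_tri (nth h0 s i) (val x) (val y); rewrite (hdistC (val x) (nth h0 s i)); lra.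
    have := hC' k ka (val x) (val y) h0 (val x); rewrite k0 !hdist0 -!fk => q.
    have q1 : hdist (val (f x)) (val (f y)) <= (1 - expR (- eta)) * gauge (val (f x)).
      have h1 : hdist (val (f x)) (val (f y)) <=
          hdist (val (f x)) (val (f y)) * gauge (val x).
        by rewrite ler_peMr ?hdist_ge0.
      apply: (le_trans h1); apply: (le_trans q).
      have -> : 1 - expR (- eta) = C' * d by rewrite /d mulrC divfK // gt_eqF.
      by rewrite -mulrA ler_pM2l // mulrC ler_pM2r // ltW.
    have := gauge_hdist (val (f x)) (val (f y)); rewrite ler_norml => /andP[_ q2].
    have q3 : expR (- eta) * gauge (val (f x)) <= gauge (val (f y)) by lra.
    move: q3; rewrite -ler_ln ?posrE ?mulr_gt0 ?expR_gt0 //.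
    by rewrite lnM ?posrE ?expR_gt0 // expRK /lgauge; lra.
  - move=> x /[dup] sx /andP[_ lx].
    have gx := gauge_pointed x.
    have gxe : gauge (val x) <= expR 1 by rewrite -(lnK (x := gauge (val x))) ?posrE // ler_expR.
    have [y ys yx] := hs _ gxe; have i : (index y s < size s)%N by rewrite index_mem.
    by exists (Ordinal i); split=> //; rewrite /= nth_index.
have [rho [rhoM rhoB]] := displacement_hom p1 Hid Hcomp Hinv quasi dilH ldil cov.
have rex k : exists f, acts k -> k h0 = h0 -> restricts f k.
  have [[ka k0]|H] := pselect (acts k /\ k h0 = h0); last by exists id => ka k0; case: H.
  by have [f fk] := restriction ka k0; exists f.
have [res hres] := choice rex.
exists (rho \o res), (ln C + 2 + ln C); split.
  move=> k k' ka k'a k0 k'0 /=; rewrite -rhoM; last 2 first.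
  - by exists k; split=> //; exact: hres.
  - by exists k'; split=> //; exact: hres.
  congr rho; apply/funext => x; apply: val_inj; rewrite /= (hres k) // (hres k') // hres //=.
    exact: (acts_comp convG ka k'a).
  by rewrite k'0 k0.
move=> k ka k0 x /eqP xn /=; pose px : pointed := exist _ x xn.
have Hf : pstab (res k) by exists k; split=> //; exact: hres.
have := rhoB _ Hf; have := quasi _ px p1 Hf; have := quasi _ p1 px Hf.
have E : lgauge (res k px) = ln (gauge (k x)) by rewrite /lgauge hres.
have E' : lgauge px = ln (gauge x) by [].
rewrite E E' !ler_norml; lra.
Qed.

(** Maps at sublinear distance from each other near infinity.  Translations are
    such maps for the identity, so this relation removes the base point. *)
Definition asymp k k' := forall e : R, 0 < e -> exists M, forall x, M <= gauge x ->
  hdist (k x) (k' x) <= e * gauge x.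

Lemma acts_lipschitz k : acts k -> exists2 L, 0 < L &
  forall x y, hdist (k x) (k y) <= L * hdist x y.
Proof.
move=> ka; have [C C1 hC] := quasi_similarity convG ConfG.
have C0 : 0 < C by apply: lt_le_trans C1.
have ke : 0 < hdist (k h0) (k e1).
  by apply: hdist_gt0 => /(acts_inj convG ka)/esym/eqP; rewrite (negbTE e1_neq0).
exists (C * hdist (k h0) (k e1)); first by rewrite mulr_gt0.
by move=> x y; have := hC k ka x y h0 e1; rewrite hdist0 gauge_e1 mulr1 mulrA.
Qed.

Lemma asymp_refl k : asymp k k.
Proof.
move=> e e0; exists 0 => x x0; rewrite hdistxx mulr_ge0 //; exact: ltW.
Qed.

Lemma asymp_sym k k' : asymp k k' -> asymp k' k.
Proof. by move=> h e /h[M hM]; exists M => x; rewrite hdistC; exact: hM. Qed.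

Lemma asymp_trans k2 k1 k3 : asymp k1 k2 -> asymp k2 k3 -> asymp k1 k3.
Proof.
move=> h1 h2 e e0; have e20 : 0 < e / 2 by rewrite divr_gt0.
have [M1 hM1] := h1 _ e20; have [M2 hM2] := h2 _ e20.
exists (Num.max M1 M2) => x; rewrite ge_max => /andP[x1 x2].
have := hdist_tri (k2 x) (k1 x) (k3 x); have := hM1 x x1; have := hM2 x x2; lra.
Qed.

Lemma asymp_comp k1 k2 j1 j2 : acts k1 -> acts j2 -> asymp k1 k2 -> asymp j1 j2 ->
  asymp (k1 \o j1) (k2 \o j2).
Proof.
move=> k1a j2a hk hj e e0.
have [L L0 hL] := acts_lipschitz k1a; have [L2 L20 hL2] := acts_lipschitz j2a.
have [j' [j'a jK j'K]] := acts_inv convG j2a; have [L3 L30 hL3] := acts_lipschitz j'a.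
pose b := gauge (j2 h0).
have d1 : 0 < e / (2 * L) by rewrite divr_gt0 // mulr_gt0.
have d2 : 0 < e / (2 * (L2 + 1)) by rewrite divr_gt0 // mulr_gt0 // ltr_wpDr.
have [M1 hM1] := hj _ d1; have [M2 hM2] := hk _ d2.
have b0 : 0 <= b by exact: gauge_ge0.
have q0 : 0 <= L3 * (`|M2| + b) by rewrite mulr_ge0 ?addr_ge0 // ltW.
exists (`|M1| + b + L3 * (`|M2| + b)) => x hx /=.
have x1 : M1 <= gauge x by have := ler_norm M1; lra.
have xb : b <= gauge x by have := normr_ge0 M1; lra.
have x2 : L3 * (`|M2| + b) <= gauge x by have := normr_ge0 M1; lra.
have up : gauge (j2 x) <= (L2 + 1) * gauge x.
  have := hL2 h0 x; rewrite hdist0; have := hdist_tri (j2 h0) h0 (j2 x).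
  by rewrite !hdist0 -/b; lra.
have low : M2 <= gauge (j2 x).
  have := hL3 (j2 h0) (j2 x); rewrite !jK hdist0 => h.
  have : L3 * (`|M2| + b) <= L3 * hdist (j2 h0) (j2 x) by lra.
  rewrite ler_pM2l // => h'.
  have := hdist_tri h0 (j2 h0) (j2 x); rewrite (hdistC (j2 h0) h0) !hdist0 -/b.
  have := ler_norm M2; lra.
have := hdist_tri (k1 (j2 x)) (k1 (j1 x)) (k2 (j2 x)).
have := hM2 _ low; have := hL (j1 x) (j2 x); have := hM1 _ x1.
set g := gauge x; set A := hdist (j1 x) (j2 x) => a1 a2 a3 a4.
have b1 : L * A <= e / 2 * g.
  have : L * A <= L * (e / (2 * L) * g) by rewrite ler_pM2l.
  by have -> : L * (e / (2 * L) * g) = e / 2 * g by field; rewrite gt_eqF.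
have b2 : e / (2 * (L2 + 1)) * gauge (j2 x) <= e / 2 * g.
  have : e / (2 * (L2 + 1)) * gauge (j2 x) <= e / (2 * (L2 + 1)) * ((L2 + 1) * g).
    by rewrite ler_pM2l.
  have -> : e / (2 * (L2 + 1)) * ((L2 + 1) * g) = e / 2 * g => //.
  by field; rewrite gt_eqF // ltr_wpDr.
lra.
Qed.

Lemma asymp_trans_id a : asymp (hmul a) id.
Proof.
move=> e e0.
pose A := nr a.1; pose B := `|a.2|.
have A0 : 0 <= A by exact: nr_ge0.
have B0 : 0 <= B by exact: normr_ge0.
have e20 : 0 < e ^+ 2 by rewrite exprn_gt0.
have q1 : 0 <= A / e by rewrite divr_ge0 // ltW.
have q2 : 0 <= (B + 4 * A) / e ^+ 2 by rewrite divr_ge0 ?(ltW e20) //; lra.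
exists (A / e + 1 + (B + 4 * A) / e ^+ 2) => x; set g := gauge x => hx.
have x1 : A / e <= g by lra.
have x2 : 1 <= g by lra.
have x3 : (B + 4 * A) / e ^+ 2 <= g by lra.
have g0 : 0 <= g by lra.
rewrite hdistC /hdist gauge_le /= ?mulr_ge0 ?(ltW e0) //; apply/andP; split.
  by rewrite addrCA addNr addr0 -/A; move: x1; rewrite ler_pdivrMr // mulrC.
have -> : - x.2 + (a.2 + x.2 + 2 * om x.1 a.1) + 2 * om (a.1 + x.1) (- x.1)
  = a.2 + 4 * om x.1 a.1.
  by rewrite omNr omDl om_diag (omC a.1); ring.
have h1 := ler_normD a.2 (4 * om x.1 a.1); rewrite normrM ger0_norm // in h1.
have h2 := om_normle x.1 a.1.
have h3 : nr x.1 * nr a.1 <= g * A by rewrite ler_wpM2r // nr_le_gauge.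
have h4 : (B + 4 * A) <= g * e ^+ 2 by rewrite -ler_pdivrMr.
have h5 : B <= B * g by rewrite ler_peMr.
have h6 : (B + 4 * A) * g <= g * e ^+ 2 * g by rewrite ler_wpM2r.
have -> : (e * g) ^+ 2 = g * e ^+ 2 * g by ring.
by rewrite -/B in h1; rewrite -/A in h2 h3; lra.
Qed.

(** The map is moved by a translation into the stabilizer of the origin. *)
Definition centered k := hmul (hinv (k h0)) \o k.

Lemma centered_acts k : acts k -> acts (centered k).
Proof. by move=> ka; apply: (acts_comp convG) => //; exact: (acts_trans ConfG). Qed.

Lemma centered0 k : centered k h0 = h0.
Proof. by rewrite /centered /= hmulVl. Qed.

Lemma centered_id k : k h0 = h0 -> centered k = k.
Proof.
by move=> k0; apply/funext => x; rewrite /centered /= k0 /hinv /= !oppr0 hmul0l.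
Qed.

Lemma asymp_centered k : acts k -> asymp (centered k) k.
Proof.
move=> ka; have := asymp_comp (acts_trans ConfG (hinv (k h0))) ka
  (asymp_trans_id (hinv (k h0))) (asymp_refl k).
by [].
Qed.

Lemma asymp_iter k k' j : acts k -> acts k' -> asymp k k' -> asymp (iter j k) (iter j k').
Proof.
move=> ka k'a h; elim: j => [|j IH]; first exact: asymp_refl.
exact: (asymp_comp ka (acts_iter convG j k'a) h IH).
Qed.

(** Take [rho k] to be the value of the homomorphism of [pstab_hom] at [centered k].
    It is additive because asymptotic maps fixing the origin have the same
    value: their iterates remain asymptotic, so the two values, multiplied by
    any j, stay at bounded distance. *)
Lemma scaling_hom : exists (rho : (heis -> heis) -> R) (c : R),
  [/\ (forall k k', acts k -> acts k' -> rho (k \o k') = rho k + rho k'),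
     (forall k, acts k -> forall x y,
        hdist (k x) (k y) <= expR (c + rho k) * hdist x y),
     (forall a, rho (hmul a) = 0) &
     (forall k s, acts k -> 0 < s -> k h0 = h0 -> (forall x, gauge (k x) = s * gauge x) ->
        rho k = ln s)].
Proof.
have [rho [c [rhoM rhoB]]] := pstab_hom.
have rho_id : rho id = 0.
  have ia := acts_id convG.
  by have := rhoM id id ia ia erefl erefl; rewrite (_ : id \o id = id) //; lra.
have rho_iter k j : acts k -> k h0 = h0 -> rho (iter j k) = j%:R * rho k.
  move=> ka k0; elim: j => [|j IH].
    by rewrite mul0r -rho_id.
  have it0 : iter j k h0 = h0 by elim: j {IH} => //= j ->.
  have := rhoM k (iter j k) ka (acts_iter convG j ka) k0 it0.
  by rewrite IH -natr1 mulrDl mul1r addrC => <-.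
have lin (d b : R) : (forall j, j%:R * d <= b) -> d <= 0.
  move=> h; rewrite leNgt; apply/negP => d0.
  have b0 : 0 <= b by have := h 0%N; rewrite mul0r.
  have b1 : 0 <= b / d by rewrite divr_ge0 // ltW.
  have := archi_boundP b1; rewrite ltr_pdivrMr // => h1.
  by have := h (Num.bound (b / d)); rewrite leNgt h1.
have e1n : e1 <> h0 by apply/eqP; exact: e1_neq0.
have half k k' : acts k -> acts k' -> k h0 = h0 -> k' h0 = h0 -> asymp k k' ->
    rho k <= rho k'.
  move=> ka k'a k0 k'0 kk'; rewrite -subr_le0.
  (* at a far point, the gauges of the j-th iterates differ at most by a factor 2 *)
  apply: (lin _ (2 * c + ln 2)) => j.
  have ja := acts_iter convG j ka; have j'a := acts_iter convG j k'a.
  have it0 : iter j k h0 = h0 by elim: j {ja j'a} => //= j ->.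
  have it'0 : iter j k' h0 = h0 by elim: j {ja j'a it0} => //= j ->.
  have [q [qa qK q'K]] := acts_inv convG j'a.
  have [L L0 hL] := acts_lipschitz qa.
  have Li0 : 0 < L^-1 by rewrite invr_gt0.
  have [M hM] := asymp_iter j ka k'a kk' Li0.
  pose x := hdil (`|M| + 1) e1.
  have M1 : 0 < `|M| + 1 by have := normr_ge0 M; lra.
  have gx : gauge x = `|M| + 1 by rewrite gauge_dil ?gauge_e1 ?mulr1 // ltW.
  have xM : M <= gauge x by rewrite gx; have := ler_norm M; lra.
  have xn : x <> h0 by move=> e; move: gx; rewrite e gauge0; lra.
  have := hM x xM; have := hL h0 (iter j k' x).
  rewrite -{1}it'0 !qK !hdist0 => h1 h2.
  have kx : 0 < gauge (iter j k x).
    by apply: gauge_gt0 => e; apply: xn; apply: (acts_inj convG ja); rewrite e it0.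
  have k'x : 0 < gauge (iter j k' x).
    by apply: gauge_gt0 => e; apply: xn; apply: (acts_inj convG j'a); rewrite e it'0.
  have h3 : L^-1 * gauge x <= gauge (iter j k' x) by rewrite mulrC ler_pdivrMr // mulrC.
  have := gauge_hdist (iter j k x) (iter j k' x); rewrite ler_norml => /andP[_ h4].
  have h5 : gauge (iter j k x) <= 2 * gauge (iter j k' x) by lra.
  have h6 : ln (gauge (iter j k x)) <= ln 2 + ln (gauge (iter j k' x)).
    by rewrite -lnM ?posrE // ler_ln ?posrE // mulr_gt0.
  have := rhoB _ ja it0 x xn; have := rhoB _ j'a it'0 x xn.
  rewrite !rho_iter // mulrBr !ler_norml; lra.
have asymp_rho k k' : acts k -> acts k' -> k h0 = h0 -> k' h0 = h0 -> asymp k k' ->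
    rho k = rho k'.
  move=> ka k'a k0 k'0 kk'; apply/eqP; rewrite eq_le !half //.
  exact: asymp_sym.
have [C C1 hC] := quasi_similarity convG ConfG.
have C0 : 0 < C by apply: lt_le_trans C1.
exists (rho \o centered), (c + ln C); split.
- move=> k k' ka k'a /=.
  have cka := centered_acts ka; have ck'a := centered_acts k'a.
  have kk'a := acts_comp convG ka k'a.
  rewrite -rhoM ?centered0 //; apply: asymp_rho; rewrite ?centered0 //=.
  + exact: centered_acts.
  + exact: (acts_comp convG).
  + by rewrite !centered0.
  + apply: asymp_trans (asymp_centered kk'a) _.
    by apply: asymp_comp => //; apply: asymp_sym; exact: asymp_centered.
- move=> k ka x y /=.
  have cka := centered_acts ka.
  have := hC _ cka x y h0 e1; rewrite !hdist0 gauge_e1 mulr1 centered0 hdist0.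
  rewrite /centered /= hdist_mul => h; apply: (le_trans h).
  rewrite mulrA ler_wpM2r ?hdist_ge0 // -/(centered k e1).
  have pe : 0 < gauge (centered k e1).
    by apply: gauge_gt0 => e; apply: e1n; apply: (acts_inj convG cka); rewrite e centered0.
  have := rhoB _ cka (centered0 k) e1 e1n.
  rewrite gauge_e1 ln1 subr0 ler_norml => /andP[h1 h2].
  rewrite -[C * _](lnK (x := C * gauge (centered k e1))) ?posrE ?mulr_gt0 //.
  by rewrite ler_expR lnM ?posrE //; lra.
- move=> a /=; rewrite -[RHS]rho_id; congr rho; apply/funext => x.
  by rewrite /centered /= hmul0r hmulK.
- move=> k s ka s0 k0 ks /=; rewrite centered_id //.
  have gi j : gauge (iter j k e1) = s ^+ j.
    by elim: j => [|j IH]; rewrite ?gauge_e1 // iterS ks IH exprS.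
  have bnd j : `|j%:R * (rho k - ln s)| <= c.
    have ja := acts_iter convG j ka.
    have it0 : iter j k h0 = h0 by elim: j {ja} => //= j ->.
    have := rhoB _ ja it0 e1 e1n.
    by rewrite rho_iter // gi gauge_e1 ln1 subr0 lnXn // -[X in _ - X]mulr_natl mulrBr.
  apply/eqP; rewrite eq_le -subr_le0 -[X in _ && X]subr_le0; apply/andP; split.
    by apply: (lin _ c) => j; have := bnd j; rewrite ler_norml => /andP[].
  by apply: (lin _ c) => j; have := bnd j; rewrite ler_norml !mulrBr => /andP[h1 _]; lra.
Qed.

(** The metric D is the supremum of [expR (- rho k) * hdist (k x) (k y)] over the
    group: composing with a group element permutes the family up to the factor
    [expR (rho k)]. *)
Lemma invariant_metric : exists (rho : (heis -> heis) -> R) (D : heis -> heis -> R) (C : R),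
  [/\ (forall k k', acts k -> acts k' -> rho (k \o k') = rho k + rho k'),
      (forall a, rho (hmul a) = 0),
      (forall k s, acts k -> 0 < s -> k h0 = h0 -> (forall x, gauge (k x) = s * gauge x) ->
        rho k = ln s),
      (forall k, acts k -> forall x y, D (k x) (k y) = expR (rho k) * D x y) &
      [/\ (forall x y, hdist x y <= D x y <= C * hdist x y),
          (forall x y, D x y = D y x) &
          (forall y x z, D x z <= D x y + D y z)]].
Proof.
have [rho [c [rhoM rhoB rhoT rhoS]]] := scaling_hom.
pose S x y := [set expR (- rho k) * hdist (k x) (k y) | k in [set k | acts k]].
have ia := acts_id convG.
have rho_id : rho id = 0.
  by have := rhoM id id ia ia; rewrite (_ : id \o id = id) //; lra.
have ub x y : ubound (S x y) (expR c * hdist x y).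
  move=> _ [k ka <-]; rewrite mulrC -ler_pdivlMr ?expR_gt0 // -expRN opprK.
  by rewrite mulrAC -expRD; exact: rhoB.
have inS k x y : acts k -> S x y (expR (- rho k) * hdist (k x) (k y)) by move=> ka; exists k.
have Sh x y : S x y (hdist x y).
  by exists id => //; rewrite rho_id oppr0 expR0 mul1r.
have hS x y : has_sup (S x y).
  by split; [exists (hdist x y)|exists (expR c * hdist x y); exact: ub].
pose D x y := sup (S x y).
have Dge k x y : acts k -> expR (- rho k) * hdist (k x) (k y) <= D x y.
  by move=> ka; apply: (sup_upper_bound (hS x y)); exact: inS.
have Dle x y b : (forall k, acts k -> expR (- rho k) * hdist (k x) (k y) <= b) -> D x y <= b.
  by move=> h; apply: sup_le_ub; [exists (hdist x y)|move=> _ [k ka <-]; exact: h].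
have half k x y : acts k -> D (k x) (k y) <= expR (rho k) * D x y.
  move=> ka; apply: Dle => j ja.
  have := Dge (j \o k) x y (acts_comp convG ja ka); rewrite rhoM //= => h.
  rewrite -ler_pdivrMl ?expR_gt0 // -expRN mulrA -expRD.
  by have -> : - rho k + - rho j = - (rho j + rho k) by ring.
exists rho, D, (expR c); split=> //.
  move=> k ka x y; apply/eqP; rewrite eq_le half //=.
  have [k' [k'a kK k'K]] := acts_inv convG ka.
  have e : rho k' = - rho k.
    have := rhoM k' k k'a ka; rewrite (_ : k' \o k = id) ?rho_id; last first.
      by apply/funext => z /=; rewrite kK.
    by lra.
  have := half k' (k x) (k y) k'a; rewrite !kK e => h.
  by rewrite -ler_pdivlMl ?expR_gt0 // -expRN.
split.
- move=> x y; apply/andP; split; first by have := sup_upper_bound (hS x y); apply; exact: Sh.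
  by apply: Dle => k ka; apply: ub; exact: inS.
- move=> x y; congr sup; apply/seteqP.
  by split=> _ [k ka <-]; exists k => //; rewrite hdistC.
- move=> y x z; apply: Dle => k ka.
  have := Dge k x y ka; have := Dge k y z ka.
  have : expR (- rho k) * hdist (k x) (k z)
    <= expR (- rho k) * (hdist (k x) (k y) + hdist (k y) (k z)).
    by rewrite ler_pM2l ?expR_gt0 // hdist_tri.
  by rewrite mulrDr; lra.
Qed.

End ScalingHomomorphism.

(** * Transitivity of the unitary group *)

Section UnitaryTransitivity.
Variables (R : realType) (m : nat).
Local Notation V := 'rV[R[i]]_m.
Implicit Types (u v w z : V) (phi : V -> V).

Definition unitary phi := (forall z w, hdot (phi z) (phi w) = hdot z w) /\
  (forall (c : R[i]) z, phi (c *: z) = c *: phi z).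

Definition reflect_along w z : V := z - (2 * (hdot z w / hdot w w)) *: w.

Lemma reflect_unitary w : w != 0 -> unitary (reflect_along w).
Proof.
move=> w0; have ww : hdot w w != 0.
  by rewrite hdot_self; apply/eqP => /(congr1 (@complex.Re R)) /= /eqP;
    rewrite -nr_sqr sqrf_eq0 nr_eq0 (negbTE w0).
have wr : ((hdot w w)^*)%R = hdot w w.
  by rewrite hdot_self; apply: eqC; rewrite ?ReJ ?ImJ //= oppr0.
split=> [z z'|c z]; rewrite /reflect_along.
  rewrite !(hdotDl, hdotDr, hdotNl, hdotNr, hdotZl, hdotZr) !conjM conjV conj2 wr.
  have -> : hdot w z' = ((hdot z' w)^*)%R by rewrite (hdotC z').
  by field.
rewrite hdotZl scalerBr scalerA; congr (_ - _ *: _); ring.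
Qed.

Lemma reflect_involutive w : w != 0 -> involutive (reflect_along w).
Proof.
move=> w0 z; have ww : hdot w w != 0.
  by rewrite hdot_self; apply/eqP => /(congr1 (@complex.Re R)) /= /eqP;
    rewrite -nr_sqr sqrf_eq0 nr_eq0 (negbTE w0).
rewrite /reflect_along hdotDl hdotNl hdotZl -addrA -opprD -scalerDl.
have -> : 2 * (hdot z w / hdot w w) +
  2 * ((hdot z w - 2 * (hdot z w / hdot w w) * hdot w w) / hdot w w) = 0 by field.
by rewrite scale0r subr0.
Qed.

(** Rotate u by a scalar so that its product with v is real; the reflection along
    the difference then exchanges the two vectors. *)
Lemma unitary_transitive u v : nr u = 1 -> nr v = 1 ->
  exists phi phi', [/\ unitary phi, cancel phi phi', cancel phi' phi & phi u = v].
Proof.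
move=> u1 v1.
have [th [th1 thr]] : exists th : R[i], cm th = 1 /\ hdot (th *: u) v = (cm (hdot u v))%:C.
  have [h0|h0] := eqVneq (hdot u v) 0.
    by exists 1; rewrite cm1 scale1r h0 cm0.
  have c0 : 0 < cm (hdot u v) by rewrite cm_gt0.
  exists (((hdot u v)^*)%R / (cm (hdot u v))%:C); split.
    by rewrite cmM cmJ cmV cm_real ger0_norm ?cm_ge0 // divff // gt_eqF.
  rewrite hdotZl mulrAC (mulrC _ (hdot u v)) mulcJ -fmorphV -rmorphM.
  by rewrite expr2 mulfK // gt_eqF.
have th0 : th != 0 by rewrite -cm_gt0 th1.
have thJ : th * (th^*)%R = 1 by rewrite mulcJ th1 expr1n.
have rot : unitary ( *:%R th : V -> V).
  split=> [z w|c z]; first by rewrite hdotZl hdotZr mulrA thJ mul1r.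
  by rewrite !scalerA mulrC.
have rotK : cancel ( *:%R th : V -> V) ( *:%R th^-1).
  by move=> z; rewrite scalerA mulVf // scale1r.
have rotK' : cancel ( *:%R th^-1 : V -> V) ( *:%R th).
  by move=> z; rewrite scalerA divff // scale1r.
have [e|ne] := eqVneq (th *: u) v; first by exists ( *:%R th), ( *:%R th^-1).
pose w := th *: u - v.
have w0 : w != 0 by rewrite subr_eq0.
have [rh rZ] := reflect_unitary w0; have rK := reflect_involutive w0.
exists (reflect_along w \o *:%R th), ( *:%R th^-1 \o reflect_along w); split.
- split=> [z z'|c z] /=; first by rewrite rh; case: rot => ->.
  by case: rot => _ ->; rewrite rZ.
- by move=> z /=; rewrite rK rotK.
- by move=> z /=; rewrite rotK' rK.
(* the product of th u and v is real, so half the square norm of w is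
   1 - t, the product of th u and w *)
have uu : hdot (th *: u) (th *: u) = 1.
  by case: rot => -> _; rewrite hdot_self -nr_sqr u1 expr1n.
have vv : hdot v v = 1 by rewrite hdot_self -nr_sqr v1 expr1n.
have vu : hdot v (th *: u) = (cm (hdot u v))%:C.
  by rewrite hdotC thr; apply: eqC; rewrite ?ReJ ?ImJ //= oppr0.
rewrite /= /reflect_along.
set t := (cm (hdot u v))%:C in thr vu.
have aw : hdot (th *: u) w = 1 - t by rewrite /w hdotDr hdotNr uu thr.
have ww : hdot w w = 2 * (1 - t).
  by rewrite /w hdotDl hdotNl !(hdotDr, hdotNr) uu vv thr vu; ring.
have t1 : 1 - t != 0.
  apply/eqP => t0; move: w0; rewrite -nr_eq0 -sqrf_eq0 nr_sqr /rd ww t0 mulr0.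
  by rewrite eqxx.
have -> : 2 * (hdot (th *: u) w / hdot w w) = 1.
  by rewrite aw ww; field; exact: t1.
by rewrite scale1r /w opprB addrC subrK.
Qed.

End UnitaryTransitivity.

(** * Isometries of a homogeneous metric on the Heisenberg group *)

Section HomogeneousMetric.
Variables (R : realType) (m : nat).
Local Notation V := 'rV[R[i]]_m.
Local Notation heis := (heis R m).
Implicit Types (a x y p q : heis) (z w v u : V) (s t r e : R).
Variables (D : heis -> heis -> R) (C : R) (u0 : V).
Hypothesis u01 : nr u0 = 1.
Hypothesis D_trans : forall a x y, D (hmul a x) (hmul a y) = D x y.
Hypothesis D_dil : forall s x y, 0 < s -> D (hdil s x) (hdil s y) = s * D x y.
Hypothesis D_unitary : forall phi phi' : V -> V, unitary phi ->
  cancel phi phi' -> cancel phi' phi ->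
  forall x y, D (phi x.1, x.2) (phi y.1, y.2) = D x y.
Hypothesis D_bound : forall x y, hdist x y <= D x y <= C * hdist x y.
Hypothesis D_sym : forall x y, D x y = D y x.
Hypothesis D_tri : forall y x q, D x q <= D x y + D y q.

(** The norm of the left invariant metric D. *)
Definition hnorm x := D h0 x.

Lemma D_hnorm x y : D x y = hnorm (hmul (hinv x) y).
Proof. by rewrite /hnorm -(D_trans x h0) hmul0r hmulVK. Qed.

Lemma hnorm_mul x y : hnorm (hmul x y) <= hnorm x + hnorm y.
Proof. by apply: (le_trans (D_tri x _ _)); rewrite lerD2l D_hnorm hmulK. Qed.

Lemma hnorm_inv x : hnorm (hinv x) = hnorm x.
Proof. by rewrite /hnorm -(D_trans x) hmul0r hmulV D_sym. Qed.

Lemma hnorm_dil s x : 0 < s -> hnorm (hdil s x) = s * hnorm x.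
Proof. by move=> s0; rewrite /hnorm -(D_dil _ _ s0) hdil_h0. Qed.

Lemma hnorm_gauge x : gauge x <= hnorm x.
Proof. by have /andP[+ _] := D_bound h0 x; rewrite hdist0. Qed.

Definition c0 := hnorm (u0, 0).
Definition c1 := hnorm (0, 1).

Lemma c0_ge1 : 1 <= c0.
Proof. by apply: le_trans (hnorm_gauge _); rewrite -u01; exact: nr_le_gauge (u0, 0). Qed.

Lemma c1_ge1 : 1 <= c1.
Proof.
apply: le_trans (hnorm_gauge _); rewrite /gauge /= normr1 sqrtr1 le_max lexx orbT; by [].
Qed.

Lemma hnorm0 : hnorm h0 = 0.
Proof.
have := D_bound h0 h0; rewrite hdistxx mulr0 => h; apply/eqP.
by rewrite eq_le andbC.
Qed.

Lemma unitize z : z != 0 -> exists2 u, nr u = 1 & z = (nr z)%:C *: u.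
Proof.
move=> z0; have n0 : nr z != 0 by rewrite nr_eq0.
exists ((nr z)^-1%:C *: z); first by rewrite nrZ ger0_norm ?invr_ge0 ?nr_ge0 // mulVf.
by rewrite scalerA -rmorphM divff // scale1r.
Qed.

Lemma hnorm_hor z : hnorm (z, 0) = c0 * nr z.
Proof.
have [->|z0] := eqVneq z 0; first by rewrite nr0 mulr0; exact: hnorm0.
have [u u1 zu] := unitize z0; have nz : 0 < nr z by rewrite nr_gt0.
have [phi [phi' [ph phK ph'K phu]]] := unitary_transitive u01 u1.
have -> : (z, 0) = hdil (nr z) (u, 0) by rewrite /hdil /= mulr0 -zu.
rewrite hnorm_dil // mulrC; congr (_ * _).
have := D_unitary ph phK ph'K h0 (u0, 0); rewrite /= phu.
by have -> : phi 0 = 0 by rewrite -(scale0r 0) (proj2 ph) !scale0r.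
Qed.

Lemma hnorm_vert t : hnorm (0, t) = c1 * Num.sqrt `|t|.
Proof.
have pos r : 0 < r -> hnorm (0, r) = c1 * Num.sqrt `|r|.
  move=> r0; rewrite gtr0_norm //.
  have -> : ((0, r) : heis) = hdil (Num.sqrt r) (0, 1).
    by rewrite /hdil /= scaler0 mulr1 sqr_sqrtr // ltW.
  by rewrite hnorm_dil ?sqrtr_gt0 // mulrC.
have [t0|t0|->] := ltgtP t 0.
- have -> : ((0, t) : heis) = hinv (0, - t) by rewrite /hinv /= oppr0 opprK.
  by rewrite hnorm_inv pos ?oppr_gt0 // normrN.
- exact: pos.
- by rewrite normr0 sqrtr0 mulr0; exact: hnorm0.
Qed.

Lemma hnorm_le_split z t : hnorm (z, t) <= c0 * nr z + c1 * Num.sqrt `|t|.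
Proof.
have -> : ((z, t) : heis) = hmul (z, 0) (0, t).
  by rewrite /hmul /= om0l mulr0 addr0 addr0 add0r.
by apply: (le_trans (hnorm_mul _ _)); rewrite hnorm_hor hnorm_vert.
Qed.

(** The square of (z, s) is the dilation by 2 of (z, s / 2), so halving the
    vertical coordinate does not increase the norm; in the limit, the norm of a
    point is at least that of its horizontal projection. *)
Lemma hnorm_ge_hor z t : c0 * nr z <= hnorm (z, t).
Proof.
have half s : hnorm (z, s / 2) <= hnorm (z, s).
  have -> : hnorm (z, s / 2) = hnorm (hdil 2 (z, s / 2)) / 2 by rewrite hnorm_dil // mulrAC divff ?mul1r ?pnatr_eq0.
  have -> : hdil 2 (z, s / 2) = hmul (z, s) (z, s).
    rewrite /hdil /hmul /= om_diag; congr pair; last by field.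
    have -> : 2%:C = 1 + 1 :> R[i] by apply: eqC; rewrite ?ReD ?ImD /= ?addr0.
    by rewrite scalerDl scale1r.
  by rewrite ler_pdivrMr //; have := hnorm_mul (z, s) (z, s); lra.
have iterh j : hnorm (z, t / 2 ^+ j) <= hnorm (z, t).
  elim: j => [|j IH]; first by rewrite expr0 divr1.
  have -> : t / 2 ^+ j.+1 = t / 2 ^+ j / 2 by rewrite exprS invfM mulrA mulrAC.
  exact: le_trans (half _) IH.
have c11 := c1_ge1.
apply/ler_addgt0Pr => e e0.
have step j : c0 * nr z <= hnorm (z, t) + c1 * Num.sqrt `|t / 2 ^+ j|.
  rewrite -hnorm_hor; have -> : ((z, 0) : heis) = hmul (z, t / 2 ^+ j) (0, - (t / 2 ^+ j)).
    by rewrite /hmul /= om0l mulr0 addr0 addr0 subrr.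
  by apply: (le_trans (hnorm_mul _ _)); rewrite hnorm_vert normrN lerD2r.
pose b := `|t| / (e / c1) ^+ 2.
have ec : 0 < e / c1 by rewrite divr_gt0 //; lra.
have b0 : 0 <= b by rewrite divr_ge0 // sqr_ge0.
have hb := archi_boundP b0; set j := Num.bound b in hb.
apply: (le_trans (step j)); rewrite lerD2l.
rewrite -ler_pdivlMl; last by lra.
rewrite (mulrC c1^-1) -[X in _ <= X](ger0_norm (ltW ec)) -(sqrtr_sqr (e / c1)) ler_wsqrtr //.
rewrite normrM normfV normrX (ger0_norm (ler0n _ 2)).
have p2 : 0 < 2 ^+ j :> R by rewrite exprn_gt0.
rewrite ler_pdivrMr // mulrC -ler_pdivrMr ?exprn_gt0 // -/b (le_trans (ltW hb)) //.
by rewrite -natrX ler_nat ltnW // ltn_expl.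
Qed.

Lemma D_ge_hor x y : c0 * nr (x.1 - y.1) <= D x y.
Proof. by rewrite D_hnorm nrB; apply: le_trans (hnorm_ge_hor _ _); rewrite /= addrC. Qed.

Lemma D_hor x z : D x (hmul x (z, 0)) = c0 * nr z.
Proof. by rewrite D_hnorm hmulK hnorm_hor. Qed.

(** A vertical shift by r is a conjugation by a horizontal element of length
    r / 4|zeta|, where zeta is the horizontal coordinate: vertical shifts of x
    hardly change its distance to points with a far projection. *)
Lemma fibre_move x r p : 0 < nr (p.1 - x.1) ->
  D (hmul x (0, r)) p <= D x p + c0 * `|r| / (2 * nr (p.1 - x.1)).
Proof.
move=> n0; set n := nr _ in n0 *.
rewrite D_hnorm hinvM -hmulA [D x p]D_hnorm; set q := hmul (hinv x) p.
have q1 : q.1 = p.1 - x.1 by rewrite /= addrC.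
(* the multiple of i zeta for which conjugation by (w, 0) shifts q by - r *)
pose w := (r / (4 * n ^+ 2))%:C *: ('i *: q.1).
have nn : n != 0 by rewrite gt_eqF.
have ow : om w q.1 = r / 4.
  rewrite omZl omiE -nr_sqr q1 -/n; field; exact: nn.
have -> : hmul (hinv (0, r)) q = hmul (w, 0) (hmul q (hinv (w, 0))).
  rewrite /hmul /= oppr0 om0r; congr pair; first by rewrite add0r addrCA subrr addr0.
  by rewrite omNl omDl omNl om_diag (omC w q.1) -[(_ + _ : V)]/q.1 ow; field.
apply: (le_trans (hnorm_mul _ _)).
have h2 := hnorm_mul q (hinv (w, 0)); rewrite hnorm_inv in h2.
have nw : nr w = `|r| / (4 * n).
  have -> : nr w = `|r / (4 * n ^+ 2)| * n.
    rewrite nrZ nrZC q1 -/n.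
    have -> : cm 'i = 1 :> R by rewrite /cm /= expr0n expr1n add0r sqrtr1.
    by rewrite mul1r.
  rewrite normrM normfV (ger0_norm (_ : 0 <= 4 * n ^+ 2)).
    by field; exact: nn.
  by rewrite mulr_ge0 ?sqr_ge0.
have E : c0 * `|r| / (2 * n) = 2 * (c0 * nr w) by rewrite nw; field; exact: nn.
rewrite E; rewrite !hnorm_hor in h2 *; lra.
Qed.

(** Two almost vertical points at distance c0 s from the origin have vertical
    coordinates of size at most about (c0 s / c1)^2, so the distance between them
    is at most about sqrt 2 c0 s. *)
Lemma not_both_vertical : exists2 eps, 0 < eps & forall s p q, 0 < s ->
  hnorm p = c0 * s -> hnorm q = c0 * s -> D p q = 2 * (c0 * s) ->
  eps * s < nr p.1 \/ eps * s < nr q.1.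
Proof.
have c01 := c0_ge1; have c11 := c1_ge1.
pose eps := Num.min (1 / 10) (c0 / (10 * c1)).
have c1p : 0 < 10 * c1 by lra.
have e0 : 0 < eps by rewrite lt_min; apply/andP; split; [lra|apply: divr_gt0; lra].
have [e1 e2] : eps <= 1 / 10 /\ eps * (10 * c1) <= c0.
  by split; [rewrite ge_min lexx|rewrite -ler_pdivlMr // ge_min lexx orbT].
exists eps => // s p q s0 Np Nq Dpq.
have [h|hp] := ltP (eps * s) (nr p.1); first by left.
have [h|hq] := ltP (eps * s) (nr q.1); first by right.
exfalso.
have cs : 0 < c0 * s by rewrite mulr_gt0 //; lra.
have es : eps * s <= s / 10 by have := ler_wpM2r (ltW s0) e1; lra.
have ecs : c0 * (eps * s) <= c0 * s / 10.
  by have := ler_wpM2l (ltW (lt_le_trans ltr01 c01)) es; lra.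
have vert x : hnorm x = c0 * s -> nr x.1 <= eps * s ->
    c1 ^+ 2 * `|x.2| <= (11 / 10 * (c0 * s)) ^+ 2.
  move=> Nx hx.
  have h1 : hnorm (0, x.2) <= c0 * nr x.1 + hnorm x.
    have -> : ((0, x.2) : heis) = hmul (- x.1, 0) x.
      by rewrite /hmul /= omNr om_diag oppr0 mulr0 addr0 add0r addNr.
    by apply: (le_trans (hnorm_mul _ _)); rewrite hnorm_hor nrN.
  rewrite hnorm_vert Nx in h1.
  have h2 : c0 * nr x.1 <= c0 * (eps * s) by rewrite ler_wpM2l //; lra.
  have h3 : c1 * Num.sqrt `|x.2| <= 11 / 10 * (c0 * s) by lra.
  have -> : c1 ^+ 2 * `|x.2| = (c1 * Num.sqrt `|x.2|) ^+ 2 by rewrite exprMn sqr_sqrtr.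
  rewrite ler_pXn2r ?nnegrE ?mulr_ge0 ?sqrtr_ge0 //; lra.
have vp := vert p Np hp; have vq := vert q Nq hq.
move: Dpq; rewrite D_hnorm; set T := hmul (hinv p) q => NT.
have := hnorm_le_split T.1 T.2; rewrite -surjective_pairing NT => h1.
have h2 : nr T.1 <= 2 * (eps * s) by have := nrD (- p.1) q.1; rewrite nrN /=; lra.
have h3 : c0 * nr T.1 <= c0 * (2 * (eps * s)) by rewrite ler_wpM2l //; lra.
have T2 : `|T.2| <= `|p.2| + `|q.2| + 2 * (nr q.1 * nr p.1).
  have := ler_normD (- p.2 + q.2) (2 * om q.1 (- p.1)); have := ler_normD (- p.2) q.2.
  have := om_normle q.1 (- p.1); rewrite nrN !normrN normrM (ger0_norm (ler0n _ 2)) /=; lra.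
have qp : nr q.1 * nr p.1 <= (eps * s) ^+ 2.
  by rewrite expr2; apply: ler_pM; rewrite ?nr_ge0.
have q2 : c1 ^+ 2 * (eps * s) ^+ 2 <= (c0 * s / 10) ^+ 2.
  rewrite -exprMn ler_pXn2r ?nnegrE; last 2 first.
  - by rewrite mulr_ge0 //; [lra|rewrite mulr_ge0 // ltW].
  - by lra.
  - by have := ler_wpM2r (ltW s0) e2; lra.
  by [].
have c12 : 0 <= c1 ^+ 2 by exact: sqr_ge0.
have h4 : c1 ^+ 2 * `|T.2| <= (8 / 5 * (c0 * s)) ^+ 2.
  have a1 := ler_wpM2l c12 T2; have a2 := ler_wpM2l c12 qp.
  have cs2 : 0 <= (c0 * s) ^+ 2 by exact: sqr_ge0.
  move: vp vq q2; rewrite !exprMn; rewrite !exprMn in a1 a2 cs2.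
  move=> vp vq q2; nra.
have h5 : c1 * Num.sqrt `|T.2| <= 8 / 5 * (c0 * s).
  rewrite -(ler_pXn2r (n:=2)) ?nnegrE ?mulr_ge0 ?sqrtr_ge0 //; try lra.
  by rewrite exprMn sqr_sqrtr.
lra.
Qed.

(** Go from x by a horizontal step to the vertical line through q, then to the far
    point p as if from q itself: by [fibre_move] the error tends to 0. *)
Lemma D_le_via x q : exists2 r, 0 <= r & forall p e, 0 < e ->
  r / e < nr (p.1 - q.1) -> D x p <= c0 * nr (q.1 - x.1) + D q p + e.
Proof.
have c01 := c0_ge1; pose y := hmul x (q.1 - x.1, 0).
have [r yE] : exists r, y = hmul q (0, r).
  have y1 : y.1 = q.1 by rewrite /y /= addrC subrK.
  exists (y.2 - q.2); rewrite [LHS]surjective_pairing y1 /hmul /= om0l mulr0 !addr0.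
  by rewrite [in RHS]addrC subrK.
have r0 : 0 <= c0 * `|r| by rewrite mulr_ge0 //; lra.
exists (c0 * `|r|) => // p e e0 far.
have n0 : 0 < nr (p.1 - q.1) by apply: le_lt_trans far; rewrite divr_ge0 // ltW.
have h1 := D_tri y x p; rewrite D_hor in h1.
have h2 := fibre_move r n0; rewrite -yE in h2.
have h3 : c0 * `|r| / (2 * nr (p.1 - q.1)) <= e.
  rewrite ler_pdivrMr ?mulr_gt0 //.
  have h : c0 * `|r| < e * nr (p.1 - q.1) by rewrite -ltr_pdivrMl // mulrC.
  lra.
lra.
Qed.

(** For a far point g p of the curve, the distance c0 (p - s) from g s is at most
    that of the horizontal step to the projection of g t plus c0 (p - t), up to
    a small error. *)
Lemma straight_half (g : R -> heis) (eps : R) : 0 < eps ->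
  (forall s t, D (g s) (g t) = c0 * `|s - t|) ->
  (forall S, exists2 s, S <= s & eps * s < nr (g s).1) ->
  forall s t, s <= t -> t - s <= nr ((g t).1 - (g s).1).
Proof.
move=> e0 gD freq s t st; have c01 := c0_ge1.
have c0p : 0 < c0 by lra.
rewrite -(ler_pM2l c0p); apply/ler_addgt0Pr => e ep.
have [r r0 via] := D_le_via (g s) (g t).
have re0 : 0 <= r / e by rewrite divr_ge0 // ltW.
pose S := Num.max (`|t| + 1) ((nr (g t).1 + 1 + r / e) / eps).
have [p Sp hp] := freq S.
have [p1 p2] : `|t| + 1 <= p /\ (nr (g t).1 + 1 + r / e) / eps <= p.
  by move: Sp; rewrite ge_max => /andP.
rewrite ler_pdivrMr // in p2.
have far : r / e < nr ((g p).1 - (g t).1).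
  by have := nrD ((g p).1 - (g t).1) (g t).1; rewrite subrK; lra.
have h1 := via _ _ ep far; have tp := ler_norm t.
rewrite !gD [`|s - p|]ler0_norm ?[`|t - p|]ler0_norm in h1; lra.
Qed.

(** By [not_both_vertical], one of the two halves of the curve has projections that
    go to infinity, so [straight_half] makes the projection an isometric
    embedding of the line, hence a straight line.  The vertical coordinate of
    the curve changes quadratically slowly and is therefore constant. *)
Lemma straight_line (g : R -> heis) : g 0 = h0 ->
  (forall s t, D (g s) (g t) = c0 * `|s - t|) ->
  nr (g 1).1 = 1 /\ forall s, g s = (s%:C *: (g 1).1, 0).
Proof.
move=> g0 gD; have c01 := c0_ge1; have c0p : 0 < c0 by lra.
have [eps e0 nonvert] := not_both_vertical.
have dist s t : nr ((g s).1 - (g t).1) = `|s - t|.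
  apply/eqP; rewrite eq_le; apply/andP; split.
    by rewrite -(ler_pM2l c0p) -gD; exact: D_ge_hor.
  suff H (a b : R) : a <= b -> b - a <= nr ((g b).1 - (g a).1).
    have [h|h] := leP s t; first by rewrite ler0_norm ?subr_le0 // opprB nrB; exact: H.
    by rewrite gtr0_norm ?subr_gt0 //; apply: H; exact: ltW.
  have [freq|nfreq] := pselect (forall S, exists2 s, S <= s & eps * s < nr (g s).1).
    exact: (straight_half e0 gD freq).
  move=> ab; have gD' s' t' : D (g (- s')) (g (- t')) = c0 * `|s' - t'|.
    by rewrite gD -opprB opprK distrC; congr (_ * `|_|); ring.
  have freq' S : exists2 s, S <= s & eps * s < nr (g (- s)).1.
    have /existsNP[S0 hS0] := nfreq.
    pose s1 := Num.max (Num.max S S0) 1.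
    have [a1 a2 a3] : [/\ S <= s1, S0 <= s1 & 1 <= s1].
      by rewrite /s1 !le_max !lexx !orbT.
    exists s1 => //; have s10 : 0 < s1 by lra.
    have Ng r : hnorm (g r) = c0 * `|r| by rewrite /hnorm -g0 gD sub0r normrN.
    have E1 : hnorm (g s1) = c0 * s1 by rewrite Ng gtr0_norm.
    have E2 : hnorm (g (- s1)) = c0 * s1 by rewrite Ng normrN gtr0_norm.
    have E3 : D (g s1) (g (- s1)) = 2 * (c0 * s1).
      by rewrite gD opprK gtr0_norm ?addr_gt0 //; ring.
    have [h|//] := nonvert _ _ _ s10 E1 E2 E3.
    by case: hS0; exists s1.
  have := straight_half e0 gD' freq' (s := - b) (t := - a).
  by rewrite !opprK lerN2 nrB => /(_ ab); lra.
have n1 : nr (g 1).1 = 1.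
  by have := dist 1 0; rewrite g0 !subr0 normr1.
have first s : (g s).1 = s%:C *: (g 1).1.
  have ns : nr (g s).1 ^+ 2 = s ^+ 2.
    by have := dist s 0; rewrite g0 !subr0 => ->; rewrite real_normK ?num_real.
  have ds : nr ((g s).1 - (g 1).1) ^+ 2 = (s - 1) ^+ 2.
    by rewrite dist real_normK ?num_real.
  apply/eqP; rewrite -subr_eq0 -nr_eq0 -sqrf_eq0.
  move: ns ds; rewrite !nr_sqr !(rdDl, rdDr, rdNl, rdNr, rdZl, rdZr) (rdC (g s).1 (g 1).1).
  have : rd (g 1).1 (g 1).1 = 1 by rewrite -nr_sqr n1 expr1n.
  move=> -> -> h; have {}h : rd (g s).1 (g 1).1 = s by lra.
  by rewrite h; apply/eqP; ring.
split=> // s; rewrite [LHS]surjective_pairing first; congr pair.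
have vdiff (a b : R) : `|(g b).2 - (g a).2| <= c0 ^+ 2 * (a - b) ^+ 2.
  have := snd_le_gauge (hmul (hinv (g a)) (g b)); rewrite /= omNr (first a) (first b).
  rewrite omZl omZr om_diag !mulr0 oppr0 mulr0 addr0 addrC => h; apply: (le_trans h).
  rewrite -[(a - b) ^+ 2]real_normK ?num_real // -exprMn ler_pXn2r ?nnegrE ?gauge_ge0 //.
    by rewrite -gD D_hnorm; exact: hnorm_gauge.
  by rewrite mulr_ge0 //; lra.
have g02 : (g 0).2 = 0 by rewrite g0.
pose K := c0 ^+ 2 * s ^+ 2.
have K0 : 0 <= K by rewrite mulr_ge0 ?sqr_ge0.
(* subdividing [0, s] into n steps bounds the vertical displacement by K / n *)
have bnd n : `|(g s).2| * n.+1%:R <= K.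
  pose d := s / n.+1%:R.
  have n0 : n.+1%:R != 0 :> R by rewrite pnatr_eq0.
  have steps j : `|(g (j%:R * d)).2| <= j%:R * (c0 ^+ 2 * d ^+ 2).
    elim: j => [|j IH]; first by rewrite !mul0r g02 normr0.
    have := vdiff (j%:R * d) (j.+1%:R * d).
    have -> : j%:R * d - j.+1%:R * d = - d by rewrite -natr1; ring.
    rewrite sqrrN -[in X in _ -> X]natr1 => h.
    have := ler_normD ((g (j.+1%:R * d)).2 - (g (j%:R * d)).2) (g (j%:R * d)).2.
    by rewrite subrK -natr1; rewrite -natr1 in h; lra.
  have := steps n.+1; have -> : n.+1%:R * d = s by rewrite /d mulrC divfK.
  move=> h; have n1' : 0 <= n.+1%:R :> R by [].
  have := ler_wpM2r n1' h.
  by have -> : n.+1%:R * (c0 ^+ 2 * d ^+ 2) * n.+1%:R = K by rewrite /d /K; field.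
apply/eqP; rewrite -normr_le0 leNgt; apply/negP => t0.
have q0 : 0 <= K / `|(g s).2| by rewrite divr_ge0.
have := archi_boundP q0; rewrite ltr_pdivrMr // mulrC => h.
have := bnd (Num.bound (K / `|(g s).2|)); rewrite leNgt; apply/negP; rewrite negbK.
by apply: (lt_le_trans h); rewrite ler_pM2l // ler_nat.
Qed.

Definition isometric (k : heis -> heis) := forall x y, D (k x) (k y) = D x y.

Lemma isometric_horizontal k : isometric k -> k h0 = h0 ->
  exists phi : V -> V, [/\ forall z, k (z, 0) = (phi z, 0),
    forall z, nr (phi z) = nr z & forall s z, phi (s%:C *: z) = s%:C *: phi z].
Proof.
move=> kI k0; exists (fun z => (k (z, 0)).1).
have line u : nr u = 1 -> nr (k (u, 0)).1 = 1 /\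
    forall s, k (s%:C *: u, 0) = (s%:C *: (k (u, 0)).1, 0).
  move=> u1; have [||n1 hs] := @straight_line (fun s => k (s%:C *: u, 0)).
  - by rewrite scale0r.
  - move=> s t; rewrite kI D_hnorm /hmul /= omZl omNr omZr om_diag !(mulr0, oppr0, addr0).
    rewrite hnorm_hor -scaleNr -scalerDl.
    have -> : - s%:C + t%:C = (t - s)%:C by rewrite addrC rmorphB.
    by rewrite nrZ u1 mulr1 distrC.
  by rewrite scale1r in n1 hs.
have norm z : k (z, 0) = ((k (z, 0)).1, 0) /\ nr (k (z, 0)).1 = nr z.
  have [->|z0] := eqVneq z 0; first by rewrite -/h0 k0.
  have [u u1 zu] := unitize z0; have [n1 hs] := line u u1.
  rewrite zu hs /=; split=> //.
  by rewrite !nrZ n1 u1.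
split=> [z|z|s z]; [by case: (norm z)|by case: (norm z)|].
have [->|z0] := eqVneq z 0; first by rewrite scaler0 -/h0 k0 /= scaler0.
have [u u1 zu] := unitize z0; have [n1 hs] := line u u1.
by rewrite zu scalerA -rmorphM !hs /= rmorphM scalerA.
Qed.

(** A Busemann function: [rd x.1 v] is the limit of t minus the distance, divided by
    c0, from x to the far point (t v, 0), and the latter is mapped to
    (t phi v, 0). *)
Lemma asymptotic_direction k (phi : V -> V) : isometric k ->
  (forall z, k (z, 0) = (phi z, 0)) -> (forall z, nr (phi z) = nr z) ->
  (forall s z, phi (s%:C *: z) = s%:C *: phi z) ->
  forall x v, nr v = 1 -> rd x.1 v <= rd (k x).1 (phi v).
Proof.
move=> kI kphi phin phiZ x v v1; have c01 := c0_ge1; have c0p : 0 < c0 by lra.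
have pv1 : rd (phi v) (phi v) = 1 by rewrite -nr_sqr phin v1 expr1n.
have vv : rd v v = 1 by rewrite -nr_sqr v1 expr1n.
have key s : - rd (k x).1 (phi v) <= nr (s%:C *: v - x.1) - s.
  rewrite -(ler_pM2l c0p); apply/ler_addgt0Pr => e ep.
  have [r r0 via] := D_le_via x (s%:C *: v, 0).
  pose t := `|s| + 1 + r / e.
  have re0 : 0 <= r / e by rewrite divr_ge0 // ltW.
  have sn := ler_norm s.
  have st : s < t by rewrite /t; lra.
  pose p : heis := (t%:C *: v, 0).
  have np : nr (p.1 - s%:C *: v) = t - s.
    by rewrite /= -scalerBl -rmorphB nrZ v1 mulr1 gtr0_norm // subr_gt0.
  have h2 : D x p <= c0 * nr (s%:C *: v - x.1) + D (s%:C *: v, 0) p + e.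
    by apply: via => //; rewrite np /t; lra.
  have Dsp : D (s%:C *: v, 0) p = c0 * (t - s).
    by rewrite D_hnorm /hmul /= omNr omZl omZr om_diag !(mulr0, oppr0, addr0) hnorm_hor addrC np.
  have h4 := D_ge_hor (k p) (k x); rewrite kI D_sym kphi phiZ /= in h4.
  have h5 : t - rd (k x).1 (phi v) <= nr (t%:C *: phi v - (k x).1).
    have := rd_le (t%:C *: phi v - (k x).1) (phi v).
    by rewrite phin v1 mulr1 rdDl rdNl rdZl pv1 mulr1.
  have h6 : c0 * (t - rd (k x).1 (phi v)) <= c0 * nr (t%:C *: phi v - (k x).1).
    by rewrite ler_pM2l.
  rewrite Dsp in h2; rewrite mulrBr mulrN; lra.
rewrite -lerN2; apply/ler_addgt0Pr => e ep.
pose a := 1 + rd x.1 x.1 / e; pose s := a + rd x.1 v.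
have xx := rd_ge0 x.1.
have re0 : 0 <= rd x.1 x.1 / e by rewrite divr_ge0 // ltW.
have a0 : 0 < a by rewrite /a; lra.
apply: (le_trans (key s)).
rewrite lerBlDr.
have -> : - rd x.1 v + e + s = a + e by rewrite /s; ring.
have ae : 0 <= a + e by lra.
rewrite -(ler_pXn2r (n:=2)) ?nnegrE ?nr_ge0 // nr_sqr.
rewrite !(rdDl, rdDr, rdNl, rdNr, rdZl, rdZr) vv.
have : rd x.1 x.1 <= e * a.
  by rewrite /a mulrDr mulr1 mulrC divfK ?gt_eqF //; lra.
have := sqr_ge0 (rd x.1 v); have := sqr_ge0 e.
rewrite (rdC x.1 v).
have ea : 0 < e * a by rewrite mulr_gt0.
rewrite /s; clearbody a=> ? ? ?; lra.
Qed.

(** The asymptotic inequality for v and - v makes phi orthogonal for the real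
    product and the first coordinate of [k x] equal to [phi x.1].  Composing with
    translations, k maps horizontal cosets to such, so it is an automorphism; on the
    centre it is multiplication by a sign eps, and phi multiplies the
    symplectic form by eps.  The two signs are the unitary and antiunitary cases. *)
Lemma isometry_form k : isometric k -> k h0 = h0 -> forall k', isometric k' ->
  cancel k k' -> cancel k' k ->
  exists (phi phi' : V -> V), [/\ cancel phi phi', cancel phi' phi &
   (unitary phi /\ forall x, k x = (phi x.1, x.2)) \/
   ((forall z w, hdot (phi z) (phi w) = ((hdot z w)^*)%R) /\
    (forall (c : R[i]) z, phi (c *: z) = (c^*)%R *: phi z) /\
    forall x, k x = (phi x.1, - x.2))].
Proof.
move=> kI k0 k' k'I kK k'K.
have k'0 : k' h0 = h0 by rewrite -{1}k0 kK.
have [phi [kphi phin phiZ]] := isometric_horizontal kI k0.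
have [phi' [k'phi phi'n phi'Z]] := isometric_horizontal k'I k'0.
have phK : cancel phi phi'.
  by move=> z; have := kK (z, 0); rewrite kphi k'phi => -[].
have ph'K : cancel phi' phi.
  by move=> z; have := k'K (z, 0); rewrite k'phi kphi => -[].
have phiN z : phi (- z) = - phi z.
  have e (w : V) : (-1)%:C *: w = - w.
    by rewrite -[RHS]scaleN1r rmorphN1.
  by have := phiZ (-1) z; rewrite !e.
have asym x v : rd (k x).1 (phi v) = rd x.1 v.
  have [->|v0] := eqVneq v 0.
    have -> : phi 0 = 0 by apply/eqP; rewrite -nr_eq0 phin nr0.
    by rewrite !rd0r.
  have [u u1 vu] := unitize v0; rewrite vu phiZ !rdZr; congr (_ * _).
  apply/eqP; rewrite eq_le (asymptotic_direction kI kphi phin phiZ) // andbT.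
  have := asymptotic_direction kI kphi phin phiZ x (v := - u).
  by rewrite nrN phiN !rdNr lerN2; exact.
have phird z w : rd (phi z) (phi w) = rd z w.
  by have := asym (z, 0) w; rewrite kphi.
have kfst x : (k x).1 = phi x.1.
  apply/eqP; rewrite -subr_eq0 -nr_eq0 -sqrf_eq0 nr_sqr.
  set d := (k x).1 - phi x.1; rewrite -{2}(ph'K d).
  by rewrite rdDl rdNl asym phird subrr.
have phiD z w : phi (z + w) = phi z + phi w.
  apply/eqP; rewrite -subr_eq0 -nr_eq0 -sqrf_eq0 nr_sqr opprD addrA.
  rewrite !(rdDl, rdDr, rdNl, rdNr) !phird !(rdDl, rdDr); apply/eqP; ring.
have kmul x w : k (hmul x (w, 0)) = hmul (k x) (phi w, 0).
  pose j := hmul (hinv (k x)) \o (k \o hmul x).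
  have jI : isometric j by move=> a b; rewrite /j /= D_trans kI D_trans.
  have j0 : j h0 = h0 by rewrite /j /= hmul0r hmulVl.
  have [psi [jpsi _ _]] := isometric_horizontal jI j0.
  have E : k (hmul x (w, 0)) = hmul (k x) (psi w, 0) by rewrite -jpsi /j /= hmulVK.
  have := congr1 fst E; rewrite kfst /= phiD kfst => /addrI e.
  by rewrite E e.
pose chi t := (k (0, t)).2.
have phi0 : phi 0 = 0 by apply/eqP; rewrite -nr_eq0 phin nr0.
have kE x : k x = (phi x.1, chi x.2).
  have -> : x = hmul (0, x.2) (x.1, 0).
    by rewrite /hmul /= om0r mulr0 addr0 add0r addr0; case: (x).
  rewrite kmul [k (0, x.2)]surjective_pairing kfst /= phi0 /hmul /= !om0r mulr0 !addr0 !add0r.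
  by [].
have chi_om z w : chi (2 * om w z) = 2 * om (phi w) (phi z).
  have := congr1 snd (kmul (z, 0) w); rewrite kE kphi /hmul /= !add0r.
  by [].
pose eps := om (phi ('i *: u0)) (phi u0).
have chiE t : chi t = eps * t.
  have := chi_om u0 ((t / 2)%:C *: ('i *: u0)).
  rewrite phiZ !omZl omiE -nr_sqr u01 expr1n mulr1 -/eps.
  have -> : 2 * (t / 2) = t by field.
  by move=> ->; field.
have om_eps z w : om (phi z) (phi w) = eps * om z w.
  have := chi_om w z; rewrite chiE; lra.
have eps1 : `|eps| = 1.
  have := kI h0 (0, 1); rewrite k0 kE phi0 chiE mulr1 -/(hnorm _) -/(hnorm _) !hnorm_vert normr1 sqrtr1.
  have c11 := c1_ge1; have c1n : c1 != 0 by rewrite gt_eqF //; lra.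
  move=> /(mulfI c1n) h.
  by rewrite -[LHS]sqr_sqrtr // h expr1n.
exists phi, phi'; split=> //.
have scaling (c d : R[i]) z : cm c = cm d -> rd (phi (c *: z)) (d *: phi z) = cm c ^+ 2 * rd z z ->
    phi (c *: z) = d *: phi z.
  move=> cd h; apply/eqP; rewrite -subr_eq0 -nr_eq0 -sqrf_eq0 nr_sqr.
  rewrite !(rdDl, rdDr, rdNl, rdNr) (rdC (phi (c *: z)) (d *: phi z)) h -!nr_sqr nrZC !phin nrZC cd.
  by apply/eqP; ring.
have [e1|e1] : eps = 1 \/ eps = -1.
  by move/eqP: eps1; rewrite eqr_norml ler01 andbT => /orP[]/eqP; [left|right].
- left; have ph z w : hdot (phi z) (phi w) = hdot z w.
    by apply: eqC; [exact: phird|rewrite -/(om _ _) om_eps e1 mul1r].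
  split; last by move=> x; rewrite kE chiE e1 mul1r.
  split=> // c z; apply: scaling => //.
  by rewrite /rd hdotZr ph hdotZl mulrA (mulrC (c^*)%R) mulcJ ReM /= mul0r subr0.
- right; have ph z w : hdot (phi z) (phi w) = ((hdot z w)^*)%R.
    apply: eqC; first by rewrite ReJ; exact: phird.
    by rewrite ImJ -/(om _ _) om_eps e1 mulN1r.
  split=> //; split; last by move=> x; rewrite kE chiE e1 mulN1r.
  move=> c z; apply: scaling; first by rewrite cmJ.
  by rewrite /rd hdotZr ph hdotZl conjM conjCK mulrA mulcJ ReM ReJ /= mul0r subr0.
Qed.

End HomogeneousMetric.

(** * Maximality *)

Section Maximality.
Variables (R : realType) (m : nat).
Local Notation V := 'rV[R[i]]_m.
Local Notation heis := (heis R m).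
Local Notation inf := (inf R m).
Local Notation bdry := (HC_boundary R (1 + m)).
Variable G : set (bdry -> bdry).
Hypotheses (m0 : (0 < m)%N) (convG : convergence_group G) (ConfG : @Conf R (1 + m) `<=` G).

Lemma Conf_comp (f g : bdry -> bdry) :
  @Conf R (1 + m) f -> @Conf R (1 + m) g -> @Conf R (1 + m) (f \o g).
Proof. by case: (Conf_subgroup R (1 + m)) => _ _ c _; exact: c. Qed.

Lemma Conf_cancel (g h : bdry -> bdry) :
  @Conf R (1 + m) g -> @Conf R (1 + m) (g \o h) -> @Conf R (1 + m) h.
Proof.
move=> gC ghC; case: (Conf_subgroup R (1 + m)) => hom _ c inv.
have [_ [g' [gK g'K _]]] := hom _ gC.
have -> : h = g' \o (g \o h) by apply: funext => x /=; rewrite gK.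
by apply: c ghC; exact: inv gC gK g'K.
Qed.

(** Compose h with the dilation that cancels its scaling factor; the result
    is an isometry of the invariant metric. *)
Lemma stabilizer_conformal (h : bdry -> bdry) :
  G h -> h inf = inf -> h (pt h0) = pt h0 -> @Conf R (1 + m) h.
Proof.
move=> hG hi h00.
have [rho [D [C [rhoM rhoT rhoS rhoD [Db Ds Dt]]]]] := invariant_metric convG ConfG.
have [k [_ _ hk]] := acts_of_stab convG hG hi.
have ka : acts G k by exists h.
have k0 : k h0 = h0 by apply: (@pt_inj R m); rewrite -hk.
pose s := expR (rho k); have s0 : 0 < s := expR_gt0 _.
have sV : 0 < s^-1 by rewrite invr_gt0.
have rho_dil r : 0 < r -> rho (hdil r) = ln r.
  move=> r0; apply: (rhoS _ _ (acts_dil ConfG r0) r0); first exact: hdil_h0.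
  by move=> x; rewrite gauge_dil // ltW.
pose k1 := hdil s^-1 \o k.
have k1a : acts G k1 := acts_comp convG (acts_dil ConfG sV) ka.
have k10 : k1 h0 = h0 by rewrite /k1 /= k0 hdil_h0.
have isom j : acts G j -> rho j = 0 -> isometric D j.
  by move=> ja j0 x y; rewrite rhoD // j0 expR0 mul1r.
have rho1 : rho k1 = 0.
  by rewrite rhoM ?rho_dil ?lnV ?posrE //; [rewrite expRK addNr|exact: acts_dil].
have [k2 [k2a k1K k2K]] := acts_inv convG k1a.
have rho_id : rho id = 0.
  have ia := acts_id convG.
  by have := rhoM id id ia ia; rewrite (_ : id \o id = id) //; lra.
have rho2 : rho k2 = 0.
  have := rhoM _ _ k2a k1a; rewrite rho1 addr0 => <-.
  by rewrite (_ : k2 \o k1 = id) //; apply: funext => x /=; rewrite k1K.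
pose u0 : V := delta_mx 0 (Ordinal m0).
have u01 : nr u0 = 1.
  apply/eqP; rewrite -(eqrXn2 (n:=2)) ?nr_ge0 ?ler01 //.
  rewrite nr_sqr /rd /hdot (bigD1 (Ordinal m0)) //= big1.
    by rewrite !mxE !eqxx addr0 conjC1 mulr1 expr1n.
  by move=> i ni; rewrite !mxE (negbTE ni) andbF mul0r.
have Dtrans a x y : D (hmul a x) (hmul a y) = D x y.
  by apply: isom; [exact: acts_trans|exact: rhoT].
have Ddil r x y : 0 < r -> D (hdil r x) (hdil r y) = r * D x y.
  by move=> r0; rewrite rhoD ?rho_dil ?lnK //; exact: acts_dil.
have Duni phi phi' : unitary phi -> cancel phi phi' -> cancel phi' phi ->
    forall x y : heis, D (phi x.1, x.2) (phi y.1, y.2) = D x y.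
  move=> [ph phZ] phK ph'K; apply: isom.
    have [g [gC gi gx]] := Conf_unitary ph phZ phK ph'K.
    by exists g; split=> //; exact: ConfG.
  rewrite -[RHS](ln1 R); apply: rhoS.
  - have [g [gC gi gx]] := Conf_unitary ph phZ phK ph'K.
    by exists g; split=> //; exact: ConfG.
  - exact: ltr01.
  - by rewrite /= -(scale0r 0) phZ !scale0r.
  - by move=> x; rewrite mul1r /gauge /= /nr /rd ph.
have [phi [phi' [phK ph'K form]]] := isometry_form u01 Dtrans Ddil Duni Db Ds Dt
  (isom _ k1a rho1) k10 (isom _ k2a rho2) k1K k2K.
have [c [cC ci cx]] : exists c, [/\ @Conf R (1 + m) c, c inf = inf & forall x, c (pt x) = pt (k1 x)].
  case: form => [[[ph phZ] k1E]|[ph [phZ k1E]]].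
    have [c [cC ci cx]] := Conf_unitary ph phZ phK ph'K.
    by exists c; split=> // x; rewrite cx k1E.
  have [c [cC ci cx]] := Conf_antiunitary ph phZ phK ph'K.
  by exists c; split=> // x; rewrite cx k1E.
have [d [dC di dx]] := Conf_dil m s0.
have -> : h = d \o c; last exact: Conf_comp.
apply: funext => xi /=; have [->|[x ->]] := boundary_chart xi; first by rewrite hi ci di.
by rewrite hk cx dx /k1 /= hdil_comp divff ?gt_eqF // hdil1.
Qed.

(** Conformal maps act transitively on pairs of distinct points, which reduces the
    claim to [stabilizer_conformal]. *)
Lemma Conf_maximal : G `<=` @Conf R (1 + m).
Proof.
case: (convG) => -[_ _ Gc _] _.
have fix_inf g : G g -> g inf = inf -> @Conf R (1 + m) g.
  move=> gG gi; have [k [_ _ gk]] := acts_of_stab convG gG gi.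
  have [t [tC ti tx]] := Conf_trans (hinv (k h0)).
  apply: (Conf_cancel tC); apply: stabilizer_conformal.
  - by apply: Gc => //; exact: ConfG.
  - by rewrite /= gi ti.
  - by rewrite /= gk tx hmulVl.
move=> g gG; have [gi|[x gx]] := boundary_chart (g inf); first exact: fix_inf.
have [t [tC ti tx]] := Conf_trans (hinv x); have [s [sC si s0]] := Conf_swap R m.
have stC := Conf_comp sC tC.
apply: (Conf_cancel stC); apply: fix_inf.
  by apply: Gc => //; exact: ConfG.
by rewrite /= gx tx hmulVl s0.
Qed.

End Maximality.

Theorem theorem3p5 (R : realType) (n : nat) (hn : (1 < n)%N) :
  convergence_group (@Conf R n) /\
  (forall G : set (HC_boundary R n -> HC_boundary R n),
     convergence_group G -> @Conf R n `<=` G -> G = @Conf R n).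
Proof.
split; first exact: Conf_convergence_group.
case: n hn => // m m0 G convG ConfG.
by apply/seteqP; split=> //; exact: Conf_maximal m0 convG ConfG.
Qed.
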